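(* Let $d\ge 3$, let $V\in L_{1,loc}(\mathbf{R}^d)$ with $V\ge 0$, and let $\mathcal{G}\subset\mathbf{R}^d$ be a domain as in the context. Suppose that for some $r_0>0$ there is a function $\tilde\gamma$ on $(0,r_0)$ with $$\forall\, r\in(0,r_0):\ \tilde\gamma(r)\in(0,1),\qquad \limsup_{r\downarrow 0}\, r^{-2(d-2)/d}\,\tilde\gamma(r)=\infty,$$ such that for every $r\in(0,r_0)$, with $\sigma(r)=(1-\tilde\gamma(r))\,\mathrm{mes}_d(\mathcal{G}_r(0))$, $$\lim_{|\mathbf{y}|\to\infty}J_V(\sigma(r),\mathbf{y},r)=\infty .$$ Then the spectrum of the operator $H=-\Delta+V(\mathbf{x})$ is discrete.
   Context: $H=-\Delta+V$ is the Schrödinger operator in $L_2(\mathbf{R}^d)$, understood as usual as the self-adjoint operator associated with the closed quadratic form $\int(|\nabla u|^2+V|u|^2)\,\mathrm{d}\mathbf{x}$. Its spectrum is discrete if it consists only of isolated eigenvalues of finite multiplicity. $\mathcal{G}\subset\mathbf{R}^d$ is a fixed open domain such that (a) $\mathcal{G}$ is bounded and star-shaped with respect to every point of some open ball $B_\rho(0)$, $\rho>0$, contained in $\mathcal{G}$; (b) $\mathrm{diam}(\mathcal{G})=2$. For $r>0$ and $\mathbf{y}\in\mathbf{R}^d$, $\mathcal{G}_r(\mathbf{y})=\{\mathbf{x}\in\mathbf{R}^d: r^{-1}\mathbf{x}\in\mathcal{G}\}+\mathbf{y}$, with closure $\bar{\mathcal{G}}_r(\mathbf{y})$. $\mathrm{mes}_d$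 is Lebesgue measure on $\mathbf{R}^d$. For $t>0$ put $$V_\star(t,\mathbf{y},r)=\sup\{s>0:\ \mathrm{mes}_d(\{\mathbf{x}\in\bar{\mathcal{G}}_r(\mathbf{y}): V(\mathbf{x})\le s\})<t\}\quad(\sup\emptyset=0),$$ $$\mathcal{K}^-(t)=\{\mathbf{x}\in\bar{\mathcal{G}}_r(\mathbf{y}):\ V(\mathbf{x})<V_\star(t,\mathbf{y},r)\},$$ $$J_V(t,\mathbf{y},r)=\int_{\mathcal{K}^-(t)}V(\mathbf{x})\,\mathrm{d}\mathbf{x}+\big(t-\mathrm{mes}_d(\mathcal{K}^-(t))\big)\,V_\star(t,\mathbf{y},r).$$ *)

(* Defs.v *)
From HB Require Import structures.
From mathcomp Require Import all_boot all_order all_algebra.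
From mathcomp Require Import complex.
From mathcomp Require Import all_classical all_reals all_analysis.

Set Implicit Arguments.
Unset Strict Implicit.
Unset Printing Implicit Defensive.
Import Order.TTheory GRing.Theory Num.Theory.
Import numFieldNormedType.Exports.

Local Open Scope classical_set_scope.
Local Open Scope ring_scope.

(* R^d is 'rV[R]_d: the library gives it its topology and vector space
   structure, but its norm `|x| is the sup norm (hence enorm below) and it has
   neither a sigma-algebra nor a Lebesgue measure. *)

Section rV_measurable.
Variables (R : realType) (n : nat).

Let coord (i : 'I_n) (x : 'rV[R]_n) : R := x ord0 i.

Let rV_set0 : g_sigma_preimage coord set0.
Proof. exact: sigma_algebra0. Qed.

Let rV_setC A : g_sigma_preimage coord A -> g_sigma_preimage coord (~` A).
Proof. exact: sigma_algebraC. Qed.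

Let rV_bigcup (F : (set 'rV[R]_n)^nat) :
  (forall i, g_sigma_preimage coord (F i)) ->
  g_sigma_preimage coord (\bigcup_i (F i)).
Proof. exact: sigma_algebra_bigcup. Qed.

(* The product sigma-algebra, i.e. the Borel sigma-algebra of R^n. *)
HB.instance Definition _ := @isMeasurable.Build default_measure_display
  'rV[R]_n (g_sigma_preimage coord) rV_set0 rV_setC rV_bigcup.

Lemma measurable_coord (i : 'I_n) :
  measurable_fun [set: 'rV[R]_n] (fun x : 'rV[R]_n => x ord0 i).
Proof.
move=> _ Y mY; rewrite setTI; apply: sub_sigma_algebra => /=.
rewrite -bigcup_seq/=; exists i => /=; first by rewrite mem_index_enum.
by exists Y => //; rewrite setTI.
Qed.

Lemma measurable_fun_rV d (T : measurableType d) (f : T -> 'rV[R]_n) :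
  (forall i, measurable_fun [set: T] (fun t => f t ord0 i)) ->
  measurable_fun [set: T] f.
Proof.
move=> mf; apply: (@measurability _ _ _ _ _ _
  (\big[setU/set0]_(i < n) preimage_set_system setT (coord i) measurable)) => //.
move=> _ [A + <-]; rewrite -bigcup_seq/= => -[i _ [B mB <-]].
by rewrite !setTI; have := mf i measurableT _ mB; rewrite setTI.
Qed.

End rV_measurable.

Lemma sigma_finite_product d1 d2 (T1 : measurableType d1)
    (T2 : measurableType d2) (R : realType)
    (m1 : {sigma_finite_measure set T1 -> \bar R})
    (m2 : {sigma_finite_measure set T2 -> \bar R}) :
  sigma_finite setT (m1 \x m2)%E.
Proof.
have /sigma_finiteP[F [TF ndF Foo]] := sigma_finiteT m1.
have /sigma_finiteP[G [TG ndG Goo]] := sigma_finiteT m2.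
exists (fun n => F n `*` G n).
  rewrite -setXTT TF TG predeqE => -[x y]; split.
    move=> [/= [n _ Fnx] [k _ Gky]]; exists (maxn n k) => //; split.
    - by move: x Fnx; exact/subsetPset/ndF/leq_maxl.
    - by move: y Gky; exact/subsetPset/ndG/leq_maxr.
  by move=> [n _ []/= ? ?]; split; exists n.
move=> k; have [? ?] := Foo k; have [? ?] := Goo k.
split; first exact: measurableX.
by rewrite product_measure1E// lte_mul_pinfty// ge0_fin_numE.
Qed.

Section lebesgue_rV.
Variable R : realType.

Definition rV_cons n (p : measurableTypeR R * 'rV[R]_n) : 'rV[R]_n.+1 :=
  row_mx (const_mx p.1 : 'rV[R]_1) p.2.

Definition rV_uncons n (x : 'rV[R]_n.+1) : measurableTypeR R * 'rV[R]_n :=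
  (x ord0 ord0, \row_j x ord0 (lift ord0 j)).

Lemma rV_cons0 n p : @rV_cons n p ord0 ord0 = p.1.
Proof. by rewrite mxE; case: splitP => //= j _; rewrite mxE. Qed.

Lemma rV_consS n p j : @rV_cons n p ord0 (lift ord0 j) = p.2 ord0 j.
Proof.
rewrite mxE; case: splitP => [i|k]; first by rewrite (ord1 i).
by rewrite /= /bump/= add1n => -[] /ord_inj ->.
Qed.

Lemma rV_consK n : cancel (@rV_cons n) (@rV_uncons n).
Proof.
case=> a v; congr (_, _); first exact: rV_cons0.
by apply/rowP => j; rewrite mxE rV_consS.
Qed.

Lemma measurable_rV_cons n : measurable_fun setT (@rV_cons n).
Proof.
apply: measurable_fun_rV => i.
rewrite (_ : (fun t => _) = fun p : measurableTypeR R * 'rV[R]_n =>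
    match fintype.split (i : 'I_(1 + n)) with
    inl _ => p.1 | inr k => p.2 ord0 k end); last first.
  by apply/funext => p; rewrite mxE; case: fintype.split => // j; rewrite mxE.
case: fintype.split => j; first exact: measurable_fst.
by apply: (measurableT_comp (measurable_coord j)); exact: measurable_snd.
Qed.

Lemma measurable_rV_uncons n : measurable_fun setT (@rV_uncons n).
Proof.
apply/measurable_fun_pairP; split; first exact: measurable_coord.
apply: measurable_fun_rV => i /=.
by under eq_fun do rewrite mxE; exact: measurable_coord.
Qed.

Section step.
Variables (n : nat) (mu : {sigma_finite_measure set 'rV[R]_n -> \bar R}).

Definition lebesgue_step : set 'rV[R]_n.+1 -> \bar R :=
  pushforward (lebesgue_measure \x mu)%E (@rV_cons n).

Let step0 : lebesgue_step set0 = 0%E.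
Proof. by rewrite /lebesgue_step /pushforward preimage_set0 measure0. Qed.

Let step_ge0 A : (0 <= lebesgue_step A)%E.
Proof. by rewrite /lebesgue_step /pushforward measure_ge0. Qed.

Let step_sigma_additive : semi_sigma_additive lebesgue_step.
Proof.
have mf A : measurable A -> measurable (@rV_cons n @^-1` A).
  by move=> mA; rewrite -[X in measurable X]setTI; exact: measurable_rV_cons.
move=> F mF tF mUF; rewrite /lebesgue_step /pushforward preimage_bigcup.
apply: measure_semi_sigma_additive.
- by move=> k; exact: mf.
- apply/trivIsetP => i j _ _ ij; rewrite -preimage_setI.
  by move/trivIsetP : tF => /(_ _ _ _ _ ij) ->//; rewrite preimage_set0.
- by rewrite -preimage_bigcup; exact: mf.
Qed.

HB.instance Definition _ := isMeasure.Build _ _ _ lebesgue_step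
  step0 step_ge0 step_sigma_additive.

Let lebesgue_step_sigma_finite : sigma_finite setT lebesgue_step.
Proof.
have [F TF Foo] := sigma_finite_product lebesgue_measure mu.
exists (fun k => @rV_uncons n @^-1` F k).
  by rewrite -preimage_bigcup -TF preimage_setT.
move=> k; have [mF Fk] := Foo k; split.
  by rewrite -[X in measurable X]setTI; exact: measurable_rV_uncons.
rewrite /lebesgue_step /pushforward -comp_preimage.
by rewrite (_ : _ \o _ = id) //; apply/funext => p; exact: rV_consK.
Qed.

HB.instance Definition _ := Measure_isSigmaFinite.Build _ _ _ lebesgue_step
  lebesgue_step_sigma_finite.
End step.

Fixpoint lebesgue_rV n : {sigma_finite_measure set 'rV[R]_n -> \bar R} :=
  match n with
  | 0 => \d_(0 : 'rV[R]_0)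
  | n'.+1 => lebesgue_step (lebesgue_rV n')
  end.

Lemma lebesgue_rV_box n (A : 'I_n -> set R) : (forall i, measurable (A i)) ->
  lebesgue_rV n [set x | forall i, A i (x ord0 i)] =
  (\prod_(i < n) (lebesgue_measure (A i : set (measurableTypeR R))))%E.
Proof.
elim: n A => [|n IHn] A mA /=.
  rewrite big_ord0 diracE mem_set//=; by case.
pose B := [set x : 'rV[R]_n | forall i, A (lift ord0 i) (x ord0 i)].
have mB : measurable B.
  rewrite (_ : B = \bigcap_(i in [set: 'I_n])
    ((fun x : 'rV[R]_n => x ord0 i) @^-1` A (lift ord0 i))); last first.
    by apply/seteqP; split=> x /= Bx i; [move=> _; exact: Bx|exact: Bx i I].
  apply: fin_bigcap_measurable => // i _.
  by rewrite -[X in measurable X]setTI; exact: measurable_coord.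
rewrite big_ord_recl -IHn// -product_measure1E//; last exact: mA.
rewrite /lebesgue_step /pushforward; congr (product_measure1 _ _ _).
apply/seteqP; split => -[a x] /=.
  move=> Aax; split=> /=; first by have := Aax ord0; rewrite rV_cons0.
  by move=> i; have := Aax (lift ord0 i); rewrite rV_consS.
move=> [/= Aa Bx] i; case: (unliftP ord0 i) => [j|] ->.
  by rewrite rV_consS; exact: Bx.
by rewrite rV_cons0.
Qed.

End lebesgue_rV.

Local Open Scope complex_scope.

Section euclidean.
Variables (R : realType) (d : nat).
Implicit Types (x y p : 'rV[R]_d) (G : set 'rV[R]_d) (r : R).

Definition enorm x : R := Num.sqrt (\sum_i x ord0 i ^+ 2).

Definition eball x r : set 'rV[R]_d := [set y | enorm (y - x) < r].

Definition enorm_infty : set_system 'rV[R]_d :=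
  filter_from [set: R] (fun M => [set y | M < enorm y]).

Definition ediam G : \bar R :=
  ereal_sup [set (enorm (p.1 - p.2))%:E | p in G `*` G].

Definition star_shaped_at G p :=
  forall x (t : R), G x -> 0 <= t <= 1 -> G ((1 - t) *: p + t *: x).

Definition admissible_domain G :=
  [/\ open G, connected G, bounded_set G,
      exists rho : R, [/\ 0 < rho, eball 0 rho `<=` G &
        forall p, eball 0 rho p -> star_shaped_at G p]
    & ediam G = 2%:E].

Definition scaled_domain G r y : set 'rV[R]_d :=
  [set x + y | x in [set x | G (r^-1 *: x)]].

End euclidean.
Arguments enorm_infty : clear implicits.

Global Instance enorm_infty_filter (R : realType) d : Filter (enorm_infty R d).
Proof.
apply: filter_from_filter; first by exists 0.
move=> M N _ _; exists (Num.max M N) => // y /=.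
by rewrite gt_max => /andP[].
Qed.

Section level_functional.
Variables (R : realType) (d : nat).
Local Notation mes := (lebesgue_rV R d).
Implicit Types (V : 'rV[R]_d -> R) (G : set 'rV[R]_d) (y : 'rV[R]_d) (t r : R).

Definition locally_integrable_rV V :=
  measurable_fun [set: 'rV[R]_d] V /\
  forall K : set 'rV[R]_d, compact K ->
    (\int[mes]_(x in K) `|V x|%:E < +oo)%E.

(* The maximum with 0 only implements the convention sup set0 = 0; the value
   is +oo when t exceeds the measure of the closed domain. *)
Definition V_star V G t y r : \bar R :=
  maxe 0%E (ereal_sup [set s%:E | s in [set s : R | (0 < s)%R /\
    (mes (closure (scaled_domain G r y) `&` [set x | (V x <= s)%R]) < t%:E)%E]]).

Definition K_minus V G t y r : set 'rV[R]_d :=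
  closure (scaled_domain G r y) `&` [set x | ((V x)%:E < V_star V G t y r)%E].

Definition J_functional V G t y r : \bar R :=
  (\int[mes]_(x in K_minus V G t y r) (V x)%:E
   + (t%:E - mes (K_minus V G t y r)) * V_star V G t y r)%E.

End level_functional.

(* Complex Hilbert space L_2(mu), elements being represented by functions that
   are identified when equal mu-almost everywhere.  An operator is given by
   its graph. *)
Section L2_operators.
Context d (T : measurableType d) (R : realType).
Variable mu : {measure set T -> \bar R}.
Implicit Types (u v f : T -> R[i]) (A : set ((T -> R[i]) * (T -> R[i])))
  (z : R[i]).

Definition cmeasurable u :=
  measurable_fun setT (@complex.Re R \o u) /\
  measurable_fun setT (@complex.Im R \o u).

Definition L2 u := cmeasurable u /\
  (\int[mu]_x ((Normc.normc (u x)) ^+ 2)%:E < +oo)%E.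

Definition cintegral u : R[i] :=
  (\int[mu]_x complex.Re (u x)) +i* (\int[mu]_x complex.Im (u x)).

Definition L2inner u v : R[i] := cintegral (fun x => u x * (v x)^*).

Definition L2norm u : R :=
  Num.sqrt (\int[mu]_x (Normc.normc (u x)) ^+ 2).

Definition ae_zero u := \forall x \ae mu, u x = 0.

Definition resolvent_set A : set R[i] := [set z |
  [/\ (* surjectivity of A - z *)
      forall f, L2 f -> exists u, A (u, fun x => f x + z * u x),
      (* injectivity *)
      forall u, A (u, fun x => z * u x) -> ae_zero u
    & (* boundedness of the inverse *)
      exists C : R, forall u f, A (u, fun x => f x + z * u x) -> L2 f ->
        L2norm u <= C * L2norm f]].

Definition spectrum A : set R[i] := ~` resolvent_set A.

Definition eigenspace A z : set (T -> R[i]) :=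
  [set u | A (u, fun x => z * u x)].

Definition is_eigenvalue A z :=
  exists2 u, eigenspace A z u & ~ ae_zero u.

Definition finite_multiplicity A z :=
  exists (n : nat) (e : 'I_n -> T -> R[i]),
    (forall k, eigenspace A z (e k)) /\
    forall u, eigenspace A z u -> exists c : 'I_n -> R[i],
      \forall x \ae mu, u x = \sum_k c k * e k x.

Definition isolated_in_spectrum A z :=
  exists2 eps : R, 0 < eps &
    forall w, spectrum A w -> Normc.normc (w - z) < eps -> w = z.

Definition discrete_spectrum A :=
  forall z, spectrum A z ->
    [/\ isolated_in_spectrum A z, is_eigenvalue A z & finite_multiplicity A z].

End L2_operators.

Section schrodinger.
Variables (R : realType) (d : nat).
Local Notation mes := (lebesgue_rV R d).
Implicit Types (V phi : 'rV[R]_d -> R) (u v g : 'rV[R]_d -> R[i]) (i : 'I_d).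

Definition partial i phi : 'rV[R]_d -> R :=
  fun x => 'D_(delta_mx ord0 i) phi x.

Definition smooth phi := forall s : seq 'I_d,
  continuous (foldr partial phi s) /\
  forall i x, derivable (foldr partial phi s) x (delta_mx ord0 i).

Definition test_function phi :=
  smooth phi /\ compact (closure [set x | phi x != 0]).

(* Real test functions suffice: both sides are linear in phi. *)
Definition weak_partial i u g := forall phi, test_function phi ->
  cintegral mes (fun x => u x * (partial i phi x)%:C) =
  - cintegral mes (fun x => g x * (phi x)%:C).

Definition in_H1 u := L2 mes u /\
  forall i, exists2 g, L2 mes g & weak_partial i u g.

(* Chosen representative of the i-th weak derivative (unique a.e.) of an
   element of H^1. *)
Definition wpartial i u : 'rV[R]_d -> R[i] :=
  xget (fun=> 0) [set g | L2 mes g /\ weak_partial i u g].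

(* The domain of the closed form \int (|grad u|^2 + V |u|^2). *)
Definition form_domain V u := in_H1 u /\
  (\int[mes]_x (V x * Normc.normc (u x) ^+ 2)%:E < +oo)%E.

Definition schrodinger_form V u v : R[i] :=
  cintegral mes (fun x =>
    \sum_i wpartial i u x * (wpartial i v x)^* + (V x)%:C * (u x * (v x)^*)).

(* Graph of the self-adjoint operator associated with the form (first
   representation theorem). *)
Definition schrodinger V : set (('rV[R]_d -> R[i]) * ('rV[R]_d -> R[i])) :=
  [set uf | [/\ form_domain V uf.1, L2 mes uf.2 &
    forall v, form_domain V v ->
      schrodinger_form V uf.1 v = L2inner mes uf.2 v]].

End schrodinger.

(* Main.v *)
(* The operator is never diagonalised; everything rests on one inequality:
   for every e > 0 there are finitely many square integrable g_j and M with
     (1)   ||u||^2 <= e (||grad u||^2 + \int V u^2) + M \sum_j <u, g_j>^2.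
   It gives the Fredholm alternative for H - z, because modulo a boundedly
   invertible operator H - z then has finite rank, and it bounds the number of
   orthonormal eigenvectors with eigenvalues in a bounded interval; hence every
   point of the spectrum is an isolated eigenvalue of finite multiplicity.

   To prove (1), the hypothesis on gamma provides arbitrarily small r with
   r^2 <= e gamma(r), since 2(d-2)/d <= 2.  Cut R^d into cubes Q of side 8r,
   each containing a translate G_r(y) in its middle, and let m be the mean of u
   over Q.  The g_j are the indicators of the finitely many cubes on which
   J_V(sigma(r), y, r) is not yet large.  On each cube the Poincare inequality
   bounds \int_Q (u - m)^2 by C r^2 \int_Q |grad u|^2, so m^2 mes(Q) remains.
   On a far cube, either |u - m| >= |m| / 2 on a part of G_r(y) of measure
   gamma(r) mes(G_r), and then m^2 gamma(r) mes(G_r) <= 4 \int_Q (u - m)^2,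
   where the loss 1 / gamma(r) is absorbed by r^2; or |u| >= |m| / 2 on a part
   of measure sigma(r), on which \int V is at least J_V by the bathtub
   principle, and then m^2 J_V <= 4 \int_Q V u^2.

   All the analysis is done for real functions; a complex function is the pair
   of its real and imaginary parts. *)
From HB Require Import structures.
Require Import Defs.
From mathcomp Require Import all_boot all_order all_algebra.
From mathcomp Require Import complex zify ring lra.
From mathcomp Require Import all_classical all_reals all_analysis.
From mathcomp Require Import measurable_realfun.
Set Implicit Arguments.
Unset Strict Implicit.
Unset Printing Implicit Defensive.
Import Order.TTheory GRing.Theory Num.Theory.
Import numFieldNormedType.Exports.
Local Open Scope classical_set_scope.
Local Open Scope ring_scope.

(** * Quadratic forms on real spaces and the Fredholm alternative *)

(** Functions equal almost everywhere are not identified, so the forms below are only semidefinite: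
    [ip w w = 0] stands for w = 0, and solutions, limits and even the chosen weak derivatives are
    determined up to null vectors, which are harmless because Cauchy-Schwarz makes them orthogonal
    to everything. Since complex functions enter as real pairs, multiplication by z is just a
    bounded real-linear map of norm |z|, and (1) is applied with e = 1 / (2 (|z| + 1)). Adding (M /
    e) \sum_j <u, g_j>^2 to the energy turns (1) into coercivity; against this larger form z + 1 is
    a perturbation of norm at most 1/2, and what has to be removed again has finite rank. The
    Poincare inequality is proved without approximating u by smooth functions: testing the weak
    derivative against functions whose partial derivative is a bump minus its translate shows that
    u(x + t e_i) - u(x) is a line integral of the derivative for almost every x. *)

Record subspace (R : realType) (E : lmodType R) (S : set E) : Prop := Subspace {
  subspace0 : S 0;
  subspaceD : forall u v, S u -> S v -> S (u + v);
  subspaceZ : forall a u, S u -> S (a *: u) }.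

(** The laws are required on [S] alone, since integrals of products are additive only for square
    integrable factors. Definiteness is left out on purpose: functions vanishing almost everywhere
    are null vectors. *)
Record nonneg_form (R : realType) (E : lmodType R) (S : set E)
    (b : E -> E -> R) : Prop := NonnegForm {
  formDl : forall u v w, S u -> S v -> S w -> b (u + v) w = b u w + b v w;
  formZl : forall a u w, S u -> S w -> b (a *: u) w = a * b u w;
  formC : forall u v, S u -> S v -> b u v = b v u;
  form_ge0 : forall u, S u -> 0 <= b u u }.

Section forms.
Variables (R : realType) (E : lmodType R) (S : set E) (b : E -> E -> R).
Hypotheses (SS : subspace S) (Sb : nonneg_form S b).

Lemma subspaceN u : S u -> S (- u).
Proof. by move=> Su; rewrite -scaleN1r; exact: subspaceZ. Qed.

Lemma subspaceB u v : S u -> S v -> S (u - v).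
Proof. by move=> Su Sv; apply: subspaceD => //; exact: subspaceN. Qed.

Lemma subspace_sum (I : Type) (r : seq I) (P : pred I) (c : I -> R)
    (e : I -> E) : (forall i, P i -> S (e i)) ->
  S (\sum_(i <- r | P i) c i *: e i).
Proof.
move=> Se; elim/big_ind : _ => [||i Pi]; first exact: subspace0.
- by move=> u v; exact: subspaceD.
- by apply: subspaceZ => //; exact: Se.
Qed.

Lemma formDr u v w : S u -> S v -> S w -> b w (u + v) = b w u + b w v.
Proof.
move=> Su Sv Sw; rewrite (formC Sb) ?(formDl Sb)//; last exact: subspaceD.
by rewrite (formC Sb) // [b v w](formC Sb).
Qed.

Lemma formZr a u w : S u -> S w -> b w (a *: u) = a * b w u.
Proof.
move=> Su Sw; rewrite (formC Sb) ?(formZl Sb)//; last exact: subspaceZ.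
by rewrite (formC Sb).
Qed.

Lemma form0l w : S w -> b 0 w = 0.
Proof. by move=> Sw; rewrite -(scale0r 0) (formZl Sb) ?mul0r//;
  exact: subspace0. Qed.

Lemma formBl u v w : S u -> S v -> S w -> b (u - v) w = b u w - b v w.
Proof.
move=> Su Sv Sw; rewrite (formDl Sb)//; last exact: subspaceN.
by rewrite -scaleN1r (formZl Sb)// mulN1r.
Qed.

Lemma formBr u v w : S u -> S v -> S w -> b w (u - v) = b w u - b w v.
Proof.
move=> Su Sv Sw; rewrite (formC Sb) ?formBl//; last exact: subspaceB.
by rewrite (formC Sb) // [b v w](formC Sb).
Qed.

Lemma form_suml (I : Type) (r : seq I) (P : pred I) (c : I -> R)
    (e : I -> E) w : (forall i, P i -> S (e i)) -> S w ->
  b (\sum_(i <- r | P i) c i *: e i) w = \sum_(i <- r | P i) c i * b (e i) w.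
Proof.
move=> Se Sw; elim: r => [|i r IHr]; first by rewrite !big_nil form0l.
rewrite !big_cons; case: ifPn => // Pi.
rewrite (formDl Sb) ?IHr ?(formZl Sb)//.
- exact: Se.
- by apply: subspaceZ => //; exact: Se.
- exact: subspace_sum.
Qed.

Lemma form_sqrD u v : S u -> S v ->
  b (u + v) (u + v) = b u u + 2 * b u v + b v v.
Proof.
move=> Su Sv; rewrite (formDl Sb) ?formDr//; last exact: subspaceD.
by rewrite [b v u](formC Sb)//; ring.
Qed.

Lemma form_sqrB u v : S u -> S v ->
  b (u - v) (u - v) = b u u - 2 * b u v + b v v.
Proof.
move=> Su Sv; rewrite formBl ?formBr//; last exact: subspaceB.
by rewrite [b v u](formC Sb)//; ring.
Qed.

Lemma form_sqrZ a u : S u -> b (a *: u) (a *: u) = a ^+ 2 * b u u.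
Proof. by move=> Su; rewrite (formZl Sb) ?formZr ?mulrA//;
  exact: subspaceZ. Qed.

Lemma form_sqrN u : S u -> b (- u) (- u) = b u u.
Proof. by move=> Su; rewrite -scaleN1r form_sqrZ// sqrrN expr1n mul1r. Qed.

(** For c > 0 evaluate at the minimum t = - m / c. For c = 0 the polynomial is affine, and if m were
    nonzero the t chosen below would give it the value -1. *)
Lemma discriminant_le (a c m : R) : 0 <= a -> 0 <= c ->
  (forall t, 0 <= a + 2 * t * m + t ^+ 2 * c) -> m ^+ 2 <= a * c.
Proof.
move=> a0 c0 H; have [c_gt0|] := ltP 0 c; last first.
  move=> c_le0; have c00 : c = 0 by apply/eqP; rewrite eq_le c_le0.
  have [->|m0] := eqVneq m 0; first by rewrite expr0n/= c00 mulr0.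
  have := H (- (a + 1) / (2 * m)); rewrite c00 mulr0 addr0.
  rewrite (_ : 2 * _ * m = - (a + 1)); last by field; rewrite m0.
  by lra.
have := H (- m / c); rewrite (_ : _ + _ + _ = (a * c - m ^+ 2) / c); last first.
  by field; rewrite gt_eqF.
by rewrite pmulr_lge0 ?invr_gt0// subr_ge0.
Qed.

Lemma form_CS u v : S u -> S v -> b u v ^+ 2 <= b u u * b v v.
Proof.
move=> Su Sv; apply: discriminant_le => [||t]; [exact: (form_ge0 Sb)..|].
have := form_ge0 Sb (subspaceD SS Su (subspaceZ SS t Sv)).
by rewrite form_sqrD ?form_sqrZ ?formZr ?mulrA//; exact: subspaceZ.
Qed.

(** This is what replaces the conclusion u = 0 in the semidefinite setting. *)
Lemma form_null u v : S u -> S v -> b u u = 0 -> b u v = 0.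
Proof.
move=> Su Sv u0; have := form_CS Su Sv; rewrite u0 mul0r => h.
by apply/eqP; rewrite -sqrf_eq0 eq_le h sqr_ge0.
Qed.

Lemma form_sqrD_le u v : S u -> S v ->
  b (u + v) (u + v) <= 2 * b u u + 2 * b v v.
Proof.
move=> Su Sv; have := form_ge0 Sb (subspaceB Su Sv).
by rewrite form_sqrB// form_sqrD//; lra.
Qed.

Lemma form_young u v t : 0 < t -> S u -> S v ->
  2 * `|b u v| <= t * b u u + t^-1 * b v v.
Proof.
move=> t0 Su Sv.
(* The form at t u + s v, divided by t; s = 1 and s = -1 give the two signs of the absolute
   value. *)
have P s : 0 <= t * b u u + 2 * s * b u v + s ^+ 2 * t^-1 * b v v.
  have := form_ge0 Sb (subspaceD SS (subspaceZ SS t Su) (subspaceZ SS s Sv)).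
  rewrite form_sqrD; [|exact: subspaceZ..].
  rewrite !form_sqrZ// (formZl Sb) ?formZr//; last exact: subspaceZ.
  rewrite [X in 0 <= X -> _](_ : _ = t * (t * b u u + 2 * s * b u v +
      s ^+ 2 * t^-1 * b v v)); first by rewrite pmulr_rge0.
  by field; rewrite gt_eqF.
have := P 1; have := P (-1).
rewrite sqrrN expr1n !mul1r mulr1 mulrN1 mulNr.
case: (ger0P (b u v)); lra.
Qed.

End forms.

Definition form_cvg (R : realType) (E : lmodType R) (q : E -> R) (u : nat -> E)
  (w : E) := forall e : R, 0 < e -> exists N, forall n, (N <= n)%N ->
    q (u n - w) <= e.

Definition form_cauchy (R : realType) (E : lmodType R) (q : E -> R)
  (u : nat -> E) := forall e : R, 0 < e -> exists N, forall m n,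
    (N <= m)%N -> (N <= n)%N -> q (u m - u n) <= e.

Definition form_complete (R : realType) (E : lmodType R) (S : set E)
    (q : E -> R) := forall u : nat -> E, (forall n, S (u n)) ->
  form_cauchy q u -> exists2 w, S w & form_cvg q u w.

Section Riesz.
Variables (R : realType) (E : lmodType R) (D : set E) (b : E -> E -> R).
Hypotheses (DS : subspace D) (Db : nonneg_form D b).
Hypothesis Dcomplete : form_complete D (fun u => b u u).
Variables (F : E -> R) (K : R).
Hypotheses (FD : forall u v, D u -> D v -> F (u + v) = F u + F v)
  (FZ : forall a u, D u -> F (a *: u) = a * F u)
  (Fbounded : forall u, D u -> F u ^+ 2 <= K * b u u).

(* A minimising sequence of [b u u - 2 F u] is Cauchy by the parallelogram
   identity, and the almost minimality of its terms gives the equation in the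
   limit. *)
Lemma form_riesz : exists2 w, D w & forall v, D v -> b w v = F v.
Proof.
have [K0|K0] := leP 0 K; last first.
  exists 0 => [|v Dv]; first exact: subspace0.
  rewrite (form0l DS Db)//; apply/esym/eqP;
    rewrite -sqrf_eq0 eq_le sqr_ge0 andbT.
  by rewrite (le_trans (Fbounded Dv))// nmulr_rle0// (form_ge0 Db).
pose phi u := b u u - 2 * F u.
have phi_ge u : D u -> - K <= phi u.
  move=> Du; rewrite /phi.
  have bu := form_ge0 Db Du; have Fu := Fbounded Du.
  (* Compare squares: 4 F(u)^2 <= 4 K b(u,u) <= (b(u,u) + K)^2. *)
  have : 2 * F u <= b u u + K; last by lra.
  have [Fu0|Fu0] := leP (F u) 0; first by lra.
  rewrite -(@ler_sqr _ (2 * F u)) ?nnegrE; [|lra|lra].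
  rewrite exprMn; have := sqr_ge0 (b u u - K); nra.
pose A := [set phi u | u in D].
have A_inf : has_inf A.
  split; first by exists (phi 0), 0 => //; exact: subspace0.
  by exists (- K) => _ [u Du <-]; exact: phi_ge.
pose m := inf A.
have phi_m u : D u -> m <= phi u.
  by move=> Du; apply: ge_inf; [exact: A_inf.2|exists u].
have ex_min n : exists u, D u /\ phi u < m + n.+1%:R^-1.
  have n0 : 0 < n.+1%:R^-1 :> R by rewrite invr_gt0.
  have [_ [u Du <-] ltu] := inf_adherent n0 A_inf.
  by exists u.
have [u uP] := choice ex_min.
have Du n : D (u n) by case: (uP n).
have phi_u n : phi (u n) < m + n.+1%:R^-1 by case: (uP n).
have FN v : D v -> F (- v) = - F v by move=> Dv; rewrite -scaleN1r FZ// mulN1r.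
(* As [u n] is minimal up to 1 / (n + 1), replacing it by u_n + t v shows 1 / (n + 1) + 2 t (b(u_n,
   v) - F v) + t^2 b(v, v) >= 0 for all t; take the discriminant. *)
have near_eq n v : D v -> (b (u n) v - F v) ^+ 2 <= n.+1%:R^-1 * b v v.
  move=> Dv; apply: discriminant_le; first by rewrite invr_ge0.
    exact: (form_ge0 Db).
  move=> t; have Dtv := subspaceZ DS t Dv.
  have := phi_m _ (subspaceD DS (Du n) Dtv); have := phi_u n.
  rewrite /phi (form_sqrD DS Db)// FD// FZ// (formZr DS Db)//.
  rewrite (form_sqrZ DS Db)//.
  move: (b _ _) (b _ _) (b _ _) (F _) (F _) n.+1%:R^-1 => a1 a2 a3 a4 a5 a6.
  by clear - m; clearbody m; lra.
have [||w Dw uw] := Dcomplete (u := u) => //.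
  move=> e e0; have [N HN] := ltr_add_invr (y := 0) (x := e / 4) ltac:(lra).
  rewrite add0r in HN.
  exists N => k n Nk Nn.
  have le_inv j : (N <= j)%N -> j.+1%:R^-1 <= e / 4.
    move=> Nj; rewrite (le_trans _ (ltW HN))// lef_pV2 ?posrE ?ltr0n//.
    by rewrite ler_nat ltnS.
  have Dkn := subspaceD DS (Du k) (Du n).
  have := phi_m _ (subspaceZ DS 2^-1 Dkn); have := phi_u k; have := phi_u n.
  rewrite /phi (form_sqrZ DS Db)// (form_sqrD DS Db)// (form_sqrB DS Db)//.
  rewrite FZ// FD//.
  have := le_inv _ Nk; have := le_inv _ Nn.
  move: n.+1%:R^-1 k.+1%:R^-1 => n1 k1.
  clear - m; clearbody m; lra.
exists w => // v Dv; apply/eqP; rewrite -subr_eq0 -sqrf_eq0 eq_le sqr_ge0 andbT.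
apply/ler_addgt0Pr => e e0; rewrite add0r.
have bv := form_ge0 Db Dv.
(* The two squared errors contribute 2 e' b(v,v) each; the + 1 covers the case b(v,v) = 0. *)
pose e' := e / (4 * (b v v + 1)).
have e'0 : 0 < e' by apply: divr_gt0 => //; lra.
have [N HN] := ltr_add_invr (y := 0) (x := e') e'0.
have [N' HN'] := uw _ e'0.
pose n := maxn N N'.
have n1 : n.+1%:R^-1 <= e'.
  rewrite add0r in HN; rewrite (le_trans _ (ltW HN))//.
  by rewrite lef_pV2 ?posrE ?ltr0n// ler_nat ltnS leq_maxl.
have n2 := HN' n (leq_maxr _ _).
have h1 := near_eq n v Dv.
have h2 := form_CS DS Db (subspaceB DS (Du n) Dw) Dv.
rewrite (formBl DS Db)// in h2.
have h3 : (b w v - F v) ^+ 2 <= 2 * (b (u n) v - F v) ^+ 2 +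
    2 * (b (u n) v - b w v) ^+ 2.
  by have := sqr_ge0 ((b (u n) v - F v) + (b (u n) v - b w v)); nra.
apply: (le_trans h3).
have h4 : n.+1%:R^-1 * b v v <= e' * b v v by exact: ler_wpM2r.
have h5 : b (u n - w) (u n - w) * b v v <= e' * b v v by exact: ler_wpM2r.
have h6 : e' * (b v v + 1) = e / 4 by rewrite /e'; field; rewrite gt_eqF//; lra.
have := le_trans h1 h4; have := le_trans h2 h5; move: h6 e'0; clear.
by clearbody e'; move: (b v v) ((_ - _) ^+ 2) ((_ - _) ^+ 2) => x y z; nra.
Qed.

End Riesz.

(** * Solving an equation whose form is perturbed by a small bounded operator *)

Section LaxMilgram.
Variables (R : realType) (E : lmodType R) (H D : set E) (ip b : E -> E -> R).
Hypotheses (HS : subspace H) (Hip : nonneg_form H ip).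
Hypotheses (DS : subspace D) (Db : nonneg_form D b) (DH : D `<=` H).
Hypothesis Dcomplete : form_complete D (fun u => b u u).
Variables (eps kappa : R) (Y : E -> E).
Hypotheses (eps0 : 0 <= eps) (kappa0 : 0 <= kappa) (eps_kappa : eps * kappa <=
  2^-1).
Hypothesis ip_le_b : forall u, D u -> ip u u <= eps * b u u.
Hypotheses (YH : forall u, D u -> H (Y u))
  (YB : forall u v, D u -> D v -> Y (u - v) = Y u - Y v)
  (Ybounded : forall u, D u -> ip (Y u) (Y u) <= kappa ^+ 2 * ip u u).

(** Two factors eps from [ip_le_b] and the bound kappa on [Y] make the perturbation of norm at most
    eps * kappa <= 1/2 with respect to [b]. Both the a priori bound and the contraction below rest
    on this. *)
Lemma ip_Y_le u v : D u -> D v -> ip (Y u) v ^+ 2 <= 4^-1 * (b u u * b v v).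
Proof.
move=> Du Dv.
have hCS := form_CS HS Hip (YH Du) (DH Dv).
have ipu := form_ge0 Hip (DH Du); have ipv := form_ge0 Hip (DH Dv).
have bu := form_ge0 Db Du; have bv := form_ge0 Db Dv.
apply: (le_trans hCS).
have h1 : ip (Y u) (Y u) * ip v v <= (kappa ^+ 2 * (eps * b u u)) * (eps * b v
  v).
  apply: ler_pM => //; [exact: (form_ge0 Hip (YH Du))| |exact: ip_le_b].
  apply: (le_trans (Ybounded Du)); apply: ler_wpM2l; first exact: sqr_ge0.
  exact: ip_le_b.
apply: (le_trans h1).
rewrite (_ : _ * _ = (eps * kappa) ^+ 2 * (b u u * b v v)); last by ring.
apply: ler_wpM2r; first exact: mulr_ge0.
rewrite (_ : 4^-1 = 2^-1 ^+ 2); last by field.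
by rewrite ler_sqr ?nnegrE ?mulr_ge0.
Qed.

(** Test with v = u: the perturbation takes away at most half of b(u,u), and the rest is controlled
    by Cauchy-Schwarz, which gives b(u,u) <= 4 eps ip(f,f). One more eps comes from [ip_le_b]. *)
Lemma form_lax_milgram_bound u f : D u -> H f ->
  (forall v, D v -> b u v - ip (Y u) v = ip f v) ->
  ip u u <= 4 * eps ^+ 2 * ip f f.
Proof.
move=> Du Hf /(_ _ Du) eqn.
have bu := form_ge0 Db Du; have ff := form_ge0 Hip Hf.
have h1 : ip (Y u) u <= 2^-1 * b u u.
  have := ip_Y_le Du Du; rewrite (_ : 4^-1 * _ = (2^-1 * b u u) ^+ 2);
    last by field.
  by move=> h; apply: ler_normlW;
    rewrite -ler_sqr ?nnegrE ?normr_ge0 ?sqr_normr ?real_normK ?num_real//; lra.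
have h2 : 2^-1 * b u u <= ip f u by lra.
have h3 : b u u <= 4 * eps * ip f f.
  have hCS := form_CS HS Hip Hf (DH Du).
  have := ip_le_b Du => h4.
  have h5 : (2^-1 * b u u) ^+ 2 <= ip f f * (eps * b u u).
    rewrite (le_trans _ (le_trans hCS _))//; last exact: ler_wpM2l.
    by rewrite ler_sqr ?nnegrE//; lra.
  have [->|bu0] := eqVneq (b u u) 0; first by rewrite !mulr_ge0.
  have {}bu0 : 0 < b u u by rewrite lt_neqAle eq_sym bu0.
  rewrite -(ler_pM2r bu0); lra.
apply: (le_trans (ip_le_b Du)).
rewrite (_ : 4 * _ * _ = eps * (4 * eps * ip f f)); last by ring.
exact: ler_wpM2l.
Qed.

(** Banach's fixed point argument for the map [T] sending u to the Riesz solution with right side f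
    + Y u. It contracts the norm of [b] by 1/2, that is, [b] itself by 1/4. *)
Lemma form_lax_milgram f : H f ->
  exists2 w, D w & forall v, D v -> b w v - ip (Y w) v = ip f v.
Proof.
move=> Hf.
have exT u : exists w, D u -> D w /\ forall v, D v -> b w v = ip (f + Y u) v.
  have [Du|] := pselect (D u); last by exists 0.
  have HfY : H (f + Y u) by apply: subspaceD => //; exact: YH.
  have [| | |w Dw Hw] := form_riesz DS Db Dcomplete
      (F := ip (f + Y u)) (K := ip (f + Y u) (f + Y u) * eps).
  - by move=> v v' Dv Dv'; rewrite (formDr HS Hip)//; exact: DH.
  - by move=> a v Dv; rewrite (formZr HS Hip)//; exact: DH.
  - move=> v Dv; apply: (le_trans (form_CS HS Hip HfY (DH Dv))).
    by rewrite -mulrA ler_wpM2l ?ip_le_b//; exact: (form_ge0 Hip).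
  by exists w => _.
have [T HT] := choice exT.
have DT u : D u -> D (T u) by move=> /HT[].
have TE u v : D u -> D v -> b (T u) v = ip (f + Y u) v.
  by move=> /HT[_ h] /h.
have Tcontr u v : D u -> D v ->
    b (T u - T v) (T u - T v) <= 4^-1 * b (u - v) (u - v).
  move=> Du Dv; have Dd := subspaceB DS (DT _ Du) (DT _ Dv).
  have Duv := subspaceB DS Du Dv.
  set d := T u - T v in Dd *.
  have hb : b d d = ip (Y (u - v)) d.
    rewrite {1}/d (formBl DS Db) ?TE//; try exact: DT.
    rewrite -(formBl HS Hip) //; last 3 first.
    - by apply: (subspaceD HS) => //; exact: YH.
    - by apply: (subspaceD HS) => //; exact: YH.
    - exact: DH.
    by rewrite YB// opprD addrACA subrr add0r.
  have := ip_Y_le Duv Dd; rewrite -hb => h.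
  have bd := form_ge0 Db Dd.
  have [->|bd0] := eqVneq (b d d) 0; first by rewrite mulr_ge0//;
    exact: (form_ge0 Db).
  have {}bd0 : 0 < b d d by rewrite lt_neqAle eq_sym bd0.
  by rewrite -(ler_pM2r bd0) -expr2 -mulrA.
pose u n := iter n T 0.
have Du n : D (u n).
  by elim: n => [|n IHn] /=; [exact: (subspace0 DS)|exact: DT].
pose c := b (u 1%N - u 0%N) (u 1%N - u 0%N).
have c0 : 0 <= c by apply: (form_ge0 Db); exact: subspaceB.
have step n : b (u n.+1 - u n) (u n.+1 - u n) <= 4^-1 ^+ n * c.
  elim: n => [|n IHn]; first by rewrite expr0 mul1r.
  rewrite exprS -mulrA; apply: (le_trans (Tcontr _ _ (Du n.+1) (Du n))).
  by rewrite ler_wpM2l// invr_ge0.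
(* The constant 4 reproduces itself in the induction: 2 * (4^-1 * 4) + 2 = 4. *)
have dist n k : b (u (k + n)%N - u n) (u (k + n)%N - u n) <= 4 * (4^-1 ^+ n *
  c).
  elim: k => [|k IHk].
    rewrite add0n subrr (form0l DS Db); last exact: (subspace0 DS).
    by rewrite !mulr_ge0// exprn_ge0// invr_ge0.
  rewrite addSn (_ : u _ - u n = (u (k + n).+1 - u n.+1) + (u n.+1 - u n));
    last first.
    by rewrite addrA subrK.
  apply: (le_trans (form_sqrD_le DS Db _ _)); [exact: subspaceB..|].
  have := Tcontr _ _ (Du (k + n)%N) (Du n).
  have := step n.
  rewrite /u /= -/(u _) -/(u n); lra.
have [||w Dw uw] := Dcomplete (u := u) => //.
  move=> e e0.
  have [N HN] : exists N, forall n, (N <= n)%N -> 4 * (4^-1 ^+ n * c) <= e.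
    have := @cvg_geometric R (4 * c) 4^-1.
    rewrite ger0_norm ?invr_ge0// invf_lt1// ltr1n => /(_ isT).
    move/cvgr0Pnorm_le => /(_ _ e0)[N _ HN]; exists N => n Nn.
    have := HN n Nn; rewrite /= ger0_norm; first by rewrite -mulrA [c * _]mulrC.
    by rewrite mulr_ge0 ?mulr_ge0// exprn_ge0// invr_ge0.
  exists N => k n Nk Nn.
  have [nk|/ltnW kn] := leqP n k.
    by rewrite -(subnK nk); apply: (le_trans (dist _ _)); exact: HN.
  rewrite -opprB (form_sqrN DS Db); last exact: subspaceB.
  by rewrite -(subnK kn); apply: (le_trans (dist _ _)); exact: HN.
exists w => // v Dv.
have DTw := DT _ Dw.
(* The values of [T] are chosen among solutions differing by null vectors, so w is fixed only modulo
   such a vector; this suffices for the equation. *)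
have Tw0 : b (T w - w) (T w - w) = 0.
  apply/eqP; rewrite eq_le (form_ge0 Db) ?andbT; last exact: subspaceB.
  apply/ler_addgt0Pr => e e0; rewrite add0r.
  have [N HN] := uw (e / 4) ltac:(lra).
  rewrite (_ : T w - w = (T w - u N.+1) + (u N.+1 - w));
    last by rewrite addrA subrK.
  apply: (le_trans (form_sqrD_le DS Db _ _)); [exact: subspaceB..|].
  have := Tcontr _ _ Dw (Du N); have := HN _ (leqnn N); have := HN _ (leqnSn N).
  rewrite -[w - u N]opprB (form_sqrN DS Db); last exact: subspaceB.
  have := form_ge0 Db (subspaceB DS (Du N) Dw).
  rewrite /u /= -/(u N); lra.
have := form_null DS Db (subspaceB DS DTw Dw) Dv Tw0.
rewrite (formBl DS Db)// TE// (formDl Hip)//; [|exact: YH|exact: DH].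
by move=> /eqP; rewrite subr_eq0 => /eqP <-; rewrite addrK.
Qed.

End LaxMilgram.

(** * The Fredholm alternative and the finiteness of the eigenvalues in a bounded interval *)

Section Fredholm.
Variables (R : realType) (E : lmodType R) (H D : set E) (ip h : E -> E -> R).
Hypotheses (HS : subspace H) (Hip : nonneg_form H ip).
Hypotheses (DS : subspace D) (Dh : nonneg_form D h) (DH : D `<=` H).
Hypothesis Dcomplete : form_complete D (fun u => h u u + ip u u).

Definition finite_rank_bound (eps : R) (N : nat) (g : 'I_N -> E) (M : R) :=
  forall u, D u -> ip u u <= eps * h u u + M * \sum_j ip u (g j) ^+ 2.

Section bound.
Variables (eps M : R) (N : nat) (g : 'I_N -> E).
Hypotheses (eps0 : 0 < eps) (M0 : 0 <= M) (Hg : forall j, H (g j)).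
Hypothesis gP : finite_rank_bound eps g M.

Let m := M / eps.
Let m0 : 0 <= m. Proof. by rewrite divr_ge0// ltW. Qed.

(** The weight m = M / eps is the one for which [finite_rank_bound] becomes
    [ip u u <= eps * shifted_form u u]; the term [ip u v] provides completeness. *)
Definition shifted_form u v := h u v + ip u v + m * \sum_j ip u (g j) * ip v (g
  j).

Lemma shifted_form_nonneg : nonneg_form D shifted_form.
Proof.
split => [u v w Du Dv Dw|a u w Du Dw|u v Du Dv|u Du]; rewrite /shifted_form.
- rewrite (formDl Dh)// (formDl Hip (DH Du) (DH Dv) (DH Dw)).
  rewrite (eq_bigr (fun j => ip u (g j) * ip w (g j) + ip v (g j) * ip w (g
    j))).
    by rewrite big_split/=; ring.
  by move=> j _; rewrite (formDl Hip (DH Du) (DH Dv) (Hg j)) mulrDl.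
- rewrite (formZl Dh)// (formZl Hip) //; [|exact: DH..].
  rewrite (eq_bigr (fun j => a * (ip u (g j) * ip w (g j)))).
    by rewrite -mulr_sumr; ring.
  by move=> j _; rewrite (formZl Hip a (DH Du) (Hg j)) mulrA.
- rewrite (formC Dh)// (formC Hip (DH Du) (DH Dv)); congr (_ + _ * _).
  by apply: eq_bigr => j _; rewrite mulrC.
- rewrite !addr_ge0 ?(form_ge0 Dh)// ?(form_ge0 Hip (DH Du))//.
  by rewrite mulr_ge0// sumr_ge0// => j _; rewrite -expr2 sqr_ge0.
Qed.

Lemma shifted_form_ge u : D u -> h u u + ip u u <= shifted_form u u.
Proof.
move=> Du; rewrite /shifted_form lerDl mulr_ge0// sumr_ge0// => j _.
by rewrite -expr2 sqr_ge0.
Qed.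

(** Together with [shifted_form_ge] it makes the shifted form equivalent to h + ip, whose
    completeness it therefore inherits. *)
Lemma shifted_form_le u : D u ->
  shifted_form u u <= (1 + m * \sum_j ip (g j) (g j)) * (h u u + ip u u).
Proof.
move=> Du; rewrite mulrDl mul1r /shifted_form lerD2l -mulrA.
apply: ler_wpM2l => //; rewrite mulr_suml; apply: ler_sum => j _.
rewrite -expr2; apply: (le_trans (form_CS HS Hip (DH Du) (Hg j))).
rewrite mulrC ler_wpM2l ?(form_ge0 Hip)// lerDr.
exact: (form_ge0 Dh).
Qed.

Lemma shifted_form_complete : form_complete D (fun u => shifted_form u u).
Proof.
move=> u Du uC.
have [||w Dw uw] := Dcomplete (u := u) => //.
  move=> e e0; have [N0 HN] := uC _ e0; exists N0 => i j Ni Nj.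
  apply: le_trans (HN i j Ni Nj); apply: shifted_form_ge.
  exact: (subspaceB DS).
exists w => // e e0.
set C := 1 + m * \sum_j ip (g j) (g j).
have C0 : 0 < C.
  rewrite ltr_pwDl// mulr_ge0// sumr_ge0// => j _; exact: (form_ge0 Hip).
have [N0 HN] := uw _ (divr_gt0 e0 C0); exists N0 => n Nn.
apply: (le_trans (shifted_form_le (subspaceB DS (Du n) Dw))).
by rewrite mulrC -ler_pdivlMr//; exact: HN.
Qed.

Lemma ip_le_shifted_form u : D u -> ip u u <= eps * shifted_form u u.
Proof.
move=> Du; apply: (le_trans (gP Du)); rewrite /shifted_form.
rewrite (eq_bigr (fun j => ip u (g j) * ip u (g j))); last by move=> j _;
  rewrite expr2.
rewrite !mulrDr -addrA lerD2l mulrA [eps * m]mulrC divfK ?gt_eqF//.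
by rewrite lerDr mulr_ge0// ?(ltW eps0)// (form_ge0 Hip (DH Du)).
Qed.

Variables (Z : E -> E) (K : R).
Hypotheses (K0 : 0 <= K) (epsK : eps * (K + 1) <= 2^-1).
Hypotheses (ZH : forall u, D u -> H (Z u))
  (ZD : forall u v, D u -> D v -> Z (u + v) = Z u + Z v)
  (ZZ : forall a u, D u -> Z (a *: u) = a *: Z u)
  (Zbounded : forall u, D u -> ip (Z u) (Z u) <= K ^+ 2 * ip u u).

(** The extra u undoes the term [ip u v] of the shifted form, at the price of the norm K + 1 instead
    of K. *)
Let Y u := Z u + u.

Let YH u : D u -> H (Y u).
Proof. by move=> Du; apply: (subspaceD HS); [exact: ZH|exact: DH]. Qed.

Let YB u v : D u -> D v -> Y (u - v) = Y u - Y v.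
Proof.
move=> Du Dv; rewrite /Y ZD//; last exact: (subspaceN DS).
by rewrite -scaleN1r ZZ// !scaleN1r opprD addrACA.
Qed.

Let Zle u : D u -> ip (Z u) u <= K * ip u u.
Proof.
move=> Du; have Hu := DH Du; have u0 := form_ge0 Hip Hu.
have h4 : ip (Z u) u ^+ 2 <= (K * ip u u) ^+ 2.
  apply: (le_trans (form_CS HS Hip (ZH Du) Hu)).
  rewrite exprMn [ip u u ^+ 2]expr2 mulrA.
  by apply: ler_wpM2r => //; exact: Zbounded.
by apply: ler_normlW; rewrite -ler_sqr ?nnegrE ?normr_ge0 ?real_normK ?num_real
  ?mulr_ge0.
Qed.

Let Ybounded u : D u -> ip (Y u) (Y u) <= (K + 1) ^+ 2 * ip u u.
Proof.
move=> Du; rewrite /Y (form_sqrD HS Hip (ZH Du) (DH Du)).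
by move: (Zle Du) (Zbounded Du); rewrite sqrrD expr1n mulr1; lra.
Qed.

Let solve f : exists w, H f -> D w /\
  forall v, D v -> shifted_form w v - ip (Y w) v = ip f v.
Proof.
have [Hf|] := pselect (H f); last by exists 0.
have K1 : 0 <= K + 1 by exact: addr_ge0.
have [w Dw wP] := form_lax_milgram HS Hip DS shifted_form_nonneg DH
  shifted_form_complete (ltW eps0) K1 epsK ip_le_shifted_form YH YB Ybounded Hf.
by exists w => _.
Qed.

Let shiftE u v : D u -> D v ->
  h u v - ip (Z u) v = shifted_form u v - ip (Y u) v
    - m * \sum_j ip u (g j) * ip v (g j).
Proof.
move=> Du Dv; rewrite /shifted_form /Y (formDl Hip)//;
  [|exact: ZH|exact: DH|exact: DH].
by ring.
Qed.

Let bounded w f : D w -> H f ->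
  (forall v, D v -> shifted_form w v - ip (Y w) v = ip f v) ->
  ip w w <= 4 * eps ^+ 2 * ip f f.
Proof.
move=> Dw Hf; have K1 : 0 <= K + 1 by exact: addr_ge0.
exact: (form_lax_milgram_bound HS Hip shifted_form_nonneg DH (ltW eps0) K1 epsK
  ip_le_shifted_form YH Ybounded).
Qed.

Let shifted_linear (I : finType) (c : I -> R) (w : I -> E) v :
  (forall i, D (w i)) -> D v ->
  shifted_form (\sum_i c i *: w i) v - ip (Y (\sum_i c i *: w i)) v =
  \sum_i c i * (shifted_form (w i) v - ip (Y (w i)) v).
Proof.
move=> Dw Dv; rewrite (form_suml DS shifted_form_nonneg)//.
have -> : Y (\sum_i c i *: w i) = \sum_i c i *: Y (w i).
  rewrite /Y; under [RHS]eq_bigr do rewrite scalerDr.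
  rewrite big_split/=; congr (_ + _).
  have [DZ ->//] : D (\sum_i c i *: w i) /\
      Z (\sum_i c i *: w i) = \sum_i c i *: Z (w i).
  elim/big_ind2 : _ => [|x x' y y' [Dx <-] [Dy <-]|i _].
  - split; first exact: (subspace0 DS).
    by rewrite -(scale0r 0) ZZ ?scale0r//; exact: (subspace0 DS).
  - by split; [exact: (subspaceD DS)|rewrite ZD].
  - by split; [exact: (subspaceZ DS)|rewrite ZZ].
rewrite (form_suml HS Hip)//; last exact: DH.
  by rewrite -sumrB; apply: eq_bigr => i _; rewrite mulrBr.
by move=> i _; exact: YH.
Qed.

Let shiftedD u u' v : D u -> D u' -> D v ->
  shifted_form (u + u') v - ip (Y (u + u')) v =
  (shifted_form u v - ip (Y u) v) + (shifted_form u' v - ip (Y u') v).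
Proof.
move=> Du Du' Dv; rewrite (formDl shifted_form_nonneg)//.
rewrite (_ : Y (u + u') = Y u + Y u'); last by rewrite /Y ZD// addrACA.
by rewrite (formDl Hip (YH Du) (YH Du') (DH Dv)) opprD addrACA.
Qed.

(* Modulo the boundedly invertible operator of the shifted form the equation
   [h u = ip (f + Z u)] has finite rank: it reduces to a linear system for the
   coordinates [ip u (g j)], with matrix [1 - Gamma]. *)
Lemma fredholm_alternative :
  (exists u, [/\ D u, ip u u != 0 & forall v, D v -> h u v = ip (Z u) v]) \/
  ((forall f, H f -> exists2 u, D u & forall v, D v -> h u v = ip (f + Z u) v)
    /\
   exists C, forall f u, H f -> D u ->
     (forall v, D v -> h u v = ip (f + Z u) v) -> ip u u <= C * ip f f).
Proof.
have [S SP] := choice solve.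
have DSf f : H f -> D (S f) by move=> /SP[].
have SE f v : H f -> D v -> shifted_form (S f) v - ip (Y (S f)) v = ip f v.
  by move=> /SP[_ Hf] /Hf.
pose w j := S (g j).
have Dw j : D (w j) by exact: DSf.
pose Gamma := \matrix_(k < N, j < N) (m * ip (w k) (g j)).
(* [U c] solves the shifted equation with right side m \sum_j c_j g_j. For the original equation its
   defect at v is m \sum_j (c_j - ip (U c) (g j)) * ip v (g j), and the coordinates ip (U c) (g j)
   are those of [c *m Gamma]. *)
pose U (c : 'rV[R]_N) := \sum_k (m * c 0 k) *: w k.
have DU c : D (U c) by exact: (subspace_sum DS).
have UE c v : D v -> shifted_form (U c) v - ip (Y (U c)) v =
    m * \sum_j c 0 j * ip v (g j).
  move=> Dv; rewrite shifted_linear// mulr_sumr; apply: eq_bigr => j _.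
  by rewrite SE// -mulrA (formC Hip (Hg j) (DH Dv)).
have Ug c j : ip (U c) (g j) = (c *m Gamma) 0 j.
  rewrite (form_suml HS Hip)//; last by move=> k _; exact: DH.
  by rewrite mxE; apply: eq_bigr => k _; rewrite mxE mulrCA !mulrA.
have [A_unit|] := boolP ((1%:M - Gamma) \in unitmx); last first.
  (* A nonzero row c fixed by [Gamma] makes the defect vanish, and [U c] is not null because c is
     its coordinate vector. *)
  rewrite -row_free_unit -kermx_eq0 => /rowV0Pn[c /sub_kermxP cA c0]; left.
  have cG : c *m Gamma = c.
    by apply/eqP; rewrite eq_sym -subr_eq0 -{1}[c]mulmx1 -mulmxBr cA.
  exists (U c); split => // [|v Dv].
    apply: contra c0 => /eqP U0; apply/eqP/rowP => j.
    by rewrite -cG -Ug mxE (form_null HS Hip (DH (DU c))).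
  apply/eqP; rewrite -subr_eq0 shiftE// UE//; apply/eqP.
  rewrite -mulrBr -sumrB big1 ?mulr0// => j _.
  by rewrite Ug cG subrr.
right; split.
  (* With the ansatz S f + U c the defect vanishes as soon as c is the coordinate vector of the
     whole sum, which is the linear system solved here. *)
  move=> f Hf; pose c := (\row_j ip (S f) (g j)) *m invmx (1%:M - Gamma).
  have cE : c = \row_j ip (S f) (g j) + c *m Gamma.
    apply/eqP; rewrite -subr_eq -{1}[c]mulmx1 -mulmxBr.
    by rewrite -mulmxA mulVmx// mulmx1.
  have Du : D (S f + U c) by apply: (subspaceD DS) => //; exact: DSf.
  exists (S f + U c) => // v Dv.
  rewrite (formDl Hip Hf (ZH Du) (DH Dv)); apply/eqP; rewrite -subr_eq.
  rewrite shiftE// shiftedD// ?DSf// ?SE// ?UE//; last exact: DSf.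
  rewrite -addrA -mulrBr -sumrB big1 ?mulr0 ?addr0// => j _.
  rewrite (formDl Hip (DH (DSf _ Hf)) (DH (DU c)) (Hg j)) Ug {1}cE !mxE.
  by rewrite subrr.
(* Relative to the norm of f, [B k] bounds the k-th coordinate of [S f], and [C j] the j-th
   coordinate of any solution, through the entries of the inverse matrix. *)
pose B k := Num.sqrt (4 * eps ^+ 2 * ip (g k) (g k)).
pose C j := \sum_k B k * `|invmx (1%:M - Gamma) k j|.
exists (eps + 2 * M * \sum_j C j ^+ 2) => f u Hf Du hu.
have ff := form_ge0 Hip Hf; have uu := form_ge0 Hip (DH Du).
pose c := \row_j ip u (g j).
have cE : c = (\row_j ip (S f) (g j)) *m invmx (1%:M - Gamma).
  (* With c the coordinates of u, the difference solves the shifted equation with right side 0, so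
     the a priori bound makes it null. *)
  pose e := u - (S f + U c).
  have DSU : D (S f + U c) by apply: (subspaceD DS) => //; exact: DSf.
  have De : D e by exact: (subspaceB DS).
  have e0 : ip e e = 0.
    apply/eqP; rewrite eq_le (form_ge0 Hip (DH De)) andbT.
    rewrite -(mulr0 (4 * eps ^+ 2)) -(form0l HS Hip (subspace0 HS)).
    apply: bounded => //; first exact: (subspace0 HS).
    move=> v Dv; rewrite (form0l HS Hip (DH Dv)).
    have := shiftedD De DSU Dv; rewrite {1 2}/e subrK shiftedD//;
      last exact: DSf.
    rewrite UE// SE// => eqn.
    have := shiftE Du Dv; rewrite hu//.
    rewrite (formDl Hip Hf (ZH Du) (DH Dv)) addrK eqn.
    rewrite (_ : \sum_j ip u (g j) * _ = \sum_j c 0 j * ip v (g j)).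
      by move=> h1; lra.
    by apply: eq_bigr => j _; rewrite mxE.
  have ce : c - c *m Gamma = \row_j ip (S f) (g j).
    apply/rowP => j; rewrite mxE [X in _ + X]mxE -Ug !mxE.
    have := form_null HS Hip (DH De) (Hg j) e0.
    rewrite /e (formBl HS Hip (DH Du) (DH DSU) (Hg j)).
    rewrite (formDl Hip (DH (DSf _ Hf)) (DH (DU c)) (Hg j)) => /eqP.
    by rewrite subr_eq0 => /eqP ->; rewrite addrK.
  by rewrite -ce (_ : c - _ = c *m (1%:M - Gamma)) ?mulmxK// mulmxBr mulmx1.
have bB k : `|ip (S f) (g k)| <= Num.sqrt (ip f f) * B k.
  rewrite -sqrtrM// -sqrtr_sqr ler_wsqrtr//.
  have DS1 := DSf _ Hf.
  apply: (le_trans (form_CS HS Hip (DH DS1) (Hg k))).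
  rewrite mulrA [ip f f * _]mulrC; apply: ler_wpM2r;
    first exact: (form_ge0 Hip).
  by apply: bounded => // v; exact: SE.
have cC j : ip u (g j) ^+ 2 <= ip f f * C j ^+ 2.
  have C0 k : 0 <= C k.
    by apply: sumr_ge0 => i _; rewrite mulr_ge0// sqrtr_ge0.
  rewrite -[ip f f]sqr_sqrtr// -exprMn -[ip u _ ^+ 2]real_normK ?num_real//.
  rewrite ler_sqr ?nnegrE ?normr_ge0 ?mulr_ge0 ?sqrtr_ge0//.
  have -> : ip u (g j) = c 0 j by rewrite mxE.
  rewrite cE mxE mulr_sumr; apply: (le_trans (ler_norm_sum _ _ _)).
  apply: ler_sum => k _; rewrite mxE normrM mulrA.
  by apply: ler_wpM2r.
(* The finite rank bound is applied to u itself, with h(u,u) replaced by means of the equation.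
   Since eps * (K + 1) <= 1/2, half of ip(u,u) is absorbed on the left; hence the factor 2 in the
   constant. *)
have h1 := gP Du.
have h2 : \sum_j ip u (g j) ^+ 2 <= (\sum_j C j ^+ 2) * ip f f.
  by rewrite mulrC mulr_sumr; exact: ler_sum.
have h3 : M * \sum_j ip u (g j) ^+ 2 <= M * ((\sum_j C j ^+ 2) * ip f f).
  exact: ler_wpM2l.
have h4 := form_young HS Hip (ltr01 : 0 < 1 :> R) Hf (DH Du).
rewrite mul1r invr1 mul1r in h4.
have h5 := ler_norm (ip f u).
have h6 : eps * (2 * ip f u) <= eps * (ip f f + ip u u).
  by rewrite ler_pM2l//; lra.
have h7 : eps * ip (Z u) u <= eps * (K * ip u u).
  by rewrite ler_pM2l//; exact: Zle.
have h8 : eps * (K + 1) * ip u u <= 2^-1 * ip u u by exact: ler_wpM2r.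
rewrite hu// (formDl Hip Hf (ZH Du) (DH Du)) in h1.
have h9 : 0 <= eps * ip u u by rewrite mulr_ge0// ltW.
rewrite mulrDl; move: h1 h3 h6 h7 h8 h9.
move: (\sum_j _) (\sum_j _) => x y; lra.
Qed.

End bound.

Hypothesis compact : forall eps, 0 < eps -> exists N (g : 'I_N -> E) M,
  [/\ 0 <= M, forall j, H (g j) & finite_rank_bound eps g M].

Definition eigenpair (l : R) u := D u /\ forall v, D v -> h u v = l * ip u v.

Lemma eigenpair_orthogonal l l' u v : eigenpair l u -> eigenpair l' v ->
  l != l' -> ip u v = 0.
Proof.
move=> [Du hu] [Dv hv] ll'; have := hu _ Dv; rewrite (formC Dh)// hv//.
rewrite (formC Hip (DH Dv) (DH Du)) => /eqP; rewrite -subr_eq0 -mulrBl mulf_eq0.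
by rewrite subr_eq0 eq_sym (negbTE ll') => /eqP.
Qed.

Definition eigenfamily (Lambda : R) n (l : 'I_n -> R) (e : 'I_n -> E) :=
  [/\ forall k, eigenpair (l k) (e k), forall k, `|l k| <= Lambda &
      forall j k, ip (e j) (e k) = (j == k)%:R].

(** With more eigenvectors than vectors g_j some nontrivial combination u is orthogonal to all g_j.
    For it h(u,u) <= Lambda ip(u,u), and (1) with eps = 1 / (2 Lambda) would give ip(u,u) <= ip(u,u)
    / 2. *)
Lemma eigenfamily_size Lambda : 0 < Lambda -> exists N, forall n l e,
  @eigenfamily Lambda n l e -> (n <= N)%N.
Proof.
move=> L0; pose eps := (2 * Lambda)^-1.
have eps0 : 0 < eps by rewrite invr_gt0 mulr_gt0.
have [N [g [M [M0 Hg gP]]]] := compact eps0.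
exists N => n l e [eig lL ortho]; rewrite leqNgt; apply/negP => Nn.
have De k : D (e k) by case: (eig k).
have he k v : D v -> h (e k) v = l k * ip (e k) v by case: (eig k) => _; apply.
pose A := \matrix_(k < n, j < N) ip (e k) (g j).
have : kermx A != 0.
  by rewrite kermx_eq0 -row_leq_rank -ltnNge (leq_ltn_trans (rank_leq_col _)).
move=> /rowV0Pn[c /sub_kermxP cA c0].
pose u := \sum_k c 0 k *: e k.
have Du : D u by apply: (subspace_sum DS).
have ipu k : ip u (e k) = c 0 k.
  rewrite (form_suml HS Hip)//; [|by move=> i _; exact: DH|exact: DH].
  rewrite (bigD1 k)//= ortho eqxx mulr1 big1 ?addr0// => j jk.
  by rewrite ortho (negbTE jk) mulr0.
have ug j : ip u (g j) = 0.
  rewrite (form_suml HS Hip)//; last by move=> i _; exact: DH.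
  have /matrixP/(_ 0 j) := cA; rewrite [RHS]mxE mxE => cA0; rewrite -[RHS]cA0.
  by apply: eq_bigr => k _; rewrite mxE.
have uu : ip u u = \sum_k c 0 k ^+ 2.
  rewrite {1}/u (form_suml HS Hip)//; [|by move=> i _; exact: DH|exact: DH].
  apply: eq_bigr => k _.
  by rewrite (formC Hip (DH (De k)) (DH Du)) ipu expr2.
have hu : h u u = \sum_k l k * c 0 k ^+ 2.
  rewrite {1}/u (form_suml DS Dh)//; apply: eq_bigr => k _.
  by rewrite he// (formC Hip (DH (De k)) (DH Du)) ipu mulrCA expr2.
have := gP _ Du; rewrite [X in _ + M * X]big1; last first.
  by move=> j _; rewrite ug expr0n.
rewrite mulr0 addr0.
have hL : h u u <= Lambda * ip u u.
  rewrite hu uu mulr_sumr; apply: ler_sum => k _.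
  by rewrite ler_wpM2r ?sqr_ge0// (le_trans (ler_norm _)).
have u0 : 0 < ip u u.
  rewrite lt_neqAle (form_ge0 Hip (DH Du)) andbT eq_sym.
  apply: contra c0 => /eqP uu0; apply/eqP/rowP => k.
  by rewrite mxE -ipu (form_null HS Hip (DH Du) (DH (De k))).
move=> h1; have h2 : eps * h u u <= 2^-1 * ip u u.
  rewrite (_ : 2^-1 * _ = eps * (Lambda * ip u u)); first by rewrite ler_pM2l.
  by rewrite /eps; field; rewrite gt_eqF.
by have := le_trans h1 h2; lra.
Qed.

(** Take a family of maximal size. Subtracting from an eigenvector its components with the same
    eigenvalue leaves an eigenvector orthogonal to the whole family, eigenvectors for different
    eigenvalues being orthogonal anyway; if it were not null, its normalisation would enlarge the
    family. *)
Lemma eigenfamily_complete Lambda : 0 < Lambda ->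
  exists n l e, @eigenfamily Lambda n l e /\
    forall lam u, eigenpair lam u -> `|lam| <= Lambda ->
      let w := u - \sum_(k | l k == lam) ip u (e k) *: e k in ip w w = 0.
Proof.
move=> L0; have [N NP] := eigenfamily_size L0.
pose P n := `[< exists l e, @eigenfamily Lambda n l e >].
have P0 : exists n, P n.
  exists 0; apply/asboolP; exists (fun=> 0), (fun=> 0).
  by split => -[].
have PN n : P n -> (n <= N)%N by move=> /asboolP[l [e /NP]].
case: (ex_maxnP P0 PN) => n /asboolP[l [e fam]] nmax.
have [eig lL ortho] := fam.
have De k : D (e k) by case: (eig k).
exists n, l, e; split => // lam u eigu lamL w.
have [Du hu] := eigu.
have Dsum : D (\sum_(k | l k == lam) ip u (e k) *: e k) by exact: (subspace_sum
  DS).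
have Dw : D w by exact: (subspaceB DS).
have we j : ip w (e j) = 0.
  rewrite (formBl HS Hip (DH Du) (DH Dsum) (DH (De j))).
  rewrite (form_suml HS Hip)//; [|by move=> i _; exact: DH|exact: DH].
  have [lj|lj] := eqVneq (l j) lam.
    rewrite (bigD1 j) ?lj//= ortho eqxx mulr1 big1 ?addr0 ?subrr// => i /andP[_
      ij].
    by rewrite ortho (negbTE ij) mulr0.
  rewrite (eigenpair_orthogonal eigu (eig j)) 1?eq_sym// big1 ?subrr// => i
    /eqP li.
  rewrite ortho; case: eqP => [ij|]; last by rewrite mulr0.
  by move: lj; rewrite -ij li eqxx.
have hw : eigenpair lam w.
  split => // v Dv; rewrite (formBl DS Dh)// hu//.
  rewrite (formBl HS Hip (DH Du) (DH Dsum) (DH Dv)) mulrBr; congr (_ - _).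
  rewrite (form_suml DS Dh)// (form_suml HS Hip)//; last 2 first.
  - by move=> i _; exact: DH.
  - exact: DH.
  rewrite mulr_sumr; apply: eq_bigr => k /eqP lk.
  by have [_ ->//] := eig k; rewrite lk mulrCA.
apply/eqP; rewrite eq_le (form_ge0 Hip (DH Dw)) andbT leNgt; apply/negP => w0.
pose e' := (Num.sqrt (ip w w))^-1 *: w.
have De' : D e' by exact: (subspaceZ DS).
suff : P n.+1 by move=> /nmax; rewrite ltnn.
apply/asboolP.
exists (fun k => if unlift ord0 k is Some j then l j else lam).
exists (fun k => if unlift ord0 k is Some j then e j else e').
have ee' j : ip e' (e j) = 0.
  by rewrite (formZl Hip _ (DH Dw) (DH (De j))) we mulr0.
have e'1 : ip e' e' = 1.
  rewrite (form_sqrZ HS Hip) ?exprVn ?sqr_sqrtr ?mulVf ?gt_eqF//;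
    first exact: ltW.
  exact: DH.
split => [k|k|j k].
- case: unliftP => [j _|_] //; split => // v Dv.
  by rewrite (formZl Dh)// (formZl Hip _ (DH Dw) (DH Dv)) hw.2// mulrCA.
- by case: unliftP.
- case: unliftP => [j' ->|->]; case: unliftP => [k' ->|->].
  + by rewrite ortho (inj_eq (@lift_inj _ _)).
  + by rewrite (formC Hip (DH (De _)) (DH De')) ee' eq_sym (negbTE (neq_lift _
    _)).
  + by rewrite ee' (negbTE (neq_lift _ _)).
  + by rewrite e'1 eqxx.
Qed.

End Fredholm.

(** * Lebesgue measure on row vectors *)

Section boxes.
Variables (R : realType) (d : nat).
Local Notation mes := (lebesgue_rV R d).
Implicit Types (a b x y : 'rV[R]_d).

(** Open boxes are stable under intersection and generate the sigma-algebra, so measures are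
    compared on them; half-open boxes serve to partition the space. *)
Definition obox a b : set 'rV[R]_d :=
  [set x | forall i, a ord0 i < x ord0 i < b ord0 i].

Definition hobox a b : set 'rV[R]_d :=
  [set x | forall i, a ord0 i <= x ord0 i < b ord0 i].

Lemma measurable_box (A : 'I_d -> set R) : (forall i, measurable (A i)) ->
  measurable [set x : 'rV[R]_d | forall i, A i (x ord0 i)].
Proof.
move=> mA; rewrite (_ : [set x | _] = \bigcap_(i in [set: 'I_d])
    ((fun x : 'rV[R]_d => x ord0 i) @^-1` A i)); last first.
  by apply/seteqP; split=> x /= Bx i; [move=> _; exact: Bx|exact: Bx i I].
apply: fin_bigcap_measurable => // i _.
by rewrite -[X in measurable X]setTI; exact: measurable_coord.
Qed.

Lemma oboxE a b :
  obox a b = [set x | forall i, `]a ord0 i, b ord0 i[%classic (x ord0 i)].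
Proof. by apply/seteqP; split => x /= xab i; have := xab i; rewrite in_itv. Qed.

Lemma hoboxE a b :
  hobox a b = [set x | forall i, `[a ord0 i, b ord0 i[%classic (x ord0 i)].
Proof. by apply/seteqP; split => x /= xab i; have := xab i; rewrite in_itv. Qed.

Lemma measurable_obox a b : measurable (obox a b).
Proof.
rewrite oboxE.
by apply: (@measurable_box (fun i => `]a ord0 i, b ord0 i[%classic)) => i;
  exact: measurable_itv.
Qed.

Lemma measurable_hobox a b : measurable (hobox a b).
Proof.
rewrite hoboxE.
by apply: (@measurable_box (fun i => `[a ord0 i, b ord0 i[%classic)) => i;
  exact: measurable_itv.
Qed.

Lemma lebesgue_obox a b : (forall i, a ord0 i <= b ord0 i) ->
  mes (obox a b) = (\prod_i (b ord0 i - a ord0 i))%:E.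
Proof.
move=> ab; rewrite oboxE (lebesgue_rV_box (A := fun i => `]a ord0 i, b ord0
  i[%classic))//.
rewrite -prodEFin; apply: eq_bigr => i _.
rewrite lebesgue_measure_itv/= lte_fin; case: ltP => //.
by move=> ba; rewrite (@le_anti _ _ (a ord0 i) (b ord0 i)) ?subrr ?ab.
Qed.

Lemma lebesgue_hobox a b : (forall i, a ord0 i <= b ord0 i) ->
  mes (hobox a b) = (\prod_i (b ord0 i - a ord0 i))%:E.
Proof.
move=> ab; rewrite hoboxE (lebesgue_rV_box (A := fun i => `[a ord0 i, b ord0
  i[%classic))//.
rewrite -prodEFin; apply: eq_bigr => i _.
rewrite lebesgue_measure_itv/= lte_fin; case: ltP => //.
by move=> ba; rewrite (@le_anti _ _ (a ord0 i) (b ord0 i)) ?subrr ?ab.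
Qed.

Lemma obox0 a b i : b ord0 i <= a ord0 i -> obox a b = set0.
Proof.
move=> ba; apply/seteqP; split => // x /(_ i)/andP[ax xb].
by have := lt_trans ax xb; rewrite ltNge ba.
Qed.

Lemma lebesgue_obox_fin a b : (mes (obox a b) < +oo)%E.
Proof.
have [ab|/existsNP[i /negP]] := pselect (forall i, a ord0 i <= b ord0 i).
  by rewrite lebesgue_obox// ltry.
by rewrite -ltNge => /ltW/obox0 ->; rewrite measure0.
Qed.

Lemma oboxI a b a' b' : obox a b `&` obox a' b' =
  obox (\row_i Num.max (a ord0 i) (a' ord0 i))
       (\row_i Num.min (b ord0 i) (b' ord0 i)).
Proof.
apply/seteqP; split => x /=.
  move=> [h h'] i; rewrite !mxE gt_max lt_min.
  by have /andP[-> ->] := h i; have /andP[-> ->] := h' i.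
by move=> h; split => i; have := h i; rewrite !mxE gt_max lt_min;
  move=> /andP[/andP[? ?] /andP[? ?]]; apply/andP.
Qed.

Definition cube_obox (M : R) := obox (const_mx (- M)) (const_mx M).

Lemma bigcup_cube_obox : \bigcup_n cube_obox n.+1%:R = setT.
Proof.
apply/seteqP; split => // x _.
pose M := \sum_i `|x ord0 i|.
exists (Num.truncn M) => // i; rewrite !mxE -ltr_norml.
apply: (le_lt_trans _ (truncnS_gt _)).
by rewrite /M (bigD1 i)//= lerDl sumr_ge0.
Qed.

Definition oboxes := [set A | exists a b, A = obox a b].

Lemma setI_closed_oboxes : setI_closed oboxes.
Proof.
by move=> _ _ [a [b ->]] [a' [b' ->]]; rewrite oboxI; eexists; eexists.
Qed.

Lemma measurable_oboxes : (@measurable _ 'rV[R]_d) = <<s oboxes >>.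
Proof.
apply/seteqP; split; last first.
  apply: smallest_sub; first exact: sigma_algebra_measurable.
  by move=> _ [a [b ->]]; exact: measurable_obox.
apply: smallest_sub; first exact: smallest_sigma_algebra.
move=> A; rewrite -bigcup_seq/= => -[i _ [B + <-]].
rewrite setTI; pose coord (x : 'rV[R]_d) := x ord0 i.
change (measurable B -> @measurable _ (g_sigma_algebraType oboxes) (coord @^-1`
  B)).
move=> mB.
suff mcoord : measurable_fun setT (coord : g_sigma_algebraType oboxes -> R).
  by rewrite -[X in measurable X]setTI; exact: mcoord.
apply: (measurability _ (RGenOpens.measurableE R)) => _ [_ [u [v ->]] <-].
(* A slab in the i-th direction is the union of boxes growing in the other directions. *)
rewrite setTI (_ : _ @^-1` _ = \bigcup_n obox
    (\row_j if j == i then u else - n.+1%:R)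
    (\row_j if j == i then v else n.+1%:R)).
  apply: bigcupT_measurable => n; apply: sub_sigma_algebra.
  by eexists; eexists; reflexivity.
apply/seteqP; split => x /=.
  rewrite in_itv/= => uxv.
  have : (\bigcup_n cube_obox n.+1%:R) x by rewrite bigcup_cube_obox.
  move=> [n _ xn]; exists n => // j; rewrite !mxE; case: eqP => [->//|_].
  by have := xn j; rewrite !mxE.
by move=> [n _ /(_ i)]; rewrite !mxE eqxx in_itv.
Qed.

(** Uniqueness of measures on a pi-system exhausting the space. It yields translation invariance,
    and later the equality of the two densities in the fundamental lemma. *)
Lemma obox_measure_unique (m1 m2 : {measure set 'rV[R]_d -> \bar R}) :
  (forall a b, (m1 (obox a b) < +oo)%E) ->
  (forall a b, m1 (obox a b) = m2 (obox a b)) ->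
  forall A, measurable A -> m1 A = m2 A.
Proof.
move=> m1fin m12; apply: (measure_unique oboxes (fun n => cube_obox n.+1%:R)).
- exact: measurable_oboxes.
- exact: setI_closed_oboxes.
- by move=> n; eexists; eexists; reflexivity.
- exact: bigcup_cube_obox.
- by move=> _ [a [b ->]].
- by move=> n; exact: m1fin.
Qed.

Lemma nbhs_rV x (U : set 'rV[R]_d) : nbhs x U <->
  exists2 e : R, 0 < e & (forall y, (forall i, `|y ord0 i - x ord0 i| < e) -> U
    y).
Proof.
split.
  move=> /nbhs_ballP[e e0 xU]; exists e => // y xy; apply: xU.
  by split => // i j; rewrite (ord1 i) /ball/= distrC.
move=> [e e0 xU]; apply/nbhs_ballP; exists e => // y [_ xy]; apply: xU => i.
by rewrite distrC; exact: xy.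
Qed.

(** The sigma-algebra is defined by the coordinates and not by the topology. An open set is the
    union of the boxes with rational corners that it contains, enumerated through [unpickle]. *)
Lemma open_measurable_rV (U : set 'rV[R]_d) : open U -> measurable U.
Proof.
move=> oU.
pose B (p : {ffun 'I_d -> rat * rat}) :=
  obox (\row_i ratr (p i).1) (\row_i ratr (p i).2).
pose F n : set 'rV[R]_d := if unpickle n is Some p
  then (if `[< B p `<=` U >] then B p else set0) else set0.
rewrite (_ : U = \bigcup_n F n).
  apply: bigcupT_measurable => n; rewrite /F; case: unpickle => // p.
  by case: ifP => // _; exact: measurable_obox.
apply/seteqP; split => x; last first.
  by move=> [n _]; rewrite /F; case: unpickle => // p;
    case: asboolP => // + Bx; apply.
move=> Ux; have /nbhs_rV[e e0 xU] := open_nbhs_nbhs (conj oU Ux).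
have ex i : exists pq : rat * rat, x ord0 i - e < ratr pq.1 < x ord0 i /\
    x ord0 i < ratr pq.2 < x ord0 i + e.
  have /rat_in_itvoo[p] : x ord0 i - e < x ord0 i by rewrite ltrBlDr ltrDl.
  have /rat_in_itvoo[q] : x ord0 i < x ord0 i + e by rewrite ltrDl.
  by rewrite !in_itv/= => ? ?; exists (p, q).
have [pq pqP] := choice ex.
exists (pickle [ffun i => pq i]) => //; rewrite /F pickleK.
rewrite asboolT.
  by move=> i; rewrite !mxE ffunE; have [/andP[_ ->] /andP[-> _]] := pqP i.
move=> y yB; apply: xU => i; have := yB i; rewrite !mxE ffunE.
by have [/andP[? ?] /andP[? ?]] := pqP i; move=> /andP[? ?];
  rewrite ltr_distl; apply/andP; split; lra.
Qed.

Lemma continuous_measurable_rV (f : 'rV[R]_d -> R) :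
  continuous f -> measurable_fun setT f.
Proof.
move=> cf; apply: (measurability _ (RGenOpens.measurableE R)) => _ [_ [u [v
  ->]] <-].
rewrite setTI; apply: open_measurable_rV; apply: open_comp;
  last exact: interval_open.
by move=> x _; exact: cf.
Qed.

Lemma measurable_addrV : measurable_fun setT (fun p : 'rV[R]_d * 'rV[R]_d =>
  p.1 + p.2).
Proof.
apply: measurable_fun_rV => i; under eq_fun do rewrite mxE.
by apply: measurable_funD; apply: (measurableT_comp (measurable_coord i)).
Qed.

Lemma measurable_addr_rV y : measurable_fun setT (fun x : 'rV[R]_d => x + y).
Proof.
apply: measurable_fun_rV => i; under eq_fun do rewrite mxE.
by apply: measurable_funD => //; exact: measurable_coord.
Qed.

Definition translate y x : 'rV[R]_d := x + y.

Lemma lebesgue_rV_translate y A : measurable A ->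
  mes (translate y @^-1` A) = mes A.
Proof.
move=> mA; rewrite -/(pushforward mes (translate y) A).
have preim a b : translate y @^-1` obox a b = obox (a - y) (b - y).
  by apply/seteqP; split => x h i; have := h i; rewrite !mxE ltrBlDr ltrBrDr.
apply: (@obox_measure_unique (pushforward mes (translate y)) mes) => //.
- exact: measurable_addr_rV.
- move=> mt a b; change (mes (translate y @^-1` obox a b) < +oo)%E.
  by rewrite preim; exact: lebesgue_obox_fin.
move=> mt a b; change (mes (translate y @^-1` obox a b) = mes (obox a b)).
rewrite preim.
have [ab|/existsNP[i /negP]] := pselect (forall i, a ord0 i <= b ord0 i).
  rewrite !lebesgue_obox//; last by move=> i; rewrite !mxE lerD2r.
  by congr EFin; apply: eq_bigr => i _; rewrite !mxE opprB addrA subrK.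
by rewrite -ltNge => /ltW ba; rewrite !(@obox0 _ _ i)// !mxE lerD2r.
Qed.

Lemma ge0_integral_translate y (f : 'rV[R]_d -> \bar R) :
  measurable_fun setT f -> (forall x, 0 <= f x)%E ->
  (\int[mes]_x f (x + y)%R = \int[mes]_x f x)%E.
Proof.
move=> mf f0.
rewrite [RHS](eq_measure_integral (pushforward mes (translate y))); last first.
- by move=> mt A mA _; rewrite -[LHS](lebesgue_rV_translate y).
- by move=> mt; rewrite ge0_integral_pushforward.
- exact: measurable_addr_rV.
Qed.

End boxes.

(** * Test functions *)

Section smooth1.
Variable R : realType.
Implicit Types (f g : R -> R) (p : {poly R}).

Fixpoint Cn (n : nat) f : Prop :=
  if n is n'.+1 then (forall x, derivable f x 1) /\ Cn n' f^`()%classic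
  else continuous f.

Definition smooth1 f := forall n, Cn n f.

Lemma derivable_continuous f : (forall x, derivable f x 1) -> continuous f.
Proof. by move=> df x; exact/differentiable_continuous/derivable1_diffP. Qed.

Lemma CnW n f : Cn n.+1 f -> Cn n f.
Proof.
elim: n f => [|n IHn] f /=; first by move=> [/derivable_continuous].
by move=> [df Cf]; split => //; exact: IHn.
Qed.

Lemma Cn_cst n c : Cn n (fun=> c).
Proof.
elim: n c => [|n IHn] c /=; first by move=> x; exact: cst_continuous.
split => [x|]; first exact: derivable_cst.
by rewrite (_ : _^`()%classic = fun=> 0)//; apply/funext => x;
  rewrite derive1_cst.
Qed.

Lemma CnD n f g : Cn n f -> Cn n g -> Cn n (fun x => f x + g x).
Proof.
elim: n f g => [|n IHn] f g /=; first by move=> cf cg x;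
  exact: cvgD (cf x) (cg x).
move=> [df Cf] [dg Cg]; split => [x|]; first exact: derivableD.
rewrite (_ : _^`()%classic = fun x => f^`()%classic x + g^`()%classic x);
  first exact: IHn.
by apply/funext => x; rewrite !derive1E deriveD.
Qed.

Lemma CnM n f g : Cn n f -> Cn n g -> Cn n (fun x => f x * g x).
Proof.
elim: n f g => [|n IHn] f g; first by move=> cf cg x; exact: cvgM (cf x) (cg x).
move=> Cf1 Cg1; have [df Cf] := Cf1; have [dg Cg] := Cg1.
split => [x|]; first exact: derivableM.
rewrite (_ : _^`()%classic =
    fun x => f x * g^`()%classic x + g x * f^`()%classic x).
  by apply: CnD; apply: IHn => //; exact: CnW.
by apply/funext => x; rewrite !derive1E deriveM.
Qed.

Lemma is_derive1_affine f (a b x : R) : derivable f (a * x + b) 1 ->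
  is_derive x 1 (fun y => f (a * y + b)) (f^`()%classic (a * x + b) * a).
Proof.
move=> df; apply: is_derive1_comp.
  by rewrite derive1E; apply: DeriveDef.
apply: (is_derive_eq (is_deriveD (is_deriveZ a (is_derive_id x (1 : R)))
  (is_derive_cst b x (1 : R)))).
by rewrite addr0 /GRing.scale/= mulr1.
Qed.

Lemma Cn_affine n f (a b : R) : Cn n f -> Cn n (fun x => f (a * x + b)).
Proof.
elim: n f => [|n IHn] f.
  move=> cf x; apply: (@continuous_comp _ _ _ (fun x => a * x + b) f);
    last exact: cf.
  by apply: cvgD; [apply: cvgMr; exact: cvg_id|exact: cvg_cst].
move=> [df Cf]; split => [x|].
  by have [] := is_derive1_affine (df (a * x + b)).
rewrite (_ : _^`()%classic = fun x => f^`()%classic (a * x + b) * a).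
  by apply: CnM; [exact: IHn|exact: Cn_cst].
apply/funext => x; rewrite derive1E.
by have [] := is_derive1_affine (df (a * x + b)).
Qed.

(* [x |-> p(1/x) exp(-1/x)] extended by [0] to [x <= 0]: this family contains
   its derivatives. *)
Definition flat p x : R := if 0 < x then p.[x^-1] * expR (- x^-1) else 0.

Lemma exp_ge_poly p : exists2 C, 0 <= C &
  forall t, 0 <= t -> `|p.[t]| <= C * expR t.
Proof.
exists (\sum_(i < size p) `|p`_i| * i`!%:R) => [|t t0].
  by apply: sumr_ge0 => i _; rewrite mulr_ge0.
rewrite horner_coef mulr_suml; apply: (le_trans (ler_norm_sum _ _ _)).
apply: ler_sum => i _; rewrite normrM -mulrA ler_wpM2l// ger0_norm ?exprn_ge0//.
case: (nat_of_ord i) => [|n].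
  by rewrite expr0 fact0 mul1r -expR0 ler_expR.
rewrite mulrC -ler_pdivrMr ?ltr0n ?fact_gt0//.
by rewrite (le_trans _ (expR_ge1Dxn n t0))// lerDr.
Qed.

(** Compare X^2 p with the exponential at 1 / x. The quadratic decay makes the difference quotients
    at 0 tend to 0, the only delicate point in differentiating [flat]. *)
Lemma flat_le p : exists2 C, 0 <= C & forall x, `|flat p x| <= C * x ^+ 2.
Proof.
have [C C0 HC] := exp_ge_poly ('X^2 * p); exists C => // x.
rewrite /flat; case: ifPn => [x0|_]; last by rewrite normr0 mulr_ge0 ?sqr_ge0.
have t0 : 0 <= x^-1 by rewrite invr_ge0 ltW.
have := HC _ t0; rewrite hornerM hornerXn normrM ger0_norm ?exprn_ge0//.
rewrite exprVn ler_pdivrMl ?exprn_gt0// => h; rewrite normrM expRN.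
rewrite (@ger0_norm _ (expR _)^-1) ?invr_ge0 ?expR_ge0//.
by rewrite ler_pdivrMr ?expR_gt0// [C * _]mulrC -mulrA.
Qed.

Lemma is_derive_flat p (x : R) :
  is_derive x 1 (flat p) (flat ('X^2 * (p - p^`())) x).
Proof.
have [x0|x0|->] := ltgtP x 0.
- rewrite {2}/flat ltNge ltW//=.
  apply: (@near_eq_is_derive _ _ _ (cst 0)).
  near=> y; rewrite /flat/= ltNge (_ : y <= 0)//.
  by apply: ltW; near: y; exact: lt_nbhsl.
- rewrite {2}/flat x0.
  suff : is_derive x 1 (fun x => p.[x^-1] * expR (- x^-1))
      (('X^2 * (p - p^`())).[x^-1] * expR (- x^-1)).
    apply: near_eq_is_derive; near=> y; rewrite /flat/= (_ : 0 < y)//.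
    by near: y; exact: lt_nbhsr.
  have dV : is_derive x 1 (fun y : R => y^-1) (- x ^- 2).
    apply: is_derive_eq; first by apply: is_deriveV; rewrite gt_eqF.
    by rewrite /GRing.scale/= mulr1.
  apply: is_derive_eq.
  rewrite /GRing.scale/= !hornerE /=.
  by field; rewrite gt_eqF.
- rewrite {2}/flat ltxx.
  have [C C0 HC] := flat_le p.
  suff : (fun h => h^-1 *: ((flat p \o shift 0) (h *: 1) - flat p 0)) @ 0^' -->
    0.
    move=> cv; apply: DeriveDef; first by apply/cvg_ex; exists 0.
    exact: cvg_lim.
  have C1 : 0 < C + 1 by rewrite ltr_wpDl.
  apply/cvgr0Pnorm_le => /= e e0; near=> h.
  rewrite [flat p 0]/flat ltxx subr0 addr0 /GRing.scale/= mulr1.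
  have h0 : h != 0 by near: h; exact: nbhs_dnbhs_neq.
  rewrite normrM normfV ler_pdivrMl ?normr_gt0//.
  apply: (le_trans (HC h));
    rewrite -[h ^+ 2]real_normK ?num_real// expr2 mulrCA.
  rewrite ler_wpM2l//.
  have : `|h| <= e / (C + 1).
    by near: h; apply: dnbhs0_le; rewrite divr_gt0.
  rewrite ler_pdivlMr// => /(le_trans _); apply.
  by rewrite mulrC ler_wpM2l// lerDl.
Unshelve. all: by end_near. Qed.

Lemma smooth1_flat p : smooth1 (flat p).
Proof.
move=> n; elim: n p => [|n IHn] p.
  by apply: derivable_continuous => x; have [] := is_derive_flat p x.
split => [x|]; first by have [] := is_derive_flat p x.
rewrite (_ : _^`()%classic = flat ('X^2 * (p - p^`()))); first exact: IHn.
by apply/funext => x; rewrite derive1E; have [] := is_derive_flat p x.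
Qed.

(** It vanishes outside ]a, b[ and tends to 1 at each point inside as n grows, the argument of
    [flat] going to infinity there. The products are expanded to match the shape of [Cn_affine]. *)
Definition smooth_bump (a b : R) (n : nat) x :=
  flat 1 (n.+1%:R * x - n.+1%:R * a) * flat 1 (- n.+1%:R * x + n.+1%:R * b).

Lemma smooth1_bump a b n : smooth1 (smooth_bump a b n).
Proof. by move=> k; apply: CnM; apply: Cn_affine; exact: smooth1_flat. Qed.

Lemma flat1_ge0 x : 0 <= flat 1 x.
Proof. by rewrite /flat; case: ifPn => // _;
  rewrite hornerE mul1r expR_ge0. Qed.

Lemma flat1_le1 x : flat 1 x <= 1.
Proof.
rewrite /flat; case: ifPn => // x0.
by rewrite hornerE mul1r expR_le1 oppr_le0 invr_ge0 ltW.
Qed.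

Lemma bump_ge0 a b n x : 0 <= smooth_bump a b n x.
Proof. by rewrite mulr_ge0 ?flat1_ge0. Qed.

Lemma bump_le1 a b n x : smooth_bump a b n x <= 1.
Proof. by rewrite -[leRHS]mulr1 ler_pM ?flat1_ge0 ?flat1_le1. Qed.

Lemma bump_eq0 a b n x : ~~ (a < x < b) -> smooth_bump a b n x = 0.
Proof.
rewrite negb_and -!leNgt /smooth_bump /flat => /orP[xa|bx].
  rewrite ifF ?mul0r//; apply/negbTE; rewrite -leNgt subr_le0.
  by rewrite ler_wpM2l.
rewrite [X in _ * X]ifF ?mulr0//; apply/negbTE; rewrite -leNgt mulNr addrC.
by rewrite subr_le0 ler_wpM2l.
Qed.

Lemma cvg_bump a b x : a < x < b -> (smooth_bump a b n x) @[n --> \oo] --> (1 :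
  R).
Proof.
move=> /andP[ax xb].
have cvg_flat (c : R) : 0 < c -> (flat 1 (n.+1%:R * c)) @[n --> \oo] --> (1 :
  R).
  move=> c0; rewrite (_ : (fun n => _) = fun n => expR (- (n.+1%:R^-1 * c^-1))).
    rewrite -[X in _ --> X]expR0; apply: continuous_cvg;
      first exact: continuous_expR.
    rewrite -[X in _ --> X]oppr0; apply: cvgN.
    rewrite -[X in _ --> X](mul0r c^-1); apply: cvgM; last exact: cvg_cst.
    exact: cvg_harmonic.
  apply/funext => n; rewrite /flat mulr_gt0// hornerE mul1r invfM.
  by [].
rewrite (_ : (fun n => _) = fun n => flat 1 (n.+1%:R * (x - a)) *
    flat 1 (n.+1%:R * (b - x))).
  rewrite -[X in _ --> X]mulr1.
  by apply: cvgM; apply: cvg_flat; rewrite subr_gt0.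
by apply/funext => n; congr (flat _ _ * flat _ _); ring.
Qed.

End smooth1.

Section product_test_functions.
Variables (R : realType) (d : nat).
Implicit Types (f : 'I_d -> R -> R) (x : 'rV[R]_d).

Definition prodf f x := \prod_i f i (x ord0 i).

Lemma continuous_prodf f : (forall i, continuous (f i)) -> continuous (prodf f).
Proof.
move=> cf; rewrite /prodf; elim: (index_enum _) => [|i s IHs].
  by under eq_fun do rewrite big_nil; move=> x; exact: cst_continuous.
have cfi : continuous (fun x : 'rV[R]_d => f i (x ord0 i)).
  move=> x; apply: (@continuous_comp _ _ _ (fun x : 'rV[R]_d => x ord0 i) (f
    i)).
    exact: coord_continuous.
  exact: cf.
under eq_fun do rewrite big_cons.
by move=> x; exact: (continuousM (cfi x) (IHs x)).
Qed.

Lemma is_derive_prodf f i x : derivable (f i) (x ord0 i) 1 ->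
  is_derive x (delta_mx ord0 i) (prodf f)
    (prodf (fun j => if j == i then (f j)^`()%classic else f j) x).
Proof.
move=> df; pose C := \prod_(j | j != i) f j (x ord0 j).
have cvC : (fun h => h^-1 *: ((prodf f \o shift x) (h *: delta_mx ord0 i) -
  prodf f x))
    @ 0^' --> prodf (fun j => if j == i then (f j)^`()%classic else f j) x.
  have -> : prodf (fun j => if j == i then (f j)^`()%classic else f j) x =
      C * (f i)^`()%classic (x ord0 i).
    rewrite /prodf (bigD1 i)//= eqxx mulrC; congr (_ * _).
    by apply: eq_bigr => j /negbTE ->.
  rewrite (_ : (fun h => _) = fun h => C * (h^-1 *:
      ((f i \o shift (x ord0 i)) (h *: 1) - f i (x ord0 i)))).
    apply: cvgMr; rewrite derive1E; exact: df.
  apply/funext => h; rewrite /prodf/= (bigD1 i)//= [X in _ - X](bigD1 i)//=.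
  rewrite !mxE !eqxx mulr1 /GRing.scale/= mulr1 -/C.
  rewrite (_ : \prod_(j < d | j != i) _ = C); first by ring.
  by apply: eq_bigr => j ji; rewrite !mxE/= (negbTE ji) mulr0 add0r.
apply: DeriveDef; first by apply/cvg_ex; eexists; exact: cvC.
exact: cvg_lim.
Qed.

Lemma partial_prodf f i : (forall j (x : R), derivable (f j) x 1) ->
  partial i (prodf f) = prodf (fun j => if j == i then (f j)^`()%classic else f
    j).
Proof.
by move=> df; apply/funext => x; have [_] := is_derive_prodf (df i (x ord0 i)).
Qed.

Lemma smooth1_derivable (f : R -> R) (x : R) : smooth1 f -> derivable f x 1.
Proof. by move=> /(_ 1%N)[]. Qed.

Lemma smooth1_derive1 (f : R -> R) : smooth1 f -> smooth1 f^`()%classic.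
Proof. by move=> sf n; have [] := sf n.+1. Qed.

(** A partial derivative of a product of one-variable functions is again such a product, so all
    iterated derivatives stay in one class of continuous functions. *)
Lemma smooth_prodf f : (forall i, smooth1 (f i)) -> smooth (prodf f).
Proof.
move=> sf s.
have [g [sg ->]] : exists g, (forall i, smooth1 (g i)) /\
    foldr (@partial R d) (prodf f) s = prodf g.
  elim: s => [|i s [g [sg IHs]]]; first by exists f.
  eexists; split; last by rewrite /= IHs partial_prodf// => *;
    exact: smooth1_derivable.
  by move=> j /=; case: ifP => // _; exact: smooth1_derive1.
split; first by apply: continuous_prodf => i; exact: (sg i 0%N).
by move=> i x; have [] := is_derive_prodf (@smooth1_derivable _ (x ord0 i) (sg
  i)).
Qed.

Lemma bounded_support_compact (phi : 'rV[R]_d -> R) (M : R) :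
  (forall x, phi x != 0 -> forall i, `|x ord0 i| <= M) ->
  compact (closure [set x | phi x != 0]).
Proof.
move=> phiM.
have cM : compact [set v : 'rV[R]_d | forall i, `[- M, M]%classic (v ord0 i)].
  apply: (@rV_compact _ _ (fun=> `[- M, M]%classic)) => i.
  exact: segment_compact.
apply: (subclosed_compact _ cM); first exact: closed_closure.
have clM : closed [set v : 'rV[R]_d | forall i, `[- M, M]%classic (v ord0 i)].
  apply: compact_closed => //; exact: norm_hausdorff.
rewrite [X in _ `<=` X](closure_id _).1//;
  apply: closure_subset => x /= /phiM xM i.
by rewrite in_itv/= -ler_norml.
Qed.

Lemma prodf_test_function f (M : R) : (forall i, smooth1 (f i)) ->
  (forall i (x : R), M < `|x| -> f i x = 0) -> test_function (prodf f).
Proof.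
move=> sf f0; split; first exact: smooth_prodf.
apply: (@bounded_support_compact _ M) => x phix i; rewrite leNgt.
apply: contra phix => xi; rewrite /prodf (bigD1 i)//= f0 ?mul0r//.
Qed.

End product_test_functions.

(** * Primitives of bumps and their increments *)

Section primitive.
Variable R : realType.
Local Notation mu := (@lebesgue_measure R).
Implicit Types f F : R -> R.

Lemma continuous_support_integrable f (a b : R) (D : set (measurableTypeR R)) :
  continuous f ->
  (forall x, ~~ (a <= x <= b) -> f x = 0) -> measurable D ->
  mu.-integrable D (EFin \o f).
Proof.
move=> cf f0 mD; apply: (@integrableS _ _ _ _ setT) => //.
rewrite (_ : EFin \o f = (EFin \o f) \_ `[a, b]).
  apply/(integrable_mkcond _ _).1 => //.
  apply: continuous_compact_integrable; first exact: segment_compact.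
  exact: continuous_subspaceT.
apply/funext => x; rewrite patchE; case: ifPn => //.
by rewrite notin_setE/= in_itv/= => /negP/f0 ->.
Qed.

Lemma primitive_exists f (a b : R) : smooth1 f ->
  (forall x, ~~ (a <= x <= b) -> f x = 0) ->
  exists2 F : R -> R, smooth1 F & forall x : R, is_derive x 1 F (f x).
Proof.
move=> sf f0; have cf := sf 0%N.
pose F x := (\int[mu]_(t in `]-oo, x]) f t)%R.
have dF x : derivable F x 1 /\ F^`()%classic x = f x.
  apply: (@continuous_FTC1 _ f -oo%O x (x + 1)).
  - by rewrite ltrDl.
  - exact: (continuous_support_integrable cf f0).
  - by rewrite /= ltNyr.
  - exact: cf.
have F'f : F^`()%classic = f by apply/funext => x; have [] := dF x.
exists F => [n|x]; last by have [h1 h2] := dF x; apply: DeriveDef;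
  rewrite -?derive1E.
apply: (@CnW _ n); split; first by move=> x; have [] := dF x.
by rewrite F'f.
Qed.

Lemma integral_shift_primitive f F (t x : R) : continuous f ->
  (forall x : R, is_derive x 1 F (f x)) -> 0 < t ->
  (\int[mu]_(s in `[0%R, t]) (f (x - s))%:E = (F x - F (x - t))%:E)%E.
Proof.
move=> cf dF t0.
have dG (s : R) : is_derive s 1 (fun s => - F (x - s)) (f (x - s)).
  have dxs : is_derive s 1 (fun s => x - s) (- 1).
    by have := is_deriveB (is_derive_cst x s (1 : R)) (is_derive_id s (1 : R));
      rewrite sub0r.
  have := is_deriveN (@is_derive1_comp _ F (fun s => x - s) s _ _ (dF (x - s))
    dxs).
  by rewrite mulrN1 opprK.
have cG : continuous (fun s => - F (x - s)).
  by apply: derivable_continuous => s; have [] := dG s.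
rewrite (@continuous_FTC2 _ _ (fun s => - F (x - s)))//.
- by rewrite subr0 -EFinB opprK addrC.
- apply: continuous_subspaceT => s.
  apply: (@continuous_comp _ _ _ (fun s => x - s) f); last exact: cf.
  by apply: cvgB; [exact: cvg_cst|exact: cvg_id].
- split => [s _||].
  + by have [] := dG s.
  + by apply: cvg_at_right_filter; exact: cG.
  + by apply: cvg_at_left_filter; exact: cG.
- by move=> s _; rewrite derive1E; have [] := dG s.
Qed.

Lemma smooth1_increment F (t : R) : smooth1 F -> smooth1 (fun x => F x - F (x -
  t)).
Proof.
move=> sF n; apply: CnD; first exact: sF.
rewrite (_ : (fun x => - F (x - t)) = fun x => -1 * F (1 * x + - t)).
  by apply: CnM; [exact: Cn_cst|apply: Cn_affine; exact: sF].
by apply/funext => x; rewrite mulN1r mul1r.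
Qed.

Lemma derive1_increment f F (t x : R) : (forall x : R, is_derive x 1 F (f x)) ->
  (fun x => F x - F (x - t))^`()%classic x = f x - f (x - t).
Proof.
move=> dF; rewrite derive1E.
have dxt : is_derive x 1 (fun x => x - t) 1 by apply: is_derive_eq;
  rewrite subr0.
have [_ ->] := is_deriveB (dF x) (@is_derive1_comp _ F (fun x => x - t) x _ _
  (dF (x - t)) dxt).
by rewrite mulr1.
Qed.

(** A primitive of a bump has no compact support, but its increment over a length t has: it is the
    integral of f over [x - t, x], which misses [a, b] unless x lies in [a, b + t]. *)
Lemma increment_eq0 f F (t x a b : R) : continuous f ->
  (forall x : R, is_derive x 1 F (f x)) -> 0 < t ->
  (forall x, ~~ (a <= x <= b) -> f x = 0) -> ~~ (a <= x <= b + t) ->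
  F x - F (x - t) = 0.
Proof.
move=> cf dF t0 f0 xab; apply: EFin_inj.
rewrite -(integral_shift_primitive _ cf dF t0); apply: integral0_eq => s /=.
rewrite in_itv/= => /andP[s0 st]; rewrite f0//; move: xab.
by apply: contra => /andP[? ?]; apply/andP; split; lra.
Qed.

End primitive.

(** * The fundamental lemma of the calculus of variations *)

Section density.
Context d (T : measurableType d) (R : realType).
Variables (mu : {measure set T -> \bar R}) (f : T -> \bar R).
Hypotheses (mf : measurable_fun setT f) (f0 : forall x, (0 <= f x)%E).

(** Made a measure so that [obox_measure_unique] applies to the positive and negative parts of a
    function. *)
Definition density (A : set T) : \bar R := (\int[mu]_(x in A) f x)%E.

Let density0 : density set0 = 0%E.
Proof. by rewrite /density integral_set0. Qed.

Let density_ge0 A : (0 <= density A)%E.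
Proof. by apply: integral_ge0 => x _; exact: f0. Qed.

Let density_sigma_additive : semi_sigma_additive density.
Proof.
move=> F mF tF mUF; rewrite /density ge0_integral_bigcup//; last first.
  exact: measurable_funTS.
by apply: is_cvg_nneseries => n _ _; exact: density_ge0.
Qed.

HB.instance Definition _ := isMeasure.Build _ _ _ density
  density0 density_ge0 density_sigma_additive.

End density.

Section fundamental_lemma.
Variables (R : realType) (d : nat).
Local Notation mes := (lebesgue_rV R d).
Implicit Types (a b : 'rV[R]_d) (f : 'rV[R]_d -> R).

Definition box_bump a b n := prodf (fun i => smooth_bump (a ord0 i) (b ord0 i)
  n).

Lemma box_bump_ge0 a b n x : 0 <= box_bump a b n x.
Proof. by apply: prodr_ge0 => i _; exact: bump_ge0. Qed.

Lemma box_bump_le1 a b n x : box_bump a b n x <= 1.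
Proof. by apply: prodr_ile1 => i _; rewrite bump_ge0 bump_le1. Qed.

Lemma box_bump_eq0 a b n x : ~ obox a b x -> box_bump a b n x = 0.
Proof.
by move=> /existsNP[i /negP xi];
  rewrite /box_bump /prodf (bigD1 i)//= bump_eq0 ?mul0r.
Qed.

Lemma cvg_box_bump a b x : obox a b x ->
  (box_bump a b n x) @[n --> \oo] --> (1 : R).
Proof.
move=> abx; rewrite /box_bump /prodf.
elim: (index_enum _) => [|i s IHs].
  by under eq_fun do rewrite big_nil; exact: cvg_cst.
under eq_fun do rewrite big_cons.
have := cvgM (cvg_bump (abx i)) IHs; rewrite mulr1; exact.
Qed.

Lemma measurable_box_bump a b n : measurable_fun setT (box_bump a b n).
Proof.
apply: continuous_measurable_rV; apply: continuous_prodf => i.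
exact: (smooth1_bump _ _ _ 0%N).
Qed.

Lemma box_bump_test a b n : test_function (box_bump a b n).
Proof.
apply: (@prodf_test_function _ _ _ (\sum_i (`|a ord0 i| + `|b ord0 i|))) => i.
  exact: smooth1_bump.
move=> x xM; rewrite bump_eq0//; apply/negP => /andP[ax xb].
have : `|a ord0 i| + `|b ord0 i| <= \sum_i (`|a ord0 i| + `|b ord0 i|).
  by rewrite [leRHS](bigD1 i)//= lerDl sumr_ge0// => j _; rewrite addr_ge0.
move=> /le_lt_trans /(_ xM); apply/negP; rewrite -leNgt.
have := ler_norm (b ord0 i); have := lerNnormlW (lexx `|a ord0 i|).
by rewrite ler_norml => ? ?; apply/andP; split; have := normr_ge0 (a ord0 i);
  have := normr_ge0 (b ord0 i); lra.
Qed.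

(** By dominated convergence the bumps give a zero integral over every open box. Hence the densities
    of the positive and of the negative part agree on boxes, then on all measurable sets; on {f > 0}
    the negative part vanishes, which kills the positive part and then both. *)
Lemma fundamental_lemma f : measurable_fun setT f ->
  (forall a b, mes.-integrable (obox a b) (EFin \o f)) ->
  (forall a b n, (\int[mes]_x (f x * box_bump a b n x)%R)%R = 0) ->
  {ae mes, forall x, f x = 0}.
Proof.
move=> mf intf f0.
have box0 a b : (\int[mes]_(x in obox a b) (f x)%:E)%E = 0%E.
  have mab := measurable_obox a b.
  have bumpE n : (\int[mes]_(x in obox a b) (f x * box_bump a b n x)%:E)%E =
    0%E.
    have intfb : mes.-integrable (obox a b) (fun x => (f x * box_bump a b n
      x)%:E).
      apply: (le_integrable mab _ _ (intf a b)).
        apply/measurable_EFinP; apply: measurable_funTS.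
        by apply: measurable_funM => //; exact: measurable_box_bump.
      move=> x _; rewrite /= lee_fin normrM ler_piMr//.
      by rewrite ger0_norm ?box_bump_ge0 ?box_bump_le1.
    have := f0 a b n; rewrite /Rintegral.
    rewrite (_ : (\int[mes]_x (f x * box_bump a b n x)%:E)%E =
      (\int[mes]_(x in obox a b) (f x * box_bump a b n x)%:E)%E).
      by move=> h; rewrite -[LHS]fineK ?h//; exact: integrable_fin_num.
    rewrite [RHS]integral_mkcond; apply: eq_integral => x _.
    rewrite patchE; case: ifPn => //; rewrite notin_setE => /box_bump_eq0 ->.
    by rewrite mulr0.
  have [|||||_ _ cv] := @dominated_convergence _ _ _ mes _ mab
      (fun n x => (f x * box_bump a b n x)%:E) (EFin \o f) (abse \o (EFin \o
        f)).
  - move=> n; apply/measurable_EFinP; apply: measurable_funTS.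
    by apply: measurable_funM => //; exact: measurable_box_bump.
  - by apply/measurable_EFinP; exact: measurable_funTS.
  - apply: aeW => x abx /=; apply: cvg_EFin; first by apply: nearW.
    rewrite -[X in _ --> X]mulr1; apply: cvgMr; exact: cvg_box_bump.
  - exact: integrable_abse.
  - apply: aeW => x n _ /=; rewrite lee_fin normrM ler_piMr//.
    by rewrite ger0_norm ?box_bump_ge0 ?box_bump_le1.
  have := cvg_lim (@ereal_hausdorff R) cv => <-.
  by under eq_fun do rewrite bumpE; rewrite lim_cst.
have mfE : measurable_fun setT (EFin \o f) by exact/measurable_EFinP.
pose p := (EFin \o f)^\+%E; pose q := (EFin \o f)^\-%E.
have mp : measurable_fun setT p by exact: measurable_funepos.
have mq : measurable_fun setT q by exact: measurable_funeneg.
have pq_box a b : (\int[mes]_(x in obox a b) p x =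
    \int[mes]_(x in obox a b) q x)%E.
  have := box0 a b; rewrite integralE => /eqP; rewrite sube_eq.
  - by rewrite add0e => /eqP.
  - apply: integrable_pos_fin_num => //; exact: measurable_obox.
  - by rewrite fin_num_adde_defr.
have pqE A : measurable A -> (\int[mes]_(x in A) p x = \int[mes]_(x in A) q
  x)%E.
  apply: (@obox_measure_unique _ _ (density mes p) (density mes q)) => //.
  - by move=> x; exact: funepos_ge0.
  - by move=> x; exact: funeneg_ge0.
  move=> p0 a b; change (\int[mes]_(x in obox a b) p x < +oo)%E.
  rewrite ltey_eq; apply/orP; left.
  by apply: integrable_pos_fin_num => //; exact: measurable_obox.
have mP : measurable [set x | 0 < f x].
  rewrite (_ : [set x | _] = f @^-1` `]0, +oo[%classic).
    by rewrite -[X in measurable X]setTI; apply: mf => //;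
      exact: measurable_itv.
  by apply/seteqP; split => x /=; rewrite in_itv/= andbT.
have q0 : (\int[mes]_(x in [set x | (0 < f x)%R]) q x = 0)%E.
  apply: integral0_eq => x /= fx; rewrite /q funenegE/=.
  by apply/max_idPr; rewrite lee_fin oppr_le0 ltW.
have p0 : (\int[mes]_x p x = 0)%E.
  rewrite -q0 -pqE// [RHS]integral_mkcond; apply: eq_integral => x _.
  rewrite patchE; case: ifPn => //; rewrite notin_setE/= => /negP;
    rewrite -leNgt => fx.
  by rewrite /p funeposE/=; apply/max_idPr; rewrite lee_fin.
have : (\int[mes]_x `|(EFin \o f) x| = 0)%E.
  rewrite (eq_integral (p \+ q)%E); last first.
    by move=> x _; rewrite -[LHS]/((abse \o (EFin \o f)) x) fune_abse.
  rewrite ge0_integralD//; last 2 first.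
  - by move=> x _; exact: funepos_ge0.
  - by move=> x _; exact: funeneg_ge0.
  by rewrite -pqE// p0 adde0.
move/ae_eq_integral_abs => /(_ measurableT mfE); apply: filterS => x /(_ I).
by move=> [].
Qed.

End fundamental_lemma.

(** * Weak derivatives and the Poincare inequality on cubes *)

Section sq_integrable.
Context d (T : measurableType d) (R : realType).
Variable mu : {measure set T -> \bar R}.
Implicit Types f g : T -> R.

Definition sq_integrable f :=
  measurable_fun setT f /\ (\int[mu]_x (f x ^+ 2)%:E < +oo)%E.

Lemma measurable_sqr f (D : set T) : measurable_fun D f ->
  measurable_fun D (fun x => (f x ^+ 2)%:E).
Proof. by move=> mf; apply/measurable_EFinP; exact: measurable_funX. Qed.

Lemma sqr_EFin_ge0 (a : R) : (0 <= (a ^+ 2)%:E)%E.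
Proof. by rewrite lee_fin sqr_ge0. Qed.

Lemma sq_integrable_sqr f : sq_integrable f ->
  mu.-integrable setT (fun x => (f x ^+ 2)%:E).
Proof.
move=> [mf f2]; apply/integrableP; split; first exact: measurable_sqr.
rewrite (eq_integral (fun x => (f x ^+ 2)%:E))// => x _.
by rewrite gee0_abs// sqr_EFin_ge0.
Qed.

Lemma sq_integrableM f g : sq_integrable f -> sq_integrable g ->
  mu.-integrable setT (fun x => (f x * g x)%:E).
Proof.
move=> sf sg; have [mf _] := sf; have [mg _] := sg.
apply: (le_integrable measurableT _ _ (integrableD measurableT
  (sq_integrable_sqr sf) (sq_integrable_sqr sg))).
  by apply/measurable_EFinP; exact: measurable_funM.
move=> x _ /=; rewrite lee_fin [leRHS]ger0_norm ?addr_ge0 ?sqr_ge0//.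
rewrite normrM -[f x ^+ 2]real_normK ?num_real// -[g x ^+ 2]real_normK
  ?num_real//.
by have := sqr_ge0 (`|f x| - `|g x|); nra.
Qed.

Lemma sq_integrable_le f g : measurable_fun setT f -> sq_integrable g ->
  (forall x, `|f x| <= `|g x|) -> sq_integrable f.
Proof.
move=> mf [mg g2] fg; split => //; apply: le_lt_trans g2.
apply: ge0_le_integral => //.
- by move=> x _; exact: sqr_EFin_ge0.
- exact: measurable_sqr.
- exact: measurable_sqr.
- move=> x _; rewrite lee_fin -[f x ^+ 2]real_normK ?num_real//.
  by rewrite -[g x ^+ 2]real_normK ?num_real// ler_sqr ?nnegrE ?normr_ge0.
Qed.

Lemma sq_integrableD f g : sq_integrable f -> sq_integrable g ->
  sq_integrable (fun x => f x + g x).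
Proof.
move=> sf sg; have [mf f2] := sf; have [mg g2] := sg.
split; first exact: measurable_funD.
apply: (@le_lt_trans _ _ (\int[mu]_x ((2 * f x ^+ 2)%:E + (2 * g x ^+
  2)%:E))%E).
  apply: ge0_le_integral => //.
  - by move=> x _; exact: sqr_EFin_ge0.
  - by apply: measurable_sqr; exact: measurable_funD.
  - apply: emeasurable_funD; apply/measurable_EFinP;
      by apply: measurable_funM => //; exact: measurable_funX.
  - by move=> x _; rewrite lee_fin; have := sqr_ge0 (f x - g x); nra.
have int2 := integrableD measurableT
  (integrableZl measurableT 2 (sq_integrable_sqr sf))
  (integrableZl measurableT 2 (sq_integrable_sqr sg)).
by rewrite ltey_eq (integrable_fin_num measurableT int2).
Qed.

Lemma sq_integrableZ a f : sq_integrable f -> sq_integrable (fun x => a * f x).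
Proof.
move=> sf; have [mf f2] := sf; split; first exact: measurable_funM.
have int2 := integrableZl measurableT (a ^+ 2) (sq_integrable_sqr sf).
rewrite (eq_integral (fun x => (a ^+ 2)%:E * (f x ^+ 2)%:E)%E).
  by rewrite ltey_eq (integrable_fin_num measurableT int2).
by move=> x _; rewrite exprMn EFinM.
Qed.

Lemma sq_integrableB f g : sq_integrable f -> sq_integrable g ->
  sq_integrable (fun x => f x - g x).
Proof.
move=> sf sg; have := sq_integrableD sf (sq_integrableZ (- 1) sg).
by under eq_fun do rewrite mulN1r.
Qed.

Lemma sq_integrable_integrable f (D : set T) : measurable D -> (mu D < +oo)%E ->
  sq_integrable f -> mu.-integrable D (EFin \o f).
Proof.
move=> mD Dfin sf; have [mf _] := sf.
have int1 : mu.-integrable D (fun=> 1%:E).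
  apply/integrableP; split => //; under eq_integral do rewrite abse1.
  by rewrite integral_cst// mul1e.
have int2 : mu.-integrable D (fun x => (f x ^+ 2)%:E).
  exact: (integrableS measurableT mD (@subsetT _ _) (sq_integrable_sqr sf)).
apply: (le_integrable mD _ _ (integrableD mD int1 int2)).
  by apply/measurable_EFinP; exact: measurable_funTS.
move=> x _ /=; rewrite lee_fin [leRHS]ger0_norm ?addr_ge0 ?sqr_ge0//.
rewrite -[f x ^+ 2]real_normK ?num_real//.
by have := sqr_ge0 (`|f x| - 1); nra.
Qed.

Lemma integrable_cst_fin (c : R) (D : set T) : measurable D -> (mu D < +oo)%E ->
  mu.-integrable D (EFin \o cst c).
Proof.
move=> mD Dfin; apply/integrableP; split; first exact/measurable_EFinP.
rewrite (eq_integral (cst `|c|%:E))// integral_cst//.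
exact: lte_mul_pinfty.
Qed.

(** Integrate 2 c f - c^2 <= f^2, with c the mean value of f over [D]. An infinite right-hand side
    is allowed, so square integrability need not be checked by the caller. *)
Lemma sqr_Rintegral_le f (D : set T) (m : R) : measurable D -> mu D = m%:E ->
  0 < m -> measurable_fun D f ->
  (((\int[mu]_(x in D) f x)%R ^+ 2)%:E <= m%:E * \int[mu]_(x in D) (f x ^+
    2)%:E)%E.
Proof.
move=> mD Dm m0 mf.
have [->|fin] := eqVneq (\int[mu]_(x in D) (f x ^+ 2)%:E)%E +oo%E.
  by rewrite gt0_muley ?lte_fin// leey.
have f2_0 : (0 <= \int[mu]_(x in D) (f x ^+ 2)%:E)%E.
  by apply: integral_ge0 => x _; exact: sqr_EFin_ge0.
have int1 (c : R) : mu.-integrable D (EFin \o cst c).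
  by apply: integrable_cst_fin => //; rewrite Dm ltry.
have int2 : mu.-integrable D (EFin \o (fun x => f x ^+ 2)).
  apply/integrableP; split; first exact: measurable_sqr.
  rewrite (eq_integral (fun x => (f x ^+ 2)%:E)); first by rewrite ltey.
  by move=> x _; rewrite gee0_abs// sqr_EFin_ge0.
have intf : mu.-integrable D (EFin \o f).
  apply: (le_integrable mD _ _ (integrableD mD (int1 1) int2)).
    exact/measurable_EFinP.
  move=> x _ /=; rewrite lee_fin [leRHS]ger0_norm ?addr_ge0 ?sqr_ge0//.
  rewrite -[f x ^+ 2]real_normK ?num_real//.
  by have := sqr_ge0 (`|f x| - 1); nra.
have intZ c : mu.-integrable D (EFin \o (fun x => c * f x)).
  by have := integrableZl mD c intf; under eq_fun do rewrite -EFinM.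
set I := (\int[mu]_(x in D) f x)%R.
pose c := I / m.
have : (\int[mu]_(x in D) (2 * c * f x - c ^+ 2) <= \int[mu]_(x in D) (f x ^+
  2))%R.
  apply: le_Rintegral => //.
    exact: (integrableB mD (intZ _) (int1 _)).
  by move=> x _; have := sqr_ge0 (f x - c); nra.
rewrite RintegralB// ?RintegralZl ?Rintegral_cst ?Dm//=;
  last exact: (int1 (c ^+ 2)).
rewrite -/I => le1.
rewrite -[X in (_ <= _ * X)%E]fineK ?ge0_fin_numE// ?ltey// -EFinM lee_fin.
rewrite -ler_pdivrMl//; apply: le_trans le1.
- by rewrite /c le_eqVlt; apply/orP; left; apply/eqP; field; rewrite gt_eqF.
- exact: (int1 m^-1).
- exact: (int1 c).
Qed.

End sq_integrable.

(** * Increments of weakly differentiable functions *)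

Section translation.
Variables (R : realType) (d : nat).
Local Notation mes := (lebesgue_rV R d).
Local Notation leb := (@lebesgue_measure R).
Local Notation ee i := (delta_mx ord0 i : 'rV[R]_d).
Implicit Types (a b x y z : 'rV[R]_d) (u g f : 'rV[R]_d -> R) (i : 'I_d).

Definition weak_deriv i u g := forall phi, test_function phi ->
  (\int[mes]_x (u x * partial i phi x))%R = - (\int[mes]_x (g x * phi x))%R.

Lemma measurable_line v :
  measurable_fun setT (fun p : 'rV[R]_d * measurableTypeR R => p.1 + p.2 *: v).
Proof.
apply: measurable_fun_rV => j; under eq_fun do rewrite !mxE.
apply: measurable_funD; first exact: (measurableT_comp (measurable_coord j)).
by apply: measurable_funM.
Qed.

Lemma sq_integrable_translate u y : sq_integrable mes u ->
  sq_integrable mes (fun x => u (x + y)).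
Proof.
move=> [mu u2]; split.
  exact: (measurableT_comp mu (measurable_addr_rV y)).
rewrite (ge0_integral_translate y (f := fun x => (u x ^+ 2)%:E)) => //.
  exact: measurable_sqr.
by move=> x; exact: sqr_EFin_ge0.
Qed.

Lemma Rintegral_translate y f : mes.-integrable setT (EFin \o f) ->
  (\int[mes]_x f (x + y)%R)%R = (\int[mes]_x f x)%R.
Proof.
move=> intf; have mf : measurable_fun setT (EFin \o f) by exact: measurable_int
  intf.
rewrite /Rintegral; congr fine; rewrite [LHS]integralE [RHS]integralE;
  congr (_ - _)%E.
  rewrite (eq_integral (fun x => (EFin \o f)^\+%E (x + y)%R)); last first.
    by move=> x _; rewrite !funeposE.
  rewrite (ge0_integral_translate y (f := (EFin \o f)^\+%E))//.
    exact: measurable_funepos.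
rewrite (eq_integral (fun x => (EFin \o f)^\-%E (x + y)%R)); last first.
  by move=> x _; rewrite !funenegE.
rewrite (ge0_integral_translate y (f := (EFin \o f)^\-%E))//.
  exact: measurable_funeneg.
Qed.

Section line_integral.
Variables (v : 'rV[R]_d) (t : R).
Hypothesis t0 : 0 < t.

Section direction.
Variables (w : 'rV[R]_d) (g : 'rV[R]_d -> R).
Hypotheses (sg : sq_integrable mes g).

Let mg : measurable_fun setT g. Proof. by case: sg. Qed.

(** The weight phi(x) makes the function integrable on the product space, where Fubini's theorem is
    needed: g by itself is only square integrable in x. *)
Definition line_integrand (phi : 'rV[R]_d -> R) (p : 'rV[R]_d * measurableTypeR
  R) : R :=
  \1_(`[0, t]%classic : set (measurableTypeR R)) p.2 * (g (p.1 + p.2 *: w) *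
    phi p.1).

Lemma measurable_line_integrand phi : measurable_fun setT phi ->
  measurable_fun setT (line_integrand phi).
Proof.
move=> mphi; apply: measurable_funM.
  by apply: measurableT_comp => //; exact: measurable_indic.
apply: measurable_funM; last exact: measurableT_comp.
by apply: measurableT_comp => //; exact: measurable_line.
Qed.

Lemma integrable_line_integrand phi : sq_integrable mes phi ->
  (mes \x leb)%E.-integrable setT (EFin \o line_integrand phi).
Proof.
move=> sphi; have [mphi _] := sphi.
have mK := measurable_line_integrand mphi.
apply/integrable21ltyP; first exact/measurable_EFinP.
pose c := (\int[mes]_x (g x ^+ 2)%:E + \int[mes]_x (phi x ^+ 2)%:E)%E.
have c0 : (0 <= c)%E by apply: adde_ge0; apply: integral_ge0 => x _;
  exact: sqr_EFin_ge0.
have cfin : (c < +oo)%E by apply: lte_add_pinfty; [case: sg|case: sphi].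
have mgs s : measurable_fun setT (fun x => g (x + s *: w)).
  exact: (measurableT_comp mg (measurable_addr_rV _)).
(* For each s the product is at most g(x + s w)^2 + phi(x)^2, and by translation invariance the
   integral c of this bound does not depend on s. *)
have inner s : (\int[mes]_x `|(EFin \o line_integrand phi) (x, s)| <=
    (fine c)%:E * (\1_(`[0%R, t]%classic : set (measurableTypeR R)) s)%:E)%E.
  rewrite fineK ?ge0_fin_numE// /line_integrand /= indicE; case: (_ \in _);
    last first.
    by rewrite mule0 integral0_eq// => x _; rewrite mul0r normr0.
  rewrite mule1 /c -(ge0_integral_translate (s *: w) (f := fun x => (g x ^+
    2)%:E)).
  - rewrite -ge0_integralD//.
    + apply: ge0_le_integral => //.
      * apply/measurable_EFinP; apply: measurableT_comp => //.
        by apply: measurable_funM => //; exact: measurable_funM.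
      * by apply: emeasurable_funD; exact: measurable_sqr.
      * move=> x _; rewrite lee_fin mul1r normrM.
        rewrite -[g _ ^+ 2]real_normK ?num_real// -[phi x ^+ 2]real_normK
          ?num_real//.
        by have := sqr_ge0 (`|g (x + s *: w)| - `|phi x|); nra.
    + by move=> x _; exact: sqr_EFin_ge0.
    + exact: measurable_sqr.
    + by move=> x _; exact: sqr_EFin_ge0.
    + exact: measurable_sqr.
  - exact: measurable_sqr.
  - by move=> x; exact: sqr_EFin_ge0.
have m1 : measurable_fun setT (fun s : measurableTypeR R =>
    (\1_(`[0%R, t]%classic : set (measurableTypeR R)) s : R)%:E).
  by apply/measurable_EFinP; exact: measurable_indic.
apply: (@le_lt_trans _ _ (\int[leb]_s ((fine c)%:E *
    (\1_(`[0%R, t]%classic : set (measurableTypeR R)) s)%:E))%E).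
  apply: ge0_le_integral => //.
  - by move=> s _; apply: integral_ge0.
  - apply: (measurable_fun_fubini_tonelli_G (abse \o (EFin \o line_integrand
    phi))) => //.
      by apply: measurableT_comp => //; exact/measurable_EFinP.
    by move=> p; exact: abse_ge0.
  - by apply: emeasurable_funM => //; exact: measurable_cst.
rewrite ge0_integralZl//; last by rewrite lee_fin fine_ge0.
rewrite [X in (_ * X)%E](_ : _ = t%:E); first by rewrite -EFinM ltry.
transitivity (leb (`[0%R, t]%classic : set (measurableTypeR R))).
  by rewrite integral_indic// setIT.
transitivity (lebesgue_measure (`[0%R, t]%classic : set (measurableTypeR R)))
  => //.
by rewrite lebesgue_measure_itv/= lte_fin t0 sube0.
Qed.

Definition line_integral x : R := (\int[leb]_(s in `[0%R, t]) g (x + s *: w))%R.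

Lemma line_integralE x : line_integral x =
  (\int[leb]_s line_integrand (cst 1) (x, s))%R.
Proof.
rewrite /line_integral Rintegral_mkcond; apply: eq_Rintegral => s _.
by rewrite /line_integrand patchE indicE/=; case: (_ \in _);
  rewrite ?mul0r// mul1r mulr1.
Qed.

Lemma measurable_line_integral : measurable_fun setT line_integral.
Proof.
rewrite (_ : line_integral = fun x => fine (\int[leb]_s (line_integrand (cst 1)
  (x, s))%:E)%E).
  apply: measurableT_comp => //.
  have mK : measurable_fun setT (EFin \o line_integrand (cst 1)).
    by apply/measurable_EFinP; exact: measurable_line_integrand.
  under eq_fun do rewrite integralE.
  apply: emeasurable_funB.
    rewrite (_ : (fun x => _) = fubini_F leb (EFin \o line_integrand (cst
      1%R))^\+%E).
      apply: measurable_fun_fubini_tonelli_F; first exact: measurable_funepos.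
      by move=> x; exact: funepos_ge0.
    by apply/funext => x; apply: eq_integral => s _; rewrite !funeposE.
  rewrite (_ : (fun x => _) = fubini_F leb (EFin \o line_integrand (cst
    1%R))^\-%E).
    apply: measurable_fun_fubini_tonelli_F; first exact: measurable_funeneg.
    by move=> x; exact: funeneg_ge0.
  by apply/funext => x; apply: eq_integral => s _; rewrite !funenegE.
by apply/funext => x; rewrite line_integralE.
Qed.

(** Dividing by phi(x) makes the section integrable without the weight. Points with phi(x) = 0 are
    treated apart in [line_integral_ae], where both sides are 0. *)
Lemma line_integral_weight phi x : phi x != 0 ->
  leb.-integrable setT (fun s => (line_integrand phi (x, s))%:E) ->
  (\int[leb]_s line_integrand phi (x, s))%R = line_integral x * phi x.
Proof.
move=> phi0 intK; rewrite line_integralE mulrC.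
have intK1 : leb.-integrable setT (fun s => (line_integrand (cst 1) (x, s))%:E).
  rewrite (_ : (fun s => _) = (fun s => (phi x)^-1%:E * (line_integrand phi (x,
    s))%:E)%E).
    exact: integrableZl.
  apply/funext => s; rewrite -EFinM /line_integrand/= mulr1.
  by congr EFin; field.
rewrite -RintegralZl//; apply: eq_Rintegral => s _.
by rewrite /line_integrand/= mulr1; ring.
Qed.

Lemma line_integral_ae phi : sq_integrable mes phi ->
  {ae mes, forall x, (\int[leb]_s line_integrand phi (x, s))%R = line_integral
    x * phi x}.
Proof.
move=> sphi; have := ae_integrable1 (integrable_line_integrand sphi).
apply: filterS => x intK; have [phi0|phi0] := eqVneq (phi x) 0.
  rewrite phi0 mulr0 /Rintegral integral0_eq// => s _.
  by rewrite /line_integrand/= phi0 !mulr0.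
exact: line_integral_weight.
Qed.

Lemma line_integral_fubini phi : sq_integrable mes phi ->
  {ae mes, forall x, fubini_F leb (EFin \o line_integrand phi) x =
    (line_integral x * phi x)%:E}.
Proof.
move=> sphi; have := ae_integrable1 (integrable_line_integrand sphi).
apply: filterS2 (line_integral_ae sphi) => x <- intK.
by rewrite fineK//; exact: integrable_fin_num.
Qed.

Lemma measurable_line_integralM phi : sq_integrable mes phi ->
  measurable_fun setT (fun x => (line_integral x * phi x)%:E).
Proof.
move=> [mphi _]; apply/measurable_EFinP; apply: measurable_funM => //.
exact: measurable_line_integral.
Qed.

Lemma integrable_line_integral phi : sq_integrable mes phi ->
  mes.-integrable setT (fun x => (line_integral x * phi x)%:E).
Proof.
move=> sphi; have intF := integrable_fubini_F (integrable_line_integrand sphi).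
have [mF Foo] := integrableP _ _ _ intF.
have mL := measurable_line_integralM sphi.
apply/integrableP; split => //; apply: le_lt_trans Foo.
rewrite le_eqVlt; apply/orP; left; apply/eqP; apply: ae_eq_integral => //.
- exact: measurableT_comp.
- exact: measurableT_comp.
- by apply: filterS (line_integral_fubini sphi) => x /= -> _.
Qed.

Lemma integral_line_integral phi : sq_integrable mes phi ->
  (\int[mes]_x (line_integral x * phi x)%:E =
   \int[leb]_s \int[mes]_x (line_integrand phi (x, s))%:E)%E.
Proof.
move=> sphi; have intK := integrable_line_integrand sphi.
rewrite -(Fubini intK); apply: ae_eq_integral => //.
- exact: measurable_line_integralM.
- exact: measurable_int (integrable_fubini_F intK).
- by apply: filterS (line_integral_fubini sphi) => x /= <- _.
Qed.

End direction.

(** Integration along v and along -v are adjoint: exchange the integrals by Fubini and translate x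
    by s v for each s. *)
Lemma Rintegral_line_integral g phi : sq_integrable mes g -> sq_integrable mes
  phi ->
  (\int[mes]_x (line_integral v g x * phi x))%R =
  (\int[mes]_x (g x * line_integral (- v) phi x))%R.
Proof.
move=> sg sphi.
rewrite /Rintegral (integral_line_integral v sg sphi).
rewrite (eq_integral (fun x => (line_integral (- v) phi x * g x)%:E));
  last first.
  by move=> x _; rewrite mulrC.
rewrite (integral_line_integral (- v) sphi sg); congr fine;
  apply: eq_integral => s _.
rewrite /line_integrand/=;
  case: (boolP (s \in (`[0, t]%classic : set (measurableTypeR R)))) => st.
  rewrite indicE st.
  have int1 : mes.-integrable setT (EFin \o (fun x => g x * phi (x - s *: v))).
    by apply: sq_integrableM => //; exact: sq_integrable_translate.
  have := Rintegral_translate (s *: v) int1; rewrite /Rintegral => h.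
  have int2 : mes.-integrable setT (fun x => (1 * (g (x + s *: v) * phi x))%:E).
    under eq_fun do rewrite mul1r.
    by apply: sq_integrableM => //; exact: sq_integrable_translate.
  have int3 : mes.-integrable setT (fun x => (1 * (phi (x + s *: - v) * g
    x))%:E).
    under eq_fun do rewrite mul1r.
    by apply: sq_integrableM => //; exact: sq_integrable_translate.
  rewrite -[LHS]fineK ?integrable_fin_num// -[RHS]fineK ?integrable_fin_num//.
  congr EFin; move: h => /=; under eq_integral do rewrite addrK -[g _ * _]mul1r.
  move=> ->; congr fine; apply: eq_integral => x _.
  by rewrite mul1r scalerN mulrC.
by rewrite indicE (negbTE st); under eq_integral do rewrite mul0r;
  under [RHS]eq_integral do rewrite mul0r.
Qed.

End line_integral.

Lemma sq_integrable_bounded_support f (a b : 'rV[R]_d) (M : R) :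
  measurable_fun setT f -> (forall x, `|f x| <= M) ->
  (forall x, ~ obox a b x -> f x = 0) -> sq_integrable mes f.
Proof.
move=> mf fM f0.
have M0 : 0 <= M by apply: le_trans (fM 0).
apply: (@sq_integrable_le _ _ _ mes f (fun x => M * \1_(obox a b) x)) => //.
  split.
    by apply: measurable_funM => //; apply: measurable_indic;
      exact: measurable_obox.
  rewrite (eq_integral (fun x => (M ^+ 2)%:E * (\1_(obox a b) x)%:E)%E);
    last first.
    by move=> x _; rewrite exprMn EFinM indicE -!EFinM; case: (_ \in _);
      rewrite ?expr1n// expr0n.
  rewrite ge0_integralZl//; last 2 first.
  - by apply/measurable_EFinP; apply: measurable_indic; exact: measurable_obox.
  - exact: sqr_EFin_ge0.
  rewrite integral_indic//; last exact: measurable_obox.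
  rewrite setIT; apply: lte_mul_pinfty => //; first exact: sqr_EFin_ge0.
  exact: lebesgue_obox_fin.
move=> x; rewrite normrM [`|M|]ger0_norm// indicE.
have [xB|xB] := boolP (x \in obox a b); first by rewrite normr1 mulr1.
by rewrite f0 ?normr0 ?mulr0//; rewrite notin_setE in xB.
Qed.

Lemma sq_integrable_box_bump a b n : sq_integrable mes (box_bump a b n).
Proof.
apply: (@sq_integrable_bounded_support _ a b 1).
- exact: measurable_box_bump.
- by move=> x; rewrite ger0_norm ?box_bump_ge0 ?box_bump_le1.
- by move=> x; exact: box_bump_eq0.
Qed.

Lemma box_bump_shift i a b n s x : box_bump a b n (x - s *: ee i) =
  smooth_bump (a ord0 i) (b ord0 i) n (x ord0 i - s) *
  \prod_(j | j != i) smooth_bump (a ord0 j) (b ord0 j) n (x ord0 j).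
Proof.
rewrite /box_bump /prodf (bigD1 i)//= !mxE !eqxx mulr1; congr (_ * _).
by apply: eq_bigr => j ji; rewrite !mxE/= (negbTE ji) mulr0 subr0.
Qed.

(** In the product [box_bump] replace the i-th factor f by F(x) - F(x - t), with F a primitive of f.
    This is the line integral of the bump along - e_i, and it keeps a compact support, widened by
    t. *)
Lemma increment_test i a b n t : 0 < t -> exists2 psi, test_function psi &
  (forall x, psi x = line_integral t (- ee i) (box_bump a b n) x) /\
  (forall x, partial i psi x = box_bump a b n x - box_bump a b n (x - t *: ee
    i)).
Proof.
move=> t0; pose f := smooth_bump (a ord0 i) (b ord0 i) n.
have sf : smooth1 f by exact: smooth1_bump.
have f0 (x : R) : ~~ (a ord0 i <= x <= b ord0 i) -> f x = 0.
  move=> xab; apply: bump_eq0; apply: contra xab => /andP[ax xb].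
  by rewrite !ltW.
have [F sF dF] := primitive_exists sf f0.
pose h (j : 'I_d) := if j == i then (fun x : R => F x - F (x - t))
  else smooth_bump (a ord0 j) (b ord0 j) n.
have sh j : smooth1 (h j).
  by rewrite /h; case: ifP => _; [exact: smooth1_increment|exact: smooth1_bump].
exists (prodf h); last split.
- apply: (@prodf_test_function _ _ _ (t + \sum_i (`|a ord0 i| + `|b ord0 i|)))
  => // j x xM.
  have abM : `|a ord0 j| + `|b ord0 j| <= \sum_i (`|a ord0 i| + `|b ord0 i|).
    by rewrite [leRHS](bigD1 j)//= lerDl sumr_ge0// => k _; rewrite addr_ge0.
  have out : ~~ (a ord0 j <= x <= b ord0 j + t).
    apply/negP => /andP[ax xb].
    move: xM; apply/negP; rewrite -leNgt ler_norml.
    have := ler_norm (b ord0 j); have := ler_norm (- a ord0 j); rewrite normrN.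
    have := normr_ge0 (a ord0 j); have := normr_ge0 (b ord0 j).
    by move=> ? ? ? ?; apply/andP; split; lra.
  rewrite /h; case: eqP => [ji|_].
    rewrite ji in out; exact: (increment_eq0 (sf 0%N) dF t0 f0 out).
  apply: bump_eq0; apply: contra out => /andP[ax xb].
  by rewrite ltW//=; lra.
- move=> x; rewrite /line_integral.
  rewrite (eq_Rintegral _ (g := fun s : measurableTypeR R => f (x ord0 i - s) *
      \prod_(j | j != i) smooth_bump (a ord0 j) (b ord0 j) n (x ord0 j)));
        last first.
    by move=> s _; rewrite scalerN box_bump_shift.
  rewrite /prodf (bigD1 i)//= {1}/h eqxx mulrC.
  rewrite (eq_bigr (fun j => smooth_bump (a ord0 j) (b ord0 j) n (x ord0 j)));
    last first.
    by move=> j /negbTE ji; rewrite /h ji.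
  set C := \prod_(j | j != i) _.
  under eq_Rintegral do rewrite mulrC.
  rewrite RintegralZl//; last first.
    apply: continuous_compact_integrable; first exact: segment_compact.
    apply: continuous_subspaceT => s.
    apply: (@continuous_comp _ _ _ (fun s => x ord0 i - s) f);
      last exact: (sf 0%N).
    by apply: cvgB; [exact: cvg_cst|exact: cvg_id].
  by rewrite /Rintegral (integral_shift_primitive _ (sf 0%N) dF t0).
- move=> x; rewrite partial_prodf; last by move=> j y; exact: smooth1_derivable.
  have -> : box_bump a b n x = box_bump a b n (x - 0 *: ee i).
    by rewrite scale0r subr0.
  rewrite !box_bump_shift subr0 -mulrBl.
  rewrite /prodf (bigD1 i)//= eqxx {1}/h eqxx (derive1_increment _ _ dF);
    congr (_ * _).
  by apply: eq_bigr => j /negbTE ji; rewrite ji /h ji.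
Qed.

(* A line integral of [box_bump] is the partial derivative of another test
   function, so that both sides agree when tested against [box_bump]. *)
Lemma increment_formula i u g t : 0 < t -> sq_integrable mes u ->
  sq_integrable mes g -> weak_deriv i u g ->
  {ae mes, forall x, u (x + t *: ee i) - u x = line_integral t (ee i) g x}.
Proof.
move=> t0 su sg ug; have [mu _] := su.
have sut := sq_integrable_translate (t *: ee i) su.
have sD := sq_integrableB sut su.
have mL : measurable_fun setT (line_integral t (ee i) g).
  exact: measurable_line_integral.
pose f x := (u (x + t *: ee i) - u x) - line_integral t (ee i) g x.
have mf : measurable_fun setT f by apply: measurable_funB => //; case: sD.
suff : {ae mes, forall x, f x = 0}.
  by apply: filterS => x /eqP; rewrite subr_eq0 => /eqP.
apply: fundamental_lemma => // [a b|a b n].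
  have mB := measurable_obox a b.
  have int2 := sq_integrable_integrable mB (lebesgue_obox_fin a b) sD.
  have s1 : sq_integrable mes (\1_(obox a b) : 'rV[R]_d -> R).
    apply: (@sq_integrable_bounded_support _ a b 1).
    - by apply: measurable_indic.
    - by move=> x; rewrite indicE; case: (_ \in _); rewrite ?normr1 ?normr0.
    - by move=> x xB; rewrite indicE memNset.
  have int1 := integrableS measurableT mB (@subsetT _ _)
    (integrable_line_integral t0 (ee i) sg s1).
  have int3 : mes.-integrable (obox a b) (EFin \o line_integral t (ee i) g).
    apply: eq_integrable int1 => // x xB.
    by rewrite /= indicE xB mulr1.
  exact: (integrableB mB int2 int3).
have sphi := sq_integrable_box_bump a b n.
have [psi tpsi [psiE dpsi]] := increment_test i a b n t0.
have intL := integrable_line_integral t0 (ee i) sg sphi.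
have intD := sq_integrableM sD sphi.
have intut := sq_integrableM sut sphi.
have intu := sq_integrableM su sphi.
rewrite (eq_Rintegral _ (g := fun x => ((u (x + t *: ee i) - u x) * box_bump a
  b n x) -
  line_integral t (ee i) g x * box_bump a b n x)); last by move=> x _;
    rewrite mulrBl.
rewrite RintegralB//.
rewrite (eq_Rintegral _ (g := fun x => (u (x + t *: ee i) * box_bump a b n x) -
  u x * box_bump a b n x)); last by move=> x _; rewrite mulrBl.
rewrite RintegralB// (Rintegral_line_integral (ee i) t0 sg sphi).
have := ug psi tpsi.
rewrite [in RHS](eq_Rintegral _ (g := fun x => g x * line_integral t (- ee i)
  (box_bump a b n) x)); last first.
  by move=> x _; rewrite psiE.
rewrite -[in X in _ -> X](opprK (\int[mes]_x (g x * _))%R) => <-; rewrite opprK.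
have sphit : sq_integrable mes (fun x => box_bump a b n (x - t *: ee i)).
  exact: sq_integrable_translate.
rewrite [X in _ + X](eq_Rintegral _ (g := fun x => u x * box_bump a b n x -
    u x * box_bump a b n (x - t *: ee i))); last by move=> x _;
      rewrite dpsi mulrBr.
rewrite RintegralB//; last exact: sq_integrableM.
have := Rintegral_translate (t *: ee i) (sq_integrableM su sphit).
rewrite (eq_Rintegral _ (g := fun x => u (x + t *: ee i) * box_bump a b n x));
  last first.
  by move=> x _; rewrite addrK.
by move=> ->; rewrite addrA subrK subrr.
Qed.

Lemma measurable_along g x v : measurable_fun setT g ->
  measurable_fun setT (fun s : measurableTypeR R => g (x + s *: v)).
Proof.
move=> mg; apply: (measurableT_comp mg).
apply: measurable_fun_rV => j; under eq_fun do rewrite !mxE.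
by apply: measurable_funD => //; exact: measurable_funM.
Qed.

Lemma line_integral_sqr_le t v g x : 0 < t -> measurable_fun setT g ->
  ((line_integral t v g x ^+ 2)%:E <=
    t%:E * \int[leb]_(s in `[0%R, t]) (g (x + s *: v) ^+ 2)%:E)%E.
Proof.
move=> t0 mg; apply: sqr_Rintegral_le => //.
  transitivity (lebesgue_measure (`[0%R, t]%classic : set (measurableTypeR R)))
    => //.
  by rewrite lebesgue_measure_itv/= lte_fin t0 sube0.
by apply: measurable_funTS; exact: measurable_along.
Qed.

(** The two indicators extend the squared increment by 0 to all x, so that the integral runs over
    the whole space and translations act on it. *)
Definition increment_on (Q : set 'rV[R]_d) u z x : \bar R :=
  (\1_Q x * \1_Q (x + z) * (u (x + z) - u x) ^+ 2)%:E.

Lemma increment_on_ge0 Q u z x : (0 <= increment_on Q u z x)%E.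
Proof. by rewrite lee_fin mulr_ge0 ?sqr_ge0// mulr_ge0. Qed.

Lemma measurable_increment_on Q u z : measurable Q -> measurable_fun setT u ->
  measurable_fun setT (increment_on Q u z).
Proof.
move=> mQ mu; have mt := measurable_addr_rV z; apply/measurable_EFinP.
have m1 : measurable_fun setT (\1_Q : 'rV[R]_d -> R) by exact: measurable_indic.
apply: measurable_funM.
  by apply: measurable_funM => //; exact: (measurableT_comp m1 mt).
apply: measurable_funX; apply: measurable_funB => //.
exact: (measurableT_comp mu mt).
Qed.

(** By Cauchy-Schwarz the squared increment is at most t times the integral of g^2 over the segment,
    which stays in Q. Exchanging the integrals, each s in [0, t] contributes at most the integral of
    g^2 over Q, whence the second factor t. *)
Lemma increment_pos_le i (Q : set 'rV[R]_d) u g t : 0 < t -> measurable Q ->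
  (forall x s, Q x -> Q (x + t *: ee i) -> 0 <= s <= t -> Q (x + s *: ee i)) ->
  sq_integrable mes u -> sq_integrable mes g -> weak_deriv i u g ->
  (\int[mes]_x increment_on Q u (t *: ee i) x <=
    (t ^+ 2)%:E * \int[mes]_(x in Q) (g x ^+ 2)%:E)%E.
Proof.
move=> t0 mQ Qcvx su sg ug; have [mu _] := su; have [mg _] := sg.
have m1 : measurable_fun setT (\1_Q : 'rV[R]_d -> R) by exact: measurable_indic.
pose k x : R := \1_Q x * g x ^+ 2.
have k0 x : 0 <= k x by rewrite mulr_ge0 ?sqr_ge0.
have mk : measurable_fun setT k by apply: measurable_funM => //;
  exact: measurable_funX.
pose I : set (measurableTypeR R) := `[0%R, t]%classic.
have mI : measurable_fun setT (\1_I : measurableTypeR R -> R).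
  by apply: measurable_indic; exact: measurable_itv.
pose K (p : 'rV[R]_d * measurableTypeR R) : \bar R :=
  (t * (\1_I p.2 * k (p.1 + p.2 *: ee i)))%:E.
have mK : measurable_fun setT K.
  apply/measurable_EFinP; apply: measurable_funM => //; apply: measurable_funM.
    exact: (measurableT_comp mI).
  exact: (measurableT_comp mk (measurable_line (ee i))).
have K0 p : (0 <= K p)%E by rewrite lee_fin mulr_ge0 ?(ltW t0)// mulr_ge0.
have le1 : (\int[mes]_x increment_on Q u (t *: ee i) x <=
    \int[mes]_x \int[leb]_s K (x, s))%E.
  apply: ae_ge0_le_integral => //.
  - by move=> x _; exact: increment_on_ge0.
  - exact: measurable_increment_on.
  - by move=> x _; apply: integral_ge0.
  - exact: measurable_fun_fubini_tonelli_F.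
  apply: filterS (increment_formula t0 su sg ug) => x ux _.
  rewrite /increment_on ux !indicE.
  have [xQ|xQ] := boolP (x \in Q); last by rewrite !mul0r; exact: integral_ge0.
  have [xtQ|xtQ] := boolP (x + t *: ee i \in Q); last first.
    by rewrite mulr0 mul0r; exact: integral_ge0.
  rewrite !mul1r; apply: (le_trans (line_integral_sqr_le (ee i) x t0 mg)).
  rewrite -ge0_integralZl//; last 3 first.
  - by apply: measurable_sqr; apply: measurable_funTS; exact: measurable_along.
  - by move=> s _; exact: sqr_EFin_ge0.
  - by rewrite lee_fin ltW.
  rewrite le_eqVlt; apply/orP; left; apply/eqP.
  rewrite integral_mkcond; apply: eq_integral => s _.
  rewrite patchE /K/= indicE -/I; case: ifPn => [sI|_];
    last by rewrite !mul0r mulr0.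
  rewrite mul1r /k indicE mem_set ?mul1r//; apply: Qcvx;
    [by rewrite inE in xQ|by rewrite inE in xtQ|].
  by move: sI; rewrite inE /I/= in_itv.
apply: (le_trans le1); rewrite fubini_tonelli//.
have kE : (\int[mes]_x (k x)%:E = \int[mes]_(x in Q) (g x ^+ 2)%:E)%E.
  rewrite [RHS]integral_mkcond; apply: eq_integral => x _.
  by rewrite patchE /k indicE; case: ifPn; rewrite ?mul1r ?mul0r.
have c0 : (0 <= \int[mes]_(x in Q) (g x ^+ 2)%:E)%E.
  by apply: integral_ge0 => x _; exact: sqr_EFin_ge0.
have cfin : (\int[mes]_(x in Q) (g x ^+ 2)%:E < +oo)%E.
  have [_] := sg; apply: le_lt_trans; apply: ge0_subset_integral => //.
    exact: measurable_sqr.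
  by move=> x _; exact: sqr_EFin_ge0.
set c := (\int[mes]_(x in Q) _)%E in kE c0 cfin *.
have cE : c = (fine c)%:E by rewrite fineK// ge0_fin_numE.
rewrite (eq_integral (fun s : measurableTypeR R => (t * fine c)%:E * (\1_I
  s)%:E)%E).
  rewrite ge0_integralZl//; last 2 first.
  - exact/measurable_EFinP.
  - by rewrite lee_fin mulr_ge0 ?fine_ge0// ltW.
  rewrite [X in (_ * X)%E](_ : _ = t%:E).
    by rewrite cE -!EFinM lee_fin; nra.
  transitivity (leb I); first by rewrite integral_indic ?setIT//;
    exact: measurable_itv.
  transitivity (lebesgue_measure I) => //.
  by rewrite lebesgue_measure_itv/= lte_fin t0 sube0.
move=> s _; rewrite -[RHS]EFinM mulrAC EFinM -cE -kE.
rewrite -(ge0_integral_translate (s *: ee i) (f := fun x => (k x)%:E));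
  last 2 first.
- exact/measurable_EFinP.
- by move=> x; rewrite lee_fin.
rewrite -ge0_integralZl//; last 3 first.
- by apply/measurable_EFinP;
  exact: (measurableT_comp mk (measurable_addr_rV _)).
- by move=> x _; rewrite lee_fin.
- by rewrite lee_fin mulr_ge0// ltW.
by apply: eq_integral => x _; rewrite /K/= -EFinM mulrA.
Qed.

(** Substitute x - z for x; this reduces increments of negative length to positive ones. *)
Lemma integral_increment_onN (Q : set 'rV[R]_d) u z : measurable Q ->
  measurable_fun setT u ->
  (\int[mes]_x increment_on Q u z x = \int[mes]_x increment_on Q u (- z) x)%E.
Proof.
move=> mQ mu.
rewrite -(ge0_integral_translate (- z) (f := increment_on Q u z)).
- apply: eq_integral => x _; rewrite /increment_on subrK.
  by rewrite [\1_Q (x - z) * _]mulrC -sqrrN opprB.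
- exact: measurable_increment_on.
- exact: increment_on_ge0.
Qed.

Lemma increment_axis_le i (Q : set 'rV[R]_d) u g t : measurable Q ->
  (forall x s t, Q x -> Q (x + t *: ee i) -> 0 <= s <= t -> Q (x + s *: ee i))
    ->
  sq_integrable mes u -> sq_integrable mes g -> weak_deriv i u g ->
  (\int[mes]_x increment_on Q u (t *: ee i) x <=
    (t ^+ 2)%:E * \int[mes]_(x in Q) (g x ^+ 2)%:E)%E.
Proof.
move=> mQ Qcvx su sg ug; have [mu _] := su.
have [t0|t0|<-] := ltgtP 0 t.
- apply: increment_pos_le => // x s ? ? ?; exact: (Qcvx x s t).
- rewrite integral_increment_onN// -scaleNr -sqrrN.
  apply: increment_pos_le => //; first by rewrite oppr_gt0.
  by move=> x s ? ? ?; exact: (Qcvx x s (- t)).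
- rewrite expr0n/= mul0e integral0_eq// => x _.
  by rewrite /increment_on scale0r addr0 subrr expr0n/= mulr0.
Qed.

Lemma sqr_sum_le n (c : 'I_n -> R) :
  (\sum_i c i) ^+ 2 <= n%:R * \sum_i c i ^+ 2.
Proof.
elim: n c => [|n IHn] c; first by rewrite !big_ord0 expr0n mulr0.
rewrite !big_ord_recr/=; set a := c ord_max; set S := \sum_(i < n) c _.
set T := \sum_(i < n) _ ^+ 2.
have h1 : S ^+ 2 <= n%:R * T by exact: IHn.
have h2 : 2 * a * S <= n%:R * a ^+ 2 + T.
  rewrite mulr_sumr -[X in X%:R * a ^+ 2](card_ord n) -sum1_card natr_sum
    mulr_suml.
  rewrite -big_split/=; apply: ler_sum => i _.
  by have := sqr_ge0 (a - c (widen_ord (leqnSn n) i)); lra.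
by rewrite -natr1; nra.
Qed.

Lemma hobox_convex i a b x s t : hobox a b x -> hobox a b (x + t *: ee i) ->
  0 <= s <= t -> hobox a b (x + s *: ee i).
Proof.
move=> xQ xtQ /andP[s0 st] j; have := xQ j; have := xtQ j; rewrite !mxE/=.
case: (j == i); rewrite ?mulr0 ?mulr1 ?addr0// => /andP[h1 h2] /andP[h3 h4].
by apply/andP; split; lra.
Qed.

Definition truncate_row z (k : nat) : 'rV[R]_d :=
  \row_j (if (j < k)%N then z ord0 j else 0).

Lemma truncate_rowS z (k : 'I_d) :
  truncate_row z k.+1 = truncate_row z k + z ord0 k *: ee k.
Proof.
apply/rowP => j; rewrite !mxE/= ltnS leq_eqVlt -val_eqE/=.
by case: ltngtP => //=; rewrite ?mulr0 ?mulr1 ?addr0 ?add0r// => /val_inj ->.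
Qed.

Lemma hobox_truncate a b x z k : hobox a b x -> hobox a b (x + z) ->
  hobox a b (x + truncate_row z k).
Proof.
move=> xQ xzQ j; have := xQ j; have := xzQ j; rewrite !mxE.
by case: ifP => _; rewrite ?addr0.
Qed.

(* One walks from [x] to [x + z] along the coordinate axes; the intermediate
   points stay in the box. *)
Lemma increment_le a b u (g : 'I_d -> 'rV[R]_d -> R) z :
  sq_integrable mes u -> (forall i, sq_integrable mes (g i)) ->
  (forall i, weak_deriv i u (g i)) ->
  (\int[mes]_x increment_on (hobox a b) u z x <=
    d%:R%:E * \sum_i (z ord0 i ^+ 2)%:E * \int[mes]_(x in hobox a b) (g i x ^+
      2)%:E)%E.
Proof.
move=> su sg ug; have [mu _] := su; set Q := hobox a b.
have mQ : measurable Q by exact: measurable_hobox.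
pose w k x := increment_on Q u (z ord0 k *: ee k) (x + truncate_row z k).
have w0 k x : (0 <= w k x)%E by exact: increment_on_ge0.
have mw k : measurable_fun setT (w k).
  apply: (measurableT_comp (measurable_increment_on _ mQ mu)).
  exact: measurable_addr_rV.
apply: (@le_trans _ _ (\int[mes]_x (d%:R%:E * \sum_k w k x))%E).
  apply: ge0_le_integral => //.
  - by move=> x _; exact: increment_on_ge0.
  - exact: measurable_increment_on.
  - by apply: emeasurable_funM => //; exact: emeasurable_sum.
  move=> x _; have [[xQ xzQ]|nQ] := pselect (Q x /\ Q (x + z)); last first.
    rewrite /increment_on (_ : \1_Q x * _ = 0); last first.
      rewrite !indicE; have [xQ|] := boolP (x \in Q); last by rewrite mul0r.
      rewrite memNset ?mulr0// => xzQ; apply: nQ; split => //.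
      by rewrite inE in xQ.
    by rewrite mul0r mule_ge0// sume_ge0.
  have wE (k : 'I_d) : w k x =
      ((u (x + truncate_row z k.+1) - u (x + truncate_row z k)) ^+ 2)%:E.
    rewrite /w /increment_on -addrA -truncate_rowS !indicE !mem_set ?mul1r//.
      exact: hobox_truncate.
    exact: hobox_truncate.
  rewrite /increment_on !indicE !mem_set// !mul1r.
  rewrite (eq_bigr _ (fun k _ => wE k)) sumEFin -EFinM lee_fin.
  apply: le_trans (sqr_sum_le _); rewrite le_eqVlt; apply/orP; left; apply/eqP.
  congr (_ ^+ 2).
  rewrite -(big_mkord predT (fun k => u (x + truncate_row z k.+1) -
    u (x + truncate_row z k))) telescope_sumr//.
  congr (u (x + _) - u _); first by apply/rowP => j; rewrite mxE ltn_ord.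
  by apply/rowP => j; rewrite !mxE addr0.
rewrite ge0_integralZl//; last 2 first.
- exact: emeasurable_sum.
- by move=> x _; exact: sume_ge0.
rewrite ge0_integral_sum//; apply: lee_wpmul2l; first by rewrite lee_fin.
apply: lee_sum => k _.
rewrite (ge0_integral_translate (truncate_row z k)
  (f := increment_on Q u (z ord0 k *: ee k))); last 2 first.
- exact: measurable_increment_on.
- exact: increment_on_ge0.
by apply: increment_axis_le => // x s t; exact: hobox_convex.
Qed.

Lemma measurable_increment_on2 (Q : set 'rV[R]_d) u : measurable Q ->
  measurable_fun setT u ->
  measurable_fun setT (fun p : 'rV[R]_d * 'rV[R]_d => increment_on Q u p.2 p.1).
Proof.
move=> mQ mu; apply/measurable_EFinP.
have m1 : measurable_fun setT (\1_Q : 'rV[R]_d -> R) by exact: measurable_indic.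
apply: measurable_funM.
  apply: measurable_funM; first exact: (measurableT_comp m1).
  exact: (measurableT_comp m1 (@measurable_addrV R d)).
apply: measurable_funX; apply: measurable_funB;
  last exact: (measurableT_comp mu).
exact: (measurableT_comp mu (@measurable_addrV R d)).
Qed.

(** Exchange the integrals and apply [increment_le] for each fixed z. Only differences of points of
    Q matter: they lie in the cube D of volume (2 l)^d, where each z_i^2 is at most l^2. *)
Lemma double_increment_le a (l : R) u (g : 'I_d -> 'rV[R]_d -> R) : 0 < l ->
  let Q := hobox a (a + const_mx l) in
  sq_integrable mes u -> (forall i, sq_integrable mes (g i)) ->
  (forall i, weak_deriv i u (g i)) ->
  (\int[mes]_x \int[mes]_z increment_on Q u z x <=
    ((2 * l) ^+ d * d%:R * l ^+ 2)%:E *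
      \sum_i \int[mes]_(x in Q) (g i x ^+ 2)%:E)%E.
Proof.
move=> l0 Q su sg ug; have [mu _] := su.
have mQ : measurable Q by exact: measurable_hobox.
rewrite (fubini_tonelli (fun p => increment_on Q u p.2 p.1)); last 2 first.
- exact: measurable_increment_on2.
- by move=> p; exact: increment_on_ge0.
pose D := obox (const_mx (- l)) (const_mx l : 'rV[R]_d).
have mD : measurable D by exact: measurable_obox.
pose S := (\sum_i \int[mes]_(x in Q) (g i x ^+ 2)%:E)%E.
have gi0 i : (0 <= \int[mes]_(x in Q) (g i x ^+ 2)%:E)%E.
  by apply: integral_ge0 => x _; exact: sqr_EFin_ge0.
have S0 : (0 <= S)%E by exact: sume_ge0.
have Sfin : (S < +oo)%E.
  apply: lte_sum_pinfty => i _; have [mg] := sg i; apply: le_lt_trans.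
  apply: ge0_subset_integral => //; first exact: measurable_sqr.
  by move=> x _; exact: sqr_EFin_ge0.
have SE : S = (fine S)%:E by rewrite fineK// ge0_fin_numE.
apply: (@le_trans _ _ (\int[mes]_z ((d%:R * l ^+ 2 * fine S)%:E * (\1_D
  z)%:E))%E).
  apply: ge0_le_integral => //.
  - by move=> z _; apply: integral_ge0 => x _; exact: increment_on_ge0.
  - apply: (measurable_fun_fubini_tonelli_G (fun p => increment_on Q u p.2
    p.1)).
      exact: measurable_increment_on2.
    by move=> p; exact: increment_on_ge0.
  - by apply: emeasurable_funM => //; apply/measurable_EFinP;
    exact: measurable_indic.
  move=> z _; rewrite indicE; have [zD|zD] := boolP (z \in D); last first.
    rewrite mule0 integral0_eq// => x _; rewrite /increment_on.
    rewrite (_ : \1_Q x * _ = 0) ?mul0r// !indicE.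
    have [xQ|] := boolP (x \in Q); last by rewrite mul0r.
    rewrite memNset ?mulr0// => xzQ; move: zD; rewrite notin_setE; apply.
    rewrite inE in xQ => i; have := xQ i; have := xzQ i; rewrite !mxE.
    by move=> /andP[h1 h2] /andP[h3 h4]; apply/andP; split; lra.
  rewrite mule1; apply: (le_trans (increment_le _ _ _ su sg ug)).
  rewrite -mulrA EFinM; apply: lee_wpmul2l; first by rewrite lee_fin.
  rewrite EFinM -SE ge0_sume_distrr; last by move=> i _; exact: gi0.
  apply: lee_sum => i _; apply: lee_wpmul2r => //; rewrite lee_fin.
  rewrite inE in zD; have := zD i; rewrite !mxE => /andP[h1 h2].
  by rewrite -[z _ _ ^+ 2]real_normK ?num_real// ler_sqr ?nnegrE ?(ltW l0)//
    ler_norml !ltW.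
rewrite ge0_integralZl//; last 2 first.
- by apply/measurable_EFinP; exact: measurable_indic.
- by rewrite lee_fin mulr_ge0 ?fine_ge0// mulr_ge0 ?sqr_ge0.
have hD : mes D = ((2 * l) ^+ d)%:E.
  rewrite lebesgue_obox; last by move=> i; rewrite !mxE; lra.
  under eq_bigr do rewrite !mxE opprK.
  by rewrite prodr_const card_ord mulr_natl mulr2n.
have -> : (\int[mes]_x (\1_D x)%:E = ((2 * l) ^+ d)%:E)%E.
  by rewrite integral_indic// setIT; exact: hD.
rewrite -/S SE -!EFinM lee_fin le_eqVlt; apply/orP; left; apply/eqP; ring.
Qed.

Definition mean_on (Q : set 'rV[R]_d) u : R :=
  (\int[mes]_(x in Q) u x)%R / fine (mes Q).

(** The difference u(x) - mean is the average over y in Q of u(x) - u(y), so its square is at most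
    the average of (u(y) - u(x))^2. With y = x + z the double integral is that of
    [double_increment_le], and dividing by l^d leaves the constant 2^d d l^2. *)
Lemma poincare a (l : R) u (g : 'I_d -> 'rV[R]_d -> R) : 0 < l ->
  let Q := hobox a (a + const_mx l) in
  sq_integrable mes u -> (forall i, sq_integrable mes (g i)) ->
  (forall i, weak_deriv i u (g i)) ->
  (\int[mes]_(x in Q) ((u x - mean_on Q u) ^+ 2)%:E <=
    (2 ^+ d * d%:R * l ^+ 2)%:E * \sum_i \int[mes]_(x in Q) (g i x ^+ 2)%:E)%E.
Proof.
move=> l0 Q su sg ug; have [mu _] := su.
have mQ : measurable Q by exact: measurable_hobox.
have Ql : mes Q = (l ^+ d)%:E.
  rewrite lebesgue_hobox; last by move=> i; rewrite !mxE; lra.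
  under eq_bigr do rewrite !mxE addrAC subrr add0r.
  by rewrite prodr_const card_ord.
have ld0 : 0 < l ^+ d by exact: exprn_gt0.
have Qfin : (mes Q < +oo)%E by rewrite Ql ltry.
have intu := sq_integrable_integrable mQ Qfin su.
have var x : (((u x - mean_on Q u) ^+ 2)%:E <=
    (l ^+ d)^-1%:E * \int[mes]_(y in Q) ((u y - u x) ^+ 2)%:E)%E.
  have intc := integrable_cst_fin (u x) mQ Qfin.
  have mux : measurable_fun Q (fun y => u y - u x).
    by apply: measurable_funTS; exact: measurable_funB.
  have intcE : (\int[mes]_(y in Q) u x)%R = u x * l ^+ d.
    by rewrite Rintegral_cst//; congr *%R; exact: (congr1 fine Ql).
  have := sqr_Rintegral_le mQ Ql ld0 mux.
  rewrite (RintegralB mQ intu intc) intcE => h.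
  have -> : (u x - mean_on Q u) ^+ 2 = ((l ^+ d)^-1 * (l ^+ d)^-1) *
      ((\int[mes]_(x in Q) u x)%R - u x * l ^+ d) ^+ 2.
    by rewrite /mean_on Ql [fine _]/=; field; rewrite gt_eqF.
  rewrite EFinM; apply: (le_trans (lee_wpmul2l _ h)).
    by rewrite lee_fin mulr_ge0// invr_ge0 ltW.
  by rewrite muleA -EFinM divfK// gt_eqF.
have inc x : Q x -> (\int[mes]_(y in Q) ((u y - u x) ^+ 2)%:E =
    \int[mes]_z increment_on Q u z x)%E.
  move=> xQ; pose f y := (\1_Q y * (u y - u x) ^+ 2)%:E.
  rewrite [RHS](eq_integral (fun z => f (z + x))); last first.
    by move=> z _; rewrite /increment_on [\1_Q x]indicE mem_set// mul1r [x +
      z]addrC.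
  rewrite (ge0_integral_translate x (f := f)).
  - rewrite integral_mkcond; apply: eq_integral => y _.
    by rewrite patchE /f indicE; case: ifPn; rewrite ?mul1r ?mul0r.
  - apply/measurable_EFinP; apply: measurable_funM;
    first exact: measurable_indic.
    by apply: measurable_funX; exact: measurable_funB.
  - by move=> y; rewrite lee_fin mulr_ge0 ?sqr_ge0.
have mF : measurable_fun setT (fun x => \int[mes]_z increment_on Q u z x)%E.
  apply: (measurable_fun_fubini_tonelli_F (fun p => increment_on Q u p.2 p.1)).
    exact: measurable_increment_on2.
  by move=> p; exact: increment_on_ge0.
have F0 x : (0 <= \int[mes]_z increment_on Q u z x)%E.
  by apply: integral_ge0 => z _; exact: increment_on_ge0.
have l1 : (0 <= (l ^+ d)^-1%:E :> \bar R)%E by rewrite lee_fin invr_ge0 ltW.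
apply: (@le_trans _ _ (\int[mes]_x ((l ^+ d)^-1%:E * \int[mes]_z increment_on Q
  u z x))%E).
  rewrite integral_mkcond; apply: ge0_le_integral => //.
  - by move=> x _; rewrite patchE; case: ifP => // _; exact: sqr_EFin_ge0.
  - apply: (measurable_restrictT _ mQ).1; apply: measurable_sqr.
    by apply: measurable_funTS; exact: measurable_funB.
  - by apply: emeasurable_funM.
  - move=> x _; rewrite patchE; case: ifPn => [|_]; last exact: mule_ge0.
    by rewrite inE => xQ; rewrite -inc.
rewrite ge0_integralZl//.
apply: (le_trans (lee_wpmul2l l1 (double_increment_le a l0 su sg ug))).
rewrite muleA -EFinM (_ : _^-1 * _ = 2 ^+ d * d%:R * l ^+ 2)//.
by rewrite exprMn; field; rewrite gt_eqF.
Qed.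

End translation.

(** * The energy bound on a tiling by cubes *)

Section bathtub.
Context d (T : measurableType d) (R : realType).
Variables (mu : {measure set T -> \bar R}) (V : T -> R).
Hypothesis mV : measurable_fun setT V.

Let W x := Num.max (V x) 0.

Let mW : measurable_fun setT W.
Proof. by apply: measurable_maxr. Qed.

Let W0 x : 0 <= W x. Proof. by rewrite /W le_max lexx orbT. Qed.

Let mWE D : measurable_fun D (fun x => (W x)%:E).
Proof. by apply/measurable_EFinP; exact: measurable_funTS. Qed.

Lemma integral_le_maxr (D : set T) :
  (\int[mu]_(x in D) (V x)%:E <= \int[mu]_(x in D) (W x)%:E)%E.
Proof.
rewrite integralE (eq_integral (fun x => (W x)%:E)); last first.
  by move=> x _; rewrite funeposE -EFin_max.
apply: (@le_trans _ _ (\int[mu]_(x in D) (W x)%:E - 0)%E);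
  last by rewrite sube0.
by apply: leeB => //; apply: integral_ge0 => x _; exact: funeneg_ge0.
Qed.

(* The part of [V] below the level [v] is the cheapest set of given measure. *)
Lemma bathtub (K E : set T) (v s : R) : 0 <= v -> measurable K -> measurable E
  ->
  E `<=` K -> (mu K < +oo)%E -> (s%:E <= mu E)%E ->
  let Kv := K `&` [set x | V x < v] in
  (\int[mu]_(x in Kv) (V x)%:E + (s%:E - mu Kv) * v%:E <=
   \int[mu]_(x in E) (W x)%:E)%E.
Proof.
move=> v0 mK mE EK Kfin sE /=; set Kv := K `&` _.
have mlt : measurable [set x | V x < v].
  rewrite (_ : [set x | _] = V @^-1` `]-oo, v[%classic).
    by rewrite -[X in measurable X]setTI; apply: mV => //;
      exact: measurable_itv.
  by apply/seteqP; split => x /=; rewrite in_itv.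
have mKv : measurable Kv by exact: measurableI.
have fin A : measurable A -> A `<=` K -> mu A \is a fin_num.
  move=> mA AK; rewrite ge0_fin_numE//; apply: le_lt_trans Kfin.
  by apply: le_measure; rewrite ?inE.
have KvK : Kv `<=` K by exact: subIsetl.
have splitI A B : measurable A -> measurable B ->
    (\int[mu]_(x in A) (W x)%:E = \int[mu]_(x in A `&` B) (W x)%:E +
      \int[mu]_(x in A `\` B) (W x)%:E)%E.
  move=> mA mB; rewrite -{1}(setUIDK A B) ge0_integral_setU//.
  - exact: measurableI.
  - exact: measurableD.
  - by move=> x _; rewrite lee_fin.
  - by rewrite disj_set2E; apply/eqP/seteqP; split => // x [[_ Bx] [_ nBx]].
(* Exchange [Kv] for [E]: W is at most v on the part lost and at least v on the part gained, and s
   <= mu E compares the measures of the two parts. *)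
have up : (\int[mu]_(x in Kv) (W x)%:E <=
    \int[mu]_(x in E `&` Kv) (W x)%:E + v%:E * mu (Kv `\` E))%E.
  rewrite (splitI Kv E)// setIC leeD2l// -integral_cst//;
    last exact: measurableD.
  apply: ge0_le_integral => //; first exact: measurableD.
  - by move=> x _; rewrite lee_fin.
  - by move=> x [[_ /= xv] _]; rewrite lee_fin /W ge_max (ltW xv).
have low : (\int[mu]_(x in E `&` Kv) (W x)%:E + v%:E * mu (E `\` Kv) <=
    \int[mu]_(x in E) (W x)%:E)%E.
  rewrite (splitI E Kv)// leeD2l// -integral_cst//; last exact: measurableD.
  apply: ge0_le_integral => //; first exact: measurableD.
  - by move=> x [xE xKv]; rewrite lee_fin /W le_max leNgt orbC;
    apply/orP; right; apply/negP => xv; apply: xKv; split => //; exact: EK.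
have mDE : (mu E = mu (E `\` Kv) + mu (E `&` Kv))%E by exact: measureDI.
have mDK : (mu Kv = mu (Kv `\` E) + mu (E `&` Kv))%E by rewrite setIC;
  exact: measureDI.
apply: le_trans low; apply: (le_trans (leeD2r _ (le_trans (integral_le_maxr _)
  up))).
rewrite -addeA leeD2l//.
have /fineK <- := fin (E `\` Kv) (measurableD mE mKv) (subset_trans (@subDsetl
  _ _ _) EK).
have /fineK fKE := fin (Kv `\` E) (measurableD mKv mE) (subset_trans (@subDsetl
  _ _ _) KvK).
have /fineK fI := fin (E `&` Kv) (measurableI _ _ mE mKv) (subset_trans
  (@subIsetl _ _ _) EK).
rewrite mDE -fI in sE.
have /fineK fEK := fin (E `\` Kv) (measurableD mE mKv) (subset_trans (@subDsetl
  _ _ _) EK).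
rewrite -fEK -EFinD lee_fin in sE.
have eK : mu Kv = (fine (mu (Kv `\` E)) + fine (mu (E `&` Kv)))%:E.
  by rewrite EFinD fKE fI.
by rewrite eK -fKE -EFinB -!EFinM -EFinD lee_fin; nra.
Qed.

End bathtub.

(** * The scaled domains and the cubes around them *)

Section geometry.
Variables (R : realType) (d : nat).
Hypothesis d0 : (0 < d)%N.
Local Notation mes := (lebesgue_rV R d).
Implicit Types (x y : 'rV[R]_d) (G : set 'rV[R]_d) (r : R).

Lemma coord_le_enorm x i : `|x ord0 i| <= enorm x.
Proof.
rewrite /enorm -sqrtr_sqr ler_wsqrtr// (bigD1 i)//= lerDl.
by apply: sumr_ge0 => j _; exact: sqr_ge0.
Qed.

Lemma enorm_le_sum x : enorm x <= \sum_i `|x ord0 i|.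
Proof.
have S0 : 0 <= \sum_i `|x ord0 i| by exact: sumr_ge0.
rewrite /enorm -[leRHS]ger0_norm// -sqrtr_sqr ler_wsqrtr// expr2 mulr_suml.
apply: ler_sum => i _; rewrite -real_normK ?num_real// expr2 ler_wpM2l//.
by rewrite (bigD1 i)//= lerDl sumr_ge0.
Qed.

(** The ball around 0 puts 0 in G, so the diameter bounds the norm of x itself. *)
Lemma admissible_coord G x i : admissible_domain G -> G x -> `|x ord0 i| <= 2.
Proof.
move=> [_ _ _ [rho [rho0 rhoG _]] diamG] Gx.
have G0 : G 0.
  apply: rhoG; rewrite /eball/= subr0 /enorm big1 ?sqrtr0// => j _.
  by rewrite mxE expr0n.
apply: (le_trans (coord_le_enorm x i)); rewrite -lee_fin -diamG.
by apply: ereal_sup_ubound; exists (x, 0); rewrite //= subr0.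
Qed.

Lemma scaled_domainE G r y : 0 < r ->
  scaled_domain G r y = [set x | G (r^-1 *: (x - y))].
Proof.
move=> r0; apply/seteqP; split => [_ [x Gx <-]|x Gx] /=; first by rewrite addrK.
by exists (x - y) => //; rewrite subrK.
Qed.

Lemma scaled_domain_translate G r y : 0 < r ->
  scaled_domain G r y = translate (- y) @^-1` scaled_domain G r 0.
Proof.
by move=> r0; rewrite !scaled_domainE//; apply/seteqP; split => x /=;
  rewrite subr0.
Qed.

Lemma open_scaled_domain G r y : 0 < r -> open G -> open (scaled_domain G r y).
Proof.
move=> r0 oG; rewrite scaled_domainE//.
apply: (open_comp (f := fun x => r^-1 *: (x - y))) => // x _.
apply: (@continuous_comp _ _ _ (fun x => x - y) ( *:%R r^-1));
  last exact: scaler_continuous.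
by apply: continuousB; [exact: cvg_id|exact: cst_continuous].
Qed.

Lemma measurable_scaled_domain G r y : 0 < r -> admissible_domain G ->
  measurable (scaled_domain G r y).
Proof.
by move=> r0 [oG _ _ _ _]; apply: open_measurable_rV; exact: open_scaled_domain.
Qed.

Lemma lebesgue_scaled_domain G r y : 0 < r -> admissible_domain G ->
  mes (scaled_domain G r y) = mes (scaled_domain G r 0).
Proof.
move=> r0 aG; rewrite scaled_domain_translate// lebesgue_rV_translate//.
exact: measurable_scaled_domain.
Qed.

(** The closed cube of half side 2 r around y contains G_r(y), hence its closure. Half side 4 r
    leaves room for the faces missing from a half-open cube. *)
Lemma closure_scaled_domain_sub G r y : 0 < r -> admissible_domain G ->
  closure (scaled_domain G r y) `<=`
  hobox (y - const_mx (4 * r)) (y - const_mx (4 * r) + const_mx (8 * r)).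
Proof.
move=> r0 aG.
pose B := [set x : 'rV[R]_d | forall i, `[y ord0 i - 2 * r, y ord0 i + 2 *
  r]%classic (x ord0 i)].
have cB : closed B.
  apply: compact_closed; first exact: norm_hausdorff.
  apply: (@rV_compact _ _ (fun i => `[y ord0 i - 2 * r, y ord0 i + 2 *
    r]%classic)) => i.
  exact: segment_compact.
apply: (@subset_trans _ B).
  rewrite [X in _ `<=` X](closure_id _).1//; apply: closure_subset.
  rewrite scaled_domainE// /B => x /= Gx i; rewrite in_itv/=.
  have := admissible_coord i aG Gx; rewrite !mxE normrM normfV (gtr0_norm r0).
  by rewrite ler_pdivrMl// [r * 2]mulrC ler_distl.
by move=> x Bx i; have := Bx i; rewrite /= in_itv/= !mxE => /andP[? ?];
  apply/andP; split; lra.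
Qed.

(** G_r(0) contains the ball of radius r rho, which contains the open cube of half side r rho / (d +
    1): its points have coordinates summing to at most r rho d / (d + 1) in absolute value, strictly
    less than r rho. *)
Lemma lebesgue_scaled_domain_ge G : admissible_domain G ->
  exists2 c : R, 0 < c & forall r, 0 < r ->
    ((c * r ^+ d)%:E <= mes (scaled_domain G r 0%R))%E.
Proof.
move=> aG; have [_ _ _ [rho [rho0 rhoG _]] _] := aG.
pose del := rho / d.+1%:R.
have del0 : 0 < del by rewrite divr_gt0.
exists ((2 * del) ^+ d) => [|r r0]; first by rewrite exprn_gt0// mulr_gt0.
pose B := obox (const_mx (- (r * del))) (const_mx (r * del) : 'rV[R]_d).
have -> : ((2 * del) ^+ d * r ^+ d)%:E = mes B.
  rewrite lebesgue_obox; last by move=> i; rewrite !mxE;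
    have := mulr_gt0 r0 del0; lra.
  under [in RHS]eq_bigr do rewrite !mxE opprK.
  by rewrite prodr_const card_ord -exprMn; congr (_ ^+ _)%:E; ring.
apply: le_measure; rewrite ?inE.
- exact: measurable_obox.
- exact: measurable_scaled_domain.
rewrite scaled_domainE// => x xB /=; apply: rhoG; rewrite /eball/= !subr0.
apply: (le_lt_trans (enorm_le_sum _)).
apply: (@le_lt_trans _ _ (\sum_(i < d) del)).
  apply: ler_sum => i _; have := xB i; rewrite !mxE -ltr_norml => /ltW h.
  by rewrite normrM normfV (gtr0_norm r0) ler_pdivrMl.
by rewrite sumr_const card_ord -mulr_natl /del mulrC -mulrA gtr_pMr//
  ltr_pdivrMl// mulr1 ltr_nat.
Qed.

Lemma scaled_domain_fin G r y : 0 < r -> admissible_domain G ->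
  (mes (closure (scaled_domain G r y)) < +oo)%E.
Proof.
move=> r0 aG; apply: (@le_lt_trans _ _ (mes (hobox (y - const_mx (4 * r))
    (y - const_mx (4 * r) + const_mx (8 * r))))); last first.
  rewrite lebesgue_hobox ?ltry// => i; rewrite !mxE; lra.
apply: le_measure; rewrite ?inE.
- by rewrite -(setCK (closure _)); apply: measurableC;
  apply: open_measurable_rV; apply: closed_openC; exact: closed_closure.
- exact: measurable_hobox.
- exact: closure_scaled_domain_sub.
Qed.

End geometry.

Section cube_estimate.
Variables (R : realType) (d : nat).
Local Notation mes := (lebesgue_rV R d).
Variables (V : 'rV[R]_d -> R) (G : set 'rV[R]_d).
Hypotheses (mV : measurable_fun setT V) (aG : admissible_domain G).

(** The sign of V will be known only almost everywhere; the truncation is nonnegative at every point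
    and agrees with V almost everywhere. *)
Definition potential x : R := Num.max (V x) 0.

Lemma measurable_potential : measurable_fun setT potential.
Proof. by apply: measurable_maxr. Qed.

Lemma potential_ge0 x : 0 <= potential x.
Proof. by rewrite /potential le_max lexx orbT. Qed.

Lemma measurable_closure_rV (A : set 'rV[R]_d) : measurable (closure A).
Proof.
rewrite -(setCK (closure _)); apply: measurableC; apply: open_measurable_rV.
by apply: closed_openC; exact: closed_closure.
Qed.

Lemma J_functional_le r y (s : R) (E : set 'rV[R]_d) : 0 < r ->
  (s%:E < mes (closure (scaled_domain G r y)))%E -> measurable E ->
  E `<=` closure (scaled_domain G r y) -> (s%:E <= mes E)%E ->
  (J_functional V G s y r <= \int[mes]_(x in E) (potential x)%:E)%E.
Proof.
move=> r0 sK mE EK sE; rewrite /J_functional /K_minus.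
have mK := measurable_closure_rV (scaled_domain G r y).
have Kfin := scaled_domain_fin y r0 aG.
set K := closure _ in sK EK mK Kfin *.
have Vs0 : (0 <= V_star V G s y r)%E by rewrite /V_star le_max lexx.
(* At an infinite level [K_minus] is all of K, and s < mes K makes the second term of J equal to
   -oo. A finite level is the bathtub principle. *)
case: (V_star V G s y r) Vs0 => [v v0| _|//]; last first.
  rewrite (_ : K `&` _ = K); last by apply/setIidPl => x _ /=; rewrite ltry.
  rewrite lt0_muley ?addeNy ?leNye// sube_lt0//.
rewrite (_ : [set x | _] = [set x | V x < v]); last first.
  by apply/seteqP; split => x /=; rewrite lte_fin.
exact: bathtub.
Qed.

Definition tile r y : set 'rV[R]_d :=
  hobox (y - const_mx (4 * r)) (y - const_mx (4 * r) + const_mx (8 * r)).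

Lemma measurable_tile r y : measurable (tile r y).
Proof. exact: measurable_hobox. Qed.

Lemma lebesgue_tile r y : 0 < r -> mes (tile r y) = ((8 * r) ^+ d)%:E.
Proof.
move=> r0; rewrite lebesgue_hobox; last by move=> i; rewrite !mxE; lra.
rewrite (eq_bigr (fun=> 8 * r)); first by rewrite prodr_const card_ord.
by move=> i _; rewrite !mxE; ring.
Qed.

Lemma integral_sqr_le_mean (Q : set 'rV[R]_d) (u : 'rV[R]_d -> R) (m M : R) :
  measurable Q -> mes Q = M%:E -> measurable_fun setT u ->
  (\int[mes]_(x in Q) (u x ^+ 2)%:E <=
    2%:E * \int[mes]_(x in Q) ((u x - m) ^+ 2)%:E + (2 * m ^+ 2 * M)%:E)%E.
Proof.
move=> mQ QM mu.
have mum : measurable_fun Q (fun x => ((u x - m) ^+ 2)%:E).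
  by apply: measurable_sqr; apply: measurable_funTS; exact: measurable_funB.
rewrite EFinM -QM -integral_cst// -ge0_integralZl//; last first.
  by move=> x _; exact: sqr_EFin_ge0.
rewrite -ge0_integralD//; last 3 first.
- by move=> x _; rewrite mule_ge0 ?sqr_EFin_ge0.
- by apply: emeasurable_funM => //; exact: measurable_cst.
- by move=> x _; rewrite lee_fin mulr_ge0 ?sqr_ge0.
apply: ge0_le_integral => //.
- by move=> x _; exact: sqr_EFin_ge0.
- by apply: measurable_sqr; exact: measurable_funTS.
- apply: emeasurable_funD => //; apply: emeasurable_funM => //;
  exact: measurable_cst.
- by move=> x _; rewrite -EFinM -EFinD lee_fin; have := sqr_ge0 (u x - 2 * m);
  nra.
Qed.

(* Either [u] is far from its mean [m] on a set of measure at least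
   [gamma |G_r|], and Chebyshev's inequality controls [m] by the variance, or
   [|u| >= |m| / 2] on a set which the hypothesis on [J] makes expensive. *)
Lemma mean_le r y (gam m X P L c : R) (u : 'rV[R]_d -> R) :
  0 < r -> 0 < gam < 1 -> 0 < L -> 0 < c ->
  measurable_fun setT u ->
  mes (scaled_domain G r 0) = c%:E ->
  (L%:E <= J_functional V G ((1 - gam) * c) y r)%E ->
  (\int[mes]_(x in tile r y) ((u x - m) ^+ 2)%:E <= X%:E)%E ->
  (\int[mes]_(x in tile r y) (potential x * u x ^+ 2)%:E <= P%:E)%E ->
  m ^+ 2 <= 4 * X / (gam * c) + 4 * P / L.
Proof.
move=> r0 /andP[gam0 gam1] L0 c0 mu Gc LJ var pot.
have X0 : 0 <= X.
  rewrite -lee_fin; apply: le_trans var; apply: integral_ge0 => x _.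
  exact: sqr_EFin_ge0.
have P0 : 0 <= P.
  rewrite -lee_fin; apply: le_trans pot; apply: integral_ge0 => x _.
  by rewrite lee_fin mulr_ge0 ?potential_ge0 ?sqr_ge0.
have gc0 : 0 < gam * c by exact: mulr_gt0.
have [->|m0] := eqVneq m 0.
  by rewrite expr0n/= addr_ge0// divr_ge0// ?mulr_ge0// ltW.
pose K := closure (scaled_domain G r y).
have mK : measurable K by exact: measurable_closure_rV.
have KQ : K `<=` tile r y by exact: closure_scaled_domain_sub.
have Kc : (c%:E <= mes K)%E.
  rewrite -Gc -(lebesgue_scaled_domain y r0 aG); apply: le_measure;
    rewrite ?inE//.
    exact: measurable_scaled_domain.
  exact: subset_closure.
have Kfin : (mes K < +oo)%E by exact: scaled_domain_fin.
pose F := [set x | `|m| / 2 <= `|u x - m|].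
have mF : measurable F.
  have mum : measurable_fun setT (fun x => `|u x - m|).
    by apply: measurableT_comp => //; exact: measurable_funB.
  rewrite (_ : F = (fun x => `|u x - m|) @^-1` `[`|m| / 2, +oo[%classic).
    by rewrite -[X in measurable X]setTI; apply: mum => //;
      exact: measurable_itv.
  by apply/seteqP; split => x; rewrite /F /= in_itv/= andbT.
have mKF : measurable (K `&` F) by exact: measurableI.
have mKD : measurable (K `\` F) by exact: measurableD.
have mQ := measurable_tile r y.
have m20 : 0 < m ^+ 2 by rewrite exprn_even_gt0.
have [sE|Es] := leP ((1 - gam) * c)%:E (mes (K `\` F)).
  (* Strictness is what settles the case of an infinite level in [J_functional_le]. *)
  have sK : (((1 - gam) * c)%:E < mes K)%E.
    by apply: lt_le_trans Kc; rewrite lte_fin; nra.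
  have LW := le_trans LJ (J_functional_le r0 sK mKD (@subDsetl _ _ _) sE).
  have : ((m ^+ 2 / 4)%:E * \int[mes]_(x in K `\` F) (potential x)%:E <=
    P%:E)%E.
    apply: le_trans pot; rewrite -ge0_integralZl//; last 3 first.
    - by apply/measurable_EFinP; apply: measurable_funTS;
      exact: measurable_potential.
    - by move=> x _; rewrite lee_fin potential_ge0.
    - by rewrite lee_fin; lra.
    have mWu (D : set 'rV[R]_d) : measurable_fun D (fun x => (potential x * u x
      ^+ 2)%:E).
      apply/measurable_EFinP; apply: measurable_funTS; apply: measurable_funM.
        exact: measurable_potential.
      exact: measurable_funX.
    apply: (@le_trans _ _ (\int[mes]_(x in K `\` F) (potential x * u x ^+
      2)%:E)%E).
      apply: ge0_le_integral => //.
      - by move=> x _; rewrite mule_ge0// lee_fin ?potential_ge0//; lra.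
      - apply: emeasurable_funM => //; apply/measurable_EFinP;
        apply: measurable_funTS; exact: measurable_potential.
      - move=> x [_ /= /negP]; rewrite -ltNge => uxm.
        rewrite -EFinM lee_fin mulrC ler_wpM2l ?potential_ge0//.
        have : `|m| / 2 <= `|u x|.
          by have := ler_normB (u x) (u x - m); rewrite opprB addrC subrK; lra.
        rewrite -[u x ^+ 2]real_normK ?num_real// -[m ^+ 2]real_normK
          ?num_real//.
        by have := normr_ge0 m; have := normr_ge0 (u x); nra.
    apply: ge0_subset_integral => //.
      by move=> x _; rewrite lee_fin mulr_ge0 ?potential_ge0 ?sqr_ge0.
    by apply: subset_trans KQ; exact: subDsetl.
  have m4 : (0 <= (m ^+ 2 / 4)%:E :> \bar R)%E by rewrite lee_fin; lra.
  move=> /(le_trans (lee_wpmul2l m4 LW)); rewrite -EFinM lee_fin => h.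
  apply: (@le_trans _ _ (4 * P / L)); first by rewrite ler_pdivlMr//; lra.
  by rewrite lerDr divr_ge0 ?mulr_ge0// ltW.
(* The closure K has measure at least c, and less than (1 - gam) c of it lies outside F. *)
have KFc : (gam * c < fine (mes (K `&` F))).
  have mDI : mes K = (mes (K `\` F) + mes (K `&` F))%E by exact: measureDI.
  have fD : mes (K `\` F) \is a fin_num.
    by rewrite ge0_fin_numE//; apply: lt_trans Es _; rewrite ltry.
  have fI : mes (K `&` F) \is a fin_num.
    rewrite ge0_fin_numE//; apply: le_lt_trans Kfin; apply: le_measure;
      rewrite ?inE//.
  have eD := fineK fD; have eI := fineK fI.
  by move: Kc Es; rewrite mDI -{1 2}eD -{1}eI -EFinD lee_fin lte_fin; lra.
have : ((m ^+ 2 / 4)%:E * mes (K `&` F) <= X%:E)%E.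
  rewrite -integral_cst//; apply: le_trans var.
  have mum (D : set 'rV[R]_d) : measurable_fun D (fun x => ((u x - m) ^+ 2)%:E).
    by apply: measurable_sqr; apply: measurable_funTS; exact: measurable_funB.
  apply: (@le_trans _ _ (\int[mes]_(x in K `&` F) ((u x - m) ^+ 2)%:E)%E).
    apply: ge0_le_integral => //.
    - by move=> x _; rewrite lee_fin; lra.
    - move=> x [_ Fx]; have uxm : `|m| / 2 <= `|u x - m| := Fx; rewrite lee_fin.
      rewrite -[(u x - m) ^+ 2]real_normK ?num_real// -[m ^+ 2]real_normK
        ?num_real//.
      by have := normr_ge0 m; nra.
  apply: ge0_subset_integral => //.
    by move=> x _; exact: sqr_EFin_ge0.
  by apply: subset_trans KQ; exact: subIsetl.
have fI : mes (K `&` F) \is a fin_num.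
  rewrite ge0_fin_numE//; apply: le_lt_trans Kfin; apply: le_measure;
    rewrite ?inE//.
rewrite -(fineK fI) -EFinM lee_fin => h.
apply: (@le_trans _ _ (4 * X / (gam * c))).
  by rewrite ler_pdivlMr//; nra.
by rewrite lerDl divr_ge0 ?mulr_ge0// ltW.
Qed.

End cube_estimate.

(** An infinite upper limit makes the supremum infinite on every right neighbourhood of 0; it is
    used on ]0, min(r0, 1)[ with the threshold 1 / e. *)
Lemma small_radius (R : realType) (d : nat) (r0 : R) (gamma : R -> R) :
  (0 < d)%N -> 0 < r0 -> (forall r, 0 < r < r0 -> 0 < gamma r < 1) ->
  limf_esup (fun r : R => (r `^ (- (2 * (d%:R - 2) / d%:R)) * gamma r)%:E) 0^'+
    = +oo%E ->
  forall e : R, 0 < e -> exists r, [/\ 0 < r, r < r0, r < 1 & r ^+ 2 <= e *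
    gamma r].
Proof.
move=> d0 r00 hgamma hsup e e0.
pose A := `]0, Num.min r0 1[%classic : set R.
set f := (fun r : R => _) in hsup.
have FA : (0 : R)^'+ A.
  have m0 : 0 < Num.min r0 1 by rewrite lt_min r00 ltr01.
  by near=> r; rewrite /A/= in_itv/=; apply/andP; split.
have supA : ereal_sup (f @` A) = +oo%E.
  apply/eqP; rewrite -leye_eq -hsup; apply: ereal_inf_lbound; exists A => //.
have [_ [r Ar <-]] : exists2 z, (f @` A) z & (e^-1%:E < z)%E.
  by apply/ereal_sup_gt; rewrite supA ltry.
move: Ar; rewrite /A/= in_itv/= lt_min => /andP[r_gt0 /andP[rr0 r1]].
rewrite /f lte_fin => fr; exists r; split => //.
have /andP[gam0 _] : 0 < gamma r < 1 by apply: hgamma; rewrite r_gt0.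
(* The exponent 2(d-2)/d is at most 2, and r < 1 gives the comparison of powers its direction. *)
have le2 : r `^ (- (2 * (d%:R - 2) / d%:R)) <= r ^- 2.
  rewrite -powR_mulrn ?(ltW r_gt0)// -powRN.
  apply: ger_powR; first by rewrite r_gt0 ltW.
  rewrite lerN2 ler_pdivrMr ?ltr0n//.
  by have : 0 <= d%:R :> R by []; lra.
have := lt_le_trans fr (ler_wpM2r (ltW gam0) le2).
by rewrite ltr_pdivlMl ?exprn_gt0// ltr_pdivrMr// => /ltW; rewrite mulrC.
Unshelve. all: by end_near. Qed.

(** * The tiling of the space by half-open cubes *)

Section tiling.
Variables (R : realType) (d : nat) (r : R).
Hypothesis r0 : 0 < r.
Local Notation mes := (lebesgue_rV R d).

Definition tile_index (x : 'rV[R]_d) : 'rV[int]_d :=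
  \row_i Num.floor (x ord0 i / (8 * r)).

(** The offset 4 r makes the tile around this centre the product of the intervals [8 r k_i, 8 r (k_i
    + 1)[. *)
Definition tile_center (k : 'rV[int]_d) : 'rV[R]_d :=
  \row_i (8 * r * (k ord0 i)%:~R + 4 * r).

Lemma tile_indexP x k : tile_index x = k <-> tile r (tile_center k) x.
Proof.
have r80 : 0 < 8 * r by rewrite mulr_gt0.
split => [<- i|xk].
  rewrite !mxE; have /andP[h1 h2] := real_floor_itv (num_real (x ord0 i / (8 *
    r))).
  rewrite ler_pdivlMr// in h1; rewrite ltr_pdivrMr// intrD in h2.
  by apply/andP; split; nra.
apply/rowP => i; rewrite mxE; apply: floor_def; have := xk i;
  rewrite !mxE => /andP[h1 h2].
by rewrite ler_pdivlMr// ltr_pdivrMr// intrD; apply/andP; split; nra.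
Qed.

(** Numbers the tiles by the codes of their indices, for sums over nat; a number that is no code
    gives the empty set. *)
Definition tile_nat (n : nat) : set 'rV[R]_d :=
  [set x | pickle (tile_index x) = n].

Lemma tile_natP n : tile_nat n = set0 \/
  exists2 k, pickle k = n & tile_nat n = tile r (tile_center k).
Proof.
have [[x xn]|nx] := pselect (exists x, tile_nat n x); last first.
  by left; apply/seteqP; split => // x xn; apply: nx; exists x.
right; exists (tile_index x) => //; apply/seteqP; split => y.
  move=> yn; apply/tile_indexP; apply: (@pcan_inj _ _ _ _ (@pickleK _)).
  by rewrite xn yn.
by move=> /tile_indexP yx; rewrite /tile_nat/= yx.
Qed.

Lemma measurable_tile_nat n : measurable (tile_nat n).
Proof.
by have [->|[k _ ->]] := tile_natP n;
  [exact: measurable0|exact: measurable_tile].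
Qed.

Lemma trivIset_tile_nat : trivIset setT tile_nat.
Proof.
apply/trivIsetP => i j _ _ ij; apply/seteqP; split => // x [/= xi xj].
by move: ij; rewrite -xi -xj eqxx.
Qed.

Lemma bigcup_tile_nat : \bigcup_n tile_nat n = setT.
Proof. by apply/seteqP; split => // x _; exists (pickle (tile_index x)). Qed.

Lemma integral_tile_nat (f : 'rV[R]_d -> \bar R) : measurable_fun setT f ->
  (forall x, 0 <= f x)%E ->
  (\int[mes]_x f x = \sum_(n <oo) \int[mes]_(x in tile_nat n) f x)%E.
Proof.
move=> mf f0; rewrite -ge0_integral_bigcup//.
- by rewrite bigcup_tile_nat.
- exact: measurable_tile_nat.
- exact: measurable_funTS.
- exact: trivIset_tile_nat.
Qed.

(** A centre of norm at most Y has all its indices in [-m, m], and n0 is the largest code of such an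
    index. The functions into 'I_(2m+1), shifted by m, enumerate this range. *)
Lemma far_tiles (Y : R) : (0 < d)%N -> exists n0, forall k : 'rV[int]_d, (n0 <
  pickle k)%N ->
  Y < enorm (tile_center k).
Proof.
move=> d0.
have lin1 (q y y' m' K : R) : 0 < q -> - y <= 8 * q * K + 4 * q ->
  8 * q * K + 4 * q <= y -> y' < 8 * q * m' -> - y' <= y -> y <= y' ->
  q * (m' + 1) <= q * K -> False by move=> *; lra.
have lin2 (q y y' m' K : R) : 0 < q -> - y <= 8 * q * K + 4 * q ->
  8 * q * K + 4 * q <= y -> y' < 8 * q * m' -> - y' <= y -> y <= y' ->
  q * (m' + 1) <= q * - K -> False by move=> *; lra.
pose m := (Num.truncn (`|Y| / (8 * r))).+2.
pose n0 := \max_(f : {ffun 'I_d -> 'I_(m + m).+1})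
  pickle (\row_i (Posz (f i) - Posz m)%R : 'rV[int]_d).
exists n0 => k; rewrite ltnNge; apply: contraNlt => kY.
have km i : `|k ord0 i| <= m%:Z.
  rewrite leNgt; apply/negP => mk.
  have := le_trans (coord_le_enorm (tile_center k) i) kY.
  rewrite mxE ler_norml => /andP[h1 h2].
  have hY : `|Y| < 8 * r * m%:R.
    have := truncnS_gt (`|Y| / (8 * r)); rewrite ltr_pdivrMr ?mulr_gt0// => h.
    by apply: (lt_le_trans h);
      rewrite mulrC ler_wpM2l ?mulr_ge0 ?(ltW r0)// ler_nat.
  have hk : m%:R + 1 <= `|(k ord0 i)%:~R| :> R.
    rewrite -intr_norm -[m%:R]/(m%:Z%:~R) -[1]/(1%:~R) -intrD ler_int; lia.
  have [Y1 Y2] : - `|Y| <= Y /\ Y <= `|Y| by split; [rewrite lerNl -normrN;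
    exact: ler_norm|exact: ler_norm].
  have := ler_wpM2l (ltW r0) hk.
  by case: (ger0P _) => _;
    [exact: lin1 r0 h1 h2 hY Y1 Y2|exact: lin2 r0 h1 h2 hY Y1 Y2].
have kf i : (absz (k ord0 i + m%:Z)%R < (m + m).+1)%N.
  have := km i; lia.
pose f := [ffun i => Ordinal (kf i)].
have -> : k = \row_i (Posz (f i) - Posz m).
    apply/rowP => i; rewrite mxE ffunE/=; rewrite (_ : k 0 i = k ord0 i)//.
  by have := km i; move: (k ord0 i) => z; lia.
exact: (leq_bigmax f).
Qed.

End tiling.

(** * The bound on one tile and its sum over all tiles *)

Section tail.
Variables (R : realType) (d : nat).
Hypothesis d0 : (0 < d)%N.
Local Notation mes := (lebesgue_rV R d).
Variables (V : 'rV[R]_d -> R) (G : set 'rV[R]_d).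
Hypotheses (mV : measurable_fun setT V) (aG : admissible_domain G).
Variables (r0 : R) (r00 : 0 < r0) (gamma : R -> R).
Hypotheses (hgamma : forall r, 0 < r < r0 -> 0 < gamma r < 1)
  (hlimsup : limf_esup (fun r : R =>
     (r `^ (- (2 * (d%:R - 2) / d%:R)) * gamma r)%:E) 0^'+ = +oo%E)
  (hJ : forall r : R, 0 < r < r0 ->
     J_functional V G ((1 - gamma r) * fine (mes (scaled_domain G r 0))) y r
       @[y --> enorm_infty R d] --> +oo%E).
Local Notation W := (potential V).

Definition real_energy (u : 'rV[R]_d -> R) (g : 'I_d -> 'rV[R]_d -> R) (D : set
  'rV[R]_d) : \bar R :=
  (\sum_i \int[mes]_(x in D) (g i x ^+ 2)%:E +
    \int[mes]_(x in D) (W x * u x ^+ 2)%:E)%E.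

Lemma real_energy_ge0 u g D : (0 <= real_energy u g D)%E.
Proof.
rewrite adde_ge0//; first by apply: sume_ge0 => i _;
  apply: integral_ge0 => x _; exact: sqr_EFin_ge0.
by apply: integral_ge0 => x _; rewrite lee_fin mulr_ge0 ?potential_ge0 ?sqr_ge0.
Qed.

Definition tile_functional (r : R) (n : nat) (u : 'rV[R]_d -> R) :=
  (\int[mes]_(x in tile_nat r n) u x)%R.

Lemma real_energy_fin u g D : measurable D -> measurable_fun setT u ->
  (forall i, measurable_fun setT (g i)) -> (real_energy u g setT < +oo)%E ->
  exists s p, [/\ 0 <= s, 0 <= p,
    (\sum_i \int[mes]_(x in D) (g i x ^+ 2)%:E)%E = s%:E &
    (\int[mes]_(x in D) (W x * u x ^+ 2)%:E)%E = p%:E].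
Proof.
move=> mD mu mg fin.
have W0 x : (0 <= (W x * u x ^+ 2)%:E)%E.
  by rewrite lee_fin mulr_ge0 ?potential_ge0 ?sqr_ge0.
have mW : measurable_fun setT (fun x => (W x * u x ^+ 2)%:E).
  apply/measurable_EFinP; apply: measurable_funM;
    first exact: measurable_potential.
  exact: measurable_funX.
have g0 D' : (0 <= \sum_i \int[mes]_(x in D') (g i x ^+ 2)%:E)%E.
  by apply: sume_ge0 => i _; apply: integral_ge0 => x _; exact: sqr_EFin_ge0.
have p0 D' : (0 <= \int[mes]_(x in D') (W x * u x ^+ 2)%:E)%E.
  by apply: integral_ge0.
have gfin : (\sum_i \int[mes]_(x in D) (g i x ^+ 2)%:E < +oo)%E.
  apply: le_lt_trans fin; rewrite /real_energy -[leLHS]adde0; apply: leeD => //.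
  apply: lee_sum => i _; apply: ge0_subset_integral => //.
    by apply: measurable_sqr; exact: mg.
  by move=> x _; exact: sqr_EFin_ge0.
have pfin : (\int[mes]_(x in D) (W x * u x ^+ 2)%:E < +oo)%E.
  apply: le_lt_trans fin; rewrite /real_energy -[leLHS]add0e; apply: leeD => //.
  exact: ge0_subset_integral.
exists (fine (\sum_i \int[mes]_(x in D) (g i x ^+ 2)%:E)%E).
exists (fine (\int[mes]_(x in D) (W x * u x ^+ 2)%:E)%E).
by split; rewrite ?fine_ge0 ?fineK// ge0_fin_numE.
Qed.

(** With X the Poincare bound on the variance, the integral of u^2 over a tile is at most 2 X + 2
    m^2 |Q|. On the tiles numbered up to n0 the mean m is kept as the finite rank term; on the
    others it is estimated by [mean_le]. *)
Lemma tile_bounds (e : R) : 0 < e -> exists r n0 M, [/\ 0 < r, 0 <= M &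
  forall u g n, sq_integrable mes u -> (forall i, sq_integrable mes (g i)) ->
    (forall i, weak_deriv i u (g i)) ->
    (real_energy u g setT < +oo)%E ->
    (\int[mes]_(x in tile_nat r n) (u x ^+ 2)%:E <=
      e%:E * real_energy u g (tile_nat r n) +
      (M * (n <= n0)%:R * tile_functional r n u ^+ 2)%:E)%E].
Proof.
move=> e0.
have [c c0 cG] := lebesgue_scaled_domain_ge aG.
(* [C1] r^2 is the Poincare constant for side 8 r, and [kap] bounds the ratio of the measures of a
   tile and of G_r. On a far tile the variance enters with the factor 2 + 8 kap / gamma, which is at
   most (2 + 8 kap) / gamma; hence [e']. *)
pose C1 : R := 2 ^+ d * d%:R * 8 ^+ 2.
pose kap : R := 8 ^+ d / c.
have kap0 : 0 < kap by rewrite divr_gt0// exprn_gt0.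
have C10 : 0 < C1 by rewrite !mulr_gt0 ?exprn_gt0 ?ltr0n.
pose e' := e / (C1 * (2 + 8 * kap)).
have e'0 : 0 < e' by rewrite divr_gt0// mulr_gt0//; lra.
have [r [r_gt0 rr0 r1 rg]] := small_radius d0 r00 hgamma hlimsup e'0.
have r_int : 0 < r < r0 by rewrite r_gt0.
have gam01 := hgamma r_int; have /andP[gam0 gam1] := gam01.
pose cr := fine (mes (scaled_domain G r 0)).
have crE : mes (scaled_domain G r 0) = cr%:E.
  rewrite fineK// ge0_fin_numE//;
    apply: le_lt_trans (scaled_domain_fin 0 r_gt0 aG).
  apply: le_measure; rewrite ?inE//.
  - exact: measurable_scaled_domain.
  - exact: measurable_closure_rV.
  - exact: subset_closure.
have crc : c * r ^+ d <= cr by have := cG r r_gt0; rewrite crE lee_fin.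
have cr0 : 0 < cr by apply: lt_le_trans crc; rewrite mulr_gt0// exprn_gt0.
pose mu0 := (8 * r) ^+ d.
have mu00 : 0 < mu0 by rewrite exprn_gt0// mulr_gt0.
(* Chosen so that the term 4 P / L of [mean_le], multiplied by 2 mu0, is exactly e P. *)
pose L := 8 * mu0 / e.
have L0 : 0 < L by rewrite divr_gt0// mulr_gt0.
have [Y HY] : exists Y, forall y : 'rV[R]_d, Y < enorm y ->
    (L%:E <= J_functional V G ((1 - gamma r) * cr) y r)%E.
  have := hJ r_int => /cvgeyPge /(_ L) [Y _ HY].
  by exists Y => y /HY.
have [n0 Hn0] := far_tiles r_gt0 Y d0.
(* The mean is F / mu0 with F the integral of u over the tile, so 2 m^2 mu0 = (2 / mu0) F^2. *)
exists r, n0, (2 / mu0); split => //; first by rewrite divr_ge0// ltW.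
move=> u g n su sg ug en_fin.
have [mu _] := su.
rewrite /tile_functional.
have [->|[k kn ->]] := tile_natP d r_gt0 n.
  rewrite integral_set0 Rintegral_set0 expr0n mulr0 adde0 mule_ge0
    ?real_energy_ge0//.
  by rewrite lee_fin ltW.
set y := tile_center r k; set Q := tile r y.
have mQ : measurable Q by exact: measurable_tile.
have QE : mes Q = mu0%:E by exact: lebesgue_tile.
have [s [p [s0 p0 sE pE]]] := real_energy_fin mQ mu (fun i => (sg i).1) en_fin.
pose X := C1 * r ^+ 2 * s.
pose m := mean_on Q u.
have varX : (\int[mes]_(x in Q) ((u x - m) ^+ 2)%:E <= X%:E)%E.
  have r8 : 0 < 8 * r by rewrite mulr_gt0.
  apply: le_trans (poincare _ r8 su sg ug) _.
  rewrite sE -EFinM lee_fin le_eqVlt; apply/orP; left; apply/eqP.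
  by rewrite /X /C1; ring.
apply: (le_trans (integral_sqr_le_mean m mQ QE mu)).
rewrite /real_energy sE pE.
apply: (@le_trans _ _ (2 * X + 2 * m ^+ 2 * mu0)%:E).
  rewrite [leRHS]EFinD; apply: leeD => //; rewrite EFinM.
  by apply: lee_pmul => //; apply: integral_ge0 => x _; exact: sqr_EFin_ge0.
rewrite -(EFinD s p) -EFinM -EFinD lee_fin.
have X0 : 0 <= X by rewrite /X mulr_ge0// mulr_ge0 ?sqr_ge0// ltW.
(* Here r^2 <= e' gamma(r) is spent; the factor gamma(r) gained pays for the 1 / gamma(r) of
   Chebyshev's inequality. *)
have Xg : (2 + 8 * kap) * X <= e * gamma r * s.
  have -> : e = e' * (C1 * (2 + 8 * kap)).
    rewrite /e' divfK// mulf_neq0 ?gt_eqF//; lra.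
  rewrite /X.
  rewrite (_ : _ * (C1 * r ^+ 2 * s) = (C1 * (2 + 8 * kap) * s) * r ^+ 2);
    last by ring.
  have -> : e' * (C1 * (2 + 8 * kap)) * gamma r * s = (C1 * (2 + 8 * kap) * s)
    * (e' * gamma r) by ring.
  apply: ler_wpM2l rg; rewrite mulr_ge0// mulr_ge0 ?(ltW C10)//; lra.
have [nn0|nn0] := leqP n n0; last first.
  rewrite mulr0 mul0r addr0.
  have varP : (\int[mes]_(x in Q) (W x * u x ^+ 2)%:E <= p%:E)%E by rewrite pE.
  have kY : Y < enorm y by apply: Hn0; rewrite kn.
  have := mean_le mV aG r_gt0 gam01 L0 cr0 mu crE (HY _ kY) varX varP.
  have Lm : 4 * p / L * (2 * mu0) = e * p.
    rewrite /L invf_div mulrA; field; rewrite ?gt_eqF//.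
  have km : mu0 / cr <= kap.
    rewrite ler_pdivrMr// /kap mulrAC ler_pdivlMr// /mu0 exprMn -mulrA (mulrC _
      c).
    by rewrite ler_pM2l// exprn_gt0.
  have XX : 4 * X / (gamma r * cr) * (2 * mu0) <= 8 * kap * (X / gamma r).
    have -> : 4 * X / (gamma r * cr) * (2 * mu0) = 8 * (mu0 / cr) * (X / gamma
      r).
      by field; rewrite ?gt_eqF.
    apply: ler_wpM2r; first by rewrite divr_ge0// ltW.
    by rewrite ler_pM2l.
  move=> hm.
  have XG : 2 * X + 8 * kap * (X / gamma r) <= e * s.
    have h1 : X <= X / gamma r by rewrite ler_pdivlMr// ler_piMr// ltW.
    have h2 : (2 + 8 * kap) * (X / gamma r) <= e * s.
      by rewrite mulrA ler_pdivrMr// mulrAC.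
    apply: le_trans h2; rewrite (mulrDl 2 (8 * kap)).
    by apply: lerD => //; apply: ler_wpM2l.
  have hm2 := ler_wpM2r (_ : 0 <= 2 * mu0) hm.
  have {}hm2 := hm2 (ltW (mulr_gt0 (ltr0Sn _ 1) mu00)).
  rewrite (mulrDl (4 * X / (gamma r * cr))) Lm in hm2.
  have -> : 2 * m ^+ 2 * mu0 = m ^+ 2 * (2 * mu0) by ring.
  rewrite (mulrDr e s p); move: hm2 XX XG.
  move: (m ^+ 2 * (2 * mu0)) (4 * X / (gamma r * cr) * (2 * mu0)) (e * p) (e *
    s) (8 * kap * (X / gamma r)) (2 * X) => *; lra.
rewrite mulr1; set F := Rintegral _ _ _.
have -> : m = F / mu0 by rewrite /m /mean_on QE.
have -> : 2 * (F / mu0) ^+ 2 * mu0 = 2 / mu0 * F ^+ 2.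
  by field; rewrite gt_eqF.
rewrite lerD2r.
have : 2 * X <= (2 + 8 * kap) * X by rewrite ler_wpM2r//; lra.
have : e * gamma r * s <= e * s.
  by rewrite ler_wpM2r// ler_piMr ?ltW.
have : 0 <= e * p by rewrite mulr_ge0// ltW.
rewrite (mulrDr e s p); move: Xg;
  move: ((2 + 8 * kap) * X) (e * gamma r * s) (e * p) (e * s) (2 * X) => *; lra.
Qed.

(** Both integrals and the energy are countably additive over the tiles, while the correction terms
    vanish beyond n0; r, n0 and M are the same for all tiles. *)
Lemma tail_bound (e : R) : 0 < e -> exists r n0 M, [/\ 0 < r, 0 <= M &
  forall u g, sq_integrable mes u -> (forall i, sq_integrable mes (g i)) ->
    (forall i, weak_deriv i u (g i)) ->
    (real_energy u g setT < +oo)%E ->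
    (\int[mes]_x (u x ^+ 2)%:E <= e%:E * real_energy u g setT +
      (M * \sum_(n < n0.+1) tile_functional r n u ^+ 2)%:E)%E].
Proof.
move=> e0; have [r [n0 [M [r_gt0 M0 tb]]]] := tile_bounds e0.
exists r, n0, M; split => // u g su sg ug fin.
have [mu _] := su.
have W0 x : (0 <= (W x * u x ^+ 2)%:E)%E.
  by rewrite lee_fin mulr_ge0 ?potential_ge0 ?sqr_ge0.
have mW : measurable_fun setT (fun x => (W x * u x ^+ 2)%:E).
  apply/measurable_EFinP; apply: measurable_funM;
    first exact: measurable_potential.
  exact: measurable_funX.
have g0 n i : (0 <= \int[mes]_(x in tile_nat r n) (g i x ^+ 2)%:E)%E.
  by apply: integral_ge0 => x _; exact: sqr_EFin_ge0.
have p0 n : (0 <= \int[mes]_(x in tile_nat r n) (W x * u x ^+ 2)%:E)%E.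
  by apply: integral_ge0.
have energyE : (real_energy u g setT = \sum_(n <oo) real_energy u g (tile_nat r
  n))%E.
  rewrite /real_energy nneseriesD//; last by move=> n _ _; apply: sume_ge0.
  rewrite nneseries_sum//; congr (_ + _)%E.
    apply: eq_bigr => i _; rewrite -integral_tile_nat//.
      by apply: measurable_sqr; exact: (sg i).1.
    by move=> x; exact: sqr_EFin_ge0.
  by rewrite -integral_tile_nat.
have F0 n : 0 <= M * (n <= n0)%N%:R * tile_functional r n u ^+ 2.
  by rewrite mulr_ge0 ?sqr_ge0// mulr_ge0.
rewrite (integral_tile_nat (r:=r))//; last 2 first.
- exact: measurable_sqr.
- by move=> x; exact: sqr_EFin_ge0.
apply: (@le_trans _ _ (\sum_(n <oo) (e%:E * real_energy u g (tile_nat r n) +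
      (M * (n <= n0)%N%:R * tile_functional r n u ^+ 2)%:E)))%E.
  apply: lee_nneseries => n _; last exact: tb.
  by move=> _; apply: integral_ge0 => x _; exact: sqr_EFin_ge0.
rewrite nneseriesD//; last 2 first.
- by move=> n _ _; rewrite mule_ge0 ?real_energy_ge0// lee_fin ltW.
- by move=> n _ _; rewrite lee_fin.
rewrite nneseriesZl//; last by move=> n _; exact: real_energy_ge0.
rewrite -energyE; apply: leeD => //.
rewrite (nneseries_split 0 n0.+1)//; last by move=> n _; rewrite lee_fin.
rewrite add0n eseries0 ?adde0; last first.
  by move=> n nn0 _; rewrite leqNgt nn0/= mulr0 mul0r.
rewrite big_mkord sumEFin lee_fin mulr_sumr le_eqVlt; apply/orP; left.
by apply/eqP/eq_bigr => n _; rewrite -ltnS ltn_ord mulr1.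
Qed.

End tail.

(** * Completeness of weighted L2 spaces *)

Section weighted_completeness.
Context dsp (T : measurableType dsp) (R : realType).
Variable mu : {measure set T -> \bar R}.
Variables (w : T -> R) (f : nat -> T -> R).
Hypotheses (mw : measurable_fun setT w) (w1 : forall x, 1 <= w x).
Hypothesis mf : forall n, measurable_fun setT (f n).
Hypothesis fC : forall e : R, 0 < e -> exists N, forall m n, (N <= m)%N -> (N
  <= n)%N ->
  (\int[mu]_x (w x * (f m x - f n x) ^+ 2)%:E <= e%:E)%E.

Let w_sqr_ge0 (x : T) (a : R) : (0 <= (w x * a ^+ 2)%:E)%E.
Proof. by rewrite lee_fin mulr_ge0 ?sqr_ge0// (le_trans ler01). Qed.

Let measurable_w_sqr (g : T -> R) : measurable_fun setT g ->
  measurable_fun setT (fun x => (w x * g x ^+ 2)%:E).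
Proof.
by move=> mg; apply/measurable_EFinP; apply: measurable_funM => //;
  exact: measurable_funX.
Qed.

(* Almost everywhere [\sum_j 4^j (h j)^2] is finite, so [h j] is [O(2^-j)]. *)
Lemma ae_summable_cvg (h : nat -> T -> R) :
  (forall j, measurable_fun setT (h j)) ->
  (forall j, (\int[mu]_x (w x * h j x ^+ 2)%:E <= (8^-1 ^+ j)%:E)%E) ->
  {ae mu, forall x, cvgn (series (h ^~ x))}.
Proof.
move=> mh hh.
pose F (x : T) : \bar R := (\sum_(j <oo) (4 ^+ j * (w x * h j x ^+ 2))%:E)%E.
have F0 j x : (0 <= (4 ^+ j * (w x * h j x ^+ 2))%:E)%E.
  by rewrite lee_fin mulr_ge0 ?exprn_ge0// -lee_fin.
have mF j : measurable_fun setT (fun x => (4 ^+ j * (w x * h j x ^+ 2))%:E).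
  have := measurable_w_sqr (mh j) => /measurable_EFinP m.
  by apply/measurable_EFinP; exact: measurable_funM.
have intF : (\int[mu]_x F x < +oo)%E.
  rewrite /F integral_nneseries//.
  apply: (@le_lt_trans _ _ (\sum_(j <oo) (2^-1 ^+ j)%:E)%E).
    apply: lee_nneseries => j _; first by move=> _; exact: integral_ge0.
    under eq_integral do rewrite EFinM.
    rewrite ge0_integralZl//; last exact: measurable_w_sqr.
    apply: (@le_trans _ _ ((4 ^+ j)%:E * (8^-1 ^+ j)%:E)%E).
      by apply: lee_pmul => //; exact: integral_ge0.
    rewrite -EFinM lee_fin -exprMn le_eqVlt; apply/orP; left; apply/eqP.
    by congr (_ ^+ _); field.
  rewrite (_ : (\sum_(_ <oo) _)%E = (2 : R)%:E) ?ltry//.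
  apply: cvg_lim => //.
  rewrite (_ : (fun n => _) = EFin \o series (geometric (1 : R) 2^-1));
    last first.
    apply/funext => n /=; rewrite sumEFin; congr EFin.
    by apply: eq_bigr => i _; rewrite /geometric/= mul1r.
  apply: cvg_EFin; first exact: nearW.
  have := @cvg_geometric_series R 1 2^-1.
  rewrite (_ : 1 * (1 - 2^-1)^-1 = 2 :> R); last by field.
  by apply; rewrite gtr0_norm// invf_lt1// ltr1n.
have iF : mu.-integrable setT F.
  apply/integrableP; split; first exact: ge0_emeasurable_sum.
  rewrite (_ : (fun x => _) = F)//; apply/funext => x; rewrite gee0_abs//.
  by apply: nneseries_ge0.
have := integrable_ae measurableT iF; apply: filterS => x /(_ I) Fx.
pose K := fine (F x).
have hK j : h j x ^+ 2 <= K * (4^-1 ^+ j).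
  have : ((4 ^+ j * (w x * h j x ^+ 2))%:E <= F x)%E.
    apply: le_trans (nneseries_lim_ge j.+1 _) => //.
    by rewrite big_mkord big_ord_recr/= leeDr// sume_ge0.
  rewrite -(fineK Fx) lee_fin exprVn ler_pdivlMr ?exprn_gt0// => H.
  apply: le_trans H; rewrite mulrC; apply: ler_wpM2l;
    first by rewrite exprn_ge0.
  by rewrite ler_peMl ?sqr_ge0.
have K0 : 0 <= K by have := hK 0; rewrite expr0 mulr1; apply: le_trans;
  exact: sqr_ge0.
apply: (@normed_cvg R R).
apply: (@series_le_cvg R _ (geometric (Num.sqrt K) 2^-1)) => //.
- by move=> n /=.
- by move=> n; rewrite /geometric/= mulr_ge0 ?sqrtr_ge0// exprn_ge0.
- move=> n; rewrite /geometric/= -sqrtr_sqr.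
  have -> : 2^-1 ^+ n = Num.sqrt (4^-1 ^+ n) :> R.
    rewrite -[LHS]ger0_norm ?exprn_ge0// -sqrtr_sqr -exprM mulnC exprM;
      congr (Num.sqrt (_ ^+ _)).
    by field.
  by rewrite -sqrtrM// ler_wsqrtr.
- by apply: is_cvg_geometric_series; rewrite gtr0_norm// invf_lt1// ltr1n.
Qed.

(** Along a subsequence whose increments have weighted square norm at most 8^-j the functions
    converge almost everywhere, and Fatou's lemma transfers the Cauchy estimate to the limit. The
    weight allows one limit to serve the L2 norm and the potential term together. *)
Lemma weighted_sqr_complete : exists2 g : T -> R, measurable_fun setT g &
  forall e : R, 0 < e -> exists N, forall n, (N <= n)%N ->
    (\int[mu]_x (w x * (f n x - g x) ^+ 2)%:E <= e%:E)%E.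
Proof.
have e8 j : 0 < (8^-1 : R) ^+ j by rewrite exprn_gt0.
have [N NP] := choice (fun j => fC (e8 j)).
(* Summing the thresholds makes [phi] increasing with phi(j) >= N(j) and phi(j) >= j. *)
pose phi j := (\sum_(i < j.+1) (N i).+1)%N.
have phiS j : phi j.+1 = (phi j + (N j.+1).+1)%N by rewrite /phi big_ord_recr.
have phiN j : (N j <= phi j)%N.
  by rewrite /phi big_ord_recr/=; apply: leq_trans (leq_addl _ _);
    exact: leqnSn.
have phij j : (j <= phi j)%N.
  elim: j => // j ih; rewrite phiS;
    apply: leq_trans (leq_add ih (ltn0Sn _)) => //.
  by rewrite addn1.
pose h j x := f (phi j.+1) x - f (phi j) x.
have hcvg : {ae mu, forall x, cvgn (series (h ^~ x))}.
  apply: ae_summable_cvg; first by move=> j; exact: measurable_funB.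
  move=> j; apply: NP => //; apply: leq_trans (phiN j) _.
  by rewrite phiS leq_addr.
(* The upper limit exists everywhere and is measurable, while the limit exists only almost
   everywhere. *)
pose g x := fine (limn_esup (fun j => (f (phi j) x)%:E)).
have mg : measurable_fun setT g.
  apply: (measurableT_comp (f := fine)) => //.
  apply: measurable_fun_limn_esup => j; apply/measurable_EFinP; exact: mf.
exists g => // e e0; have [M MP] := fC e0; exists M => n Mn.
have gP : {ae mu, forall x, (w x * (f n x - g x) ^+ 2)%:E =
    limn_einf (fun j => (w x * (f n x - f (phi j) x) ^+ 2)%:E)}.
  apply: filterS hcvg => x /cvg_ex[l hl].
  have fl : f (phi j) x @[j --> \oo] --> l + f (phi 0) x.
    rewrite (_ : (fun j => _) = (fun j => series (h ^~ x) j + f (phi 0) x)).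
      by apply: cvgD => //; exact: cvg_cst.
    by apply/funext => j; rewrite /series/= /h telescope_sumr// subrK.
  have gE : g x = l + f (phi 0) x.
    rewrite /g (cvg_limn_einf_sup (l := (l + f (phi 0) x)%:E))//.
    by apply: cvg_EFin => //; exact: nearW.
  have cv : (w x * (f n x - f (phi j) x) ^+ 2)%:E @[j --> \oo] -->
      (w x * (f n x - g x) ^+ 2)%:E.
    apply: cvg_EFin; first exact: nearW.
    rewrite gE; apply: cvgM; first exact: cvg_cst.
    by rewrite expr2; under eq_fun do rewrite expr2; apply: cvgM;
      (apply: cvgB => //; exact: cvg_cst).
  by have [-> _] := cvg_limn_einf_sup cv.
have mlim : measurable_fun setT (fun x => limn_einf (fun j => (w x * (f n x - f
  (phi j) x) ^+ 2)%:E)).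
  have -> : (fun x => limn_einf (fun j => (w x * (f n x - f (phi j) x) ^+
    2)%:E)) =
    (fun x => - limn_esup (fun j => - (w x * (f n x - f (phi j) x) ^+ 2)%:E))%E.
    by apply/funext => x; rewrite /limn_einf.
  apply: measurableT_comp => //; apply: measurable_fun_limn_esup => j.
  by apply: measurableT_comp => //; apply: measurable_w_sqr;
    exact: measurable_funB.
have lim0 (u : nat -> \bar R) : (forall j, 0 <= u j)%E -> (0 <= limn_einf u)%E.
  move=> u0; rewrite limn_einf_lim; apply: lime_ge; first exact: is_cvg_einfs.
  by apply: nearW => j; apply: le_ereal_inf_tmp => _ [k _ <-].
rewrite (ge0_ae_eq_integral measurableT _ mlim _ _ (filterS _ gP))//;
  last 2 first.
- by apply: measurable_w_sqr; exact: measurable_funB.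
- by move=> x _; exact: lim0.
apply: le_trans (fatou mu measurableT _ _) _ => //.
  by move=> j; apply: measurable_w_sqr; exact: measurable_funB.
rewrite limn_einf_lim; apply: lime_le; first exact: is_cvg_einfs.
(* The infimum over indices k >= j is at most the term at max(j, M), which lies in the range of the
   Cauchy estimate. *)
apply: nearW => j; apply: (@le_trans _ _ (\int[mu]_x (w x * (f n x - f (phi
  (maxn j M)) x) ^+ 2)%:E)%E).
  by apply: ereal_inf_lbound; exists (maxn j M) => //=; exact: leq_maxl.
by apply: MP => //; apply: leq_trans (phij _); exact: leq_maxr.
Qed.

End weighted_completeness.

(** * The real Dirichlet form *)

Section double.
Variables (R : realType) (E : lmodType R).
Local Notation EE := ((E * E)%type : lmodType R).

Definition double_set (S : set E) : set EE := [set p | S p.1 /\ S p.2].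

(** For the pairs (Re u, Im u) this is the real part of the sesquilinear form built from [b]. *)
Definition double_form (b : E -> E -> R) (p q : EE) := b p.1 q.1 + b p.2 q.2.

Variables (S : set E) (b : E -> E -> R).
Hypotheses (SS : subspace S) (Sb : nonneg_form S b).

Lemma subspace_double : subspace (double_set S).
Proof.
split; first by split; exact: subspace0.
- by move=> u v [? ?] [? ?]; split; exact: subspaceD.
- by move=> a u [? ?]; split; exact: subspaceZ.
Qed.

Lemma nonneg_form_double : nonneg_form (double_set S) (double_form b).
Proof.
split.
- move=> u v w [u1 u2] [v1 v2] [w1 w2].
  by rewrite /double_form/= !(formDl Sb)// addrACA.
- by move=> a u w [u1 u2] [w1 w2]; rewrite /double_form/= !(formZl Sb)// mulrDr.
- by move=> u v [u1 u2] [v1 v2]; congr (_ + _); exact: (formC Sb).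
- by move=> u [u1 u2]; rewrite addr_ge0//; exact: (form_ge0 Sb).
Qed.

Lemma form_complete_double : form_complete S (fun u => b u u) ->
  form_complete (double_set S) (fun u => double_form b u u).
Proof.
move=> Sc u Su uC.
have [w1 Sw1 w1P] : exists2 w, S w & form_cvg (fun u => b u u) (fun n => (u
  n).1) w.
  apply: Sc => [n|e e0]; first by have [] := Su n.
  have [N NP] := uC e e0; exists N => m n mN nN.
  apply: le_trans (NP _ _ mN nN); rewrite lerDl; apply: (form_ge0 Sb).
  by have [_ ?] := Su m; have [_ ?] := Su n; exact: subspaceB.
have [w2 Sw2 w2P] : exists2 w, S w & form_cvg (fun u => b u u) (fun n => (u
  n).2) w.
  apply: Sc => [n|e e0]; first by have [] := Su n.
  have [N NP] := uC e e0; exists N => m n mN nN.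
  apply: le_trans (NP _ _ mN nN); rewrite lerDr; apply: (form_ge0 Sb).
  by have [? _] := Su m; have [? _] := Su n; exact: subspaceB.
exists (w1, w2) => // e e0.
have e20 : 0 < e / 2 by rewrite divr_gt0.
have [N1 N1P] := w1P _ e20; have [N2 N2P] := w2P _ e20.
exists (maxn N1 N2) => n; rewrite geq_max => /andP[n1 n2].
rewrite (splitr e); apply: lerD; [exact: N1P|exact: N2P].
Qed.

End double.

(** Each g_j is placed once in either component, which doubles the rank but keeps eps and M. *)
Lemma finite_rank_bound_double (R : realType) (E : lmodType R) (H D : set E)
    (ip h : E -> E -> R) (eps : R) N (g : 'I_N -> E) (M : R) :
  subspace H -> nonneg_form H ip -> D `<=` H -> (forall j, H (g j)) ->
  finite_rank_bound D ip h eps g M ->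
  exists2 g' : 'I_(N + N) -> E * E, forall j, double_set H (g' j) &
    finite_rank_bound (double_set D) (double_form ip) (double_form h) eps g' M.
Proof.
move=> HS Hip DH Hg gP.
exists (fun j => match fintype.split j with inl i => (g i, 0) | inr i => (0, g
  i) end).
  by move=> j; case: fintype.split => i; split => //=; exact: subspace0.
move=> u [u1 u2]; rewrite big_split_ord/=.
have ip0 v : D v -> ip v 0 = 0.
  by move=> /DH Hv; rewrite (formC Hip)// ?(form0l HS Hip)//; exact: subspace0.
rewrite (eq_bigr (fun i => ip u.1 (g i) ^+ 2)); last first.
  move=> i _; rewrite /double_form (_ : fintype.split _ = inl i) /= ?ip0
    ?addr0//.
  exact: (unsplitK (inl i)).
rewrite [X in _ + _ * (_ + X)](eq_bigr (fun i => ip u.2 (g i) ^+ 2));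
  last first.
  move=> i _; rewrite /double_form (_ : fintype.split _ = inr i) /= ?ip0
    ?add0r//.
  exact: (unsplitK (inr i)).
by rewrite /double_form !mulrDr addrACA; apply: lerD; exact: gP.
Qed.

Section forms.
Variables (R : realType).

Lemma nonneg_formD (E : lmodType R) (S : set E) (b c : E -> E -> R) :
  nonneg_form S b -> nonneg_form S c -> nonneg_form S (fun u v => b u v + c u
    v).
Proof.
move=> Sb Sc; split.
- by move=> u v w *; rewrite (formDl Sb)// (formDl Sc)// addrACA.
- by move=> a u w *; rewrite (formZl Sb)// (formZl Sc)// mulrDr.
- by move=> u v *; rewrite (formC Sb)// (formC Sc).
- by move=> u *; rewrite addr_ge0// ?(form_ge0 Sb)// (form_ge0 Sc).
Qed.

Lemma nonneg_form_sum (E : lmodType R) (S : set E) (I : Type) (r : seq I)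
    (b : I -> E -> E -> R) :
  (forall i, nonneg_form S (b i)) -> nonneg_form S (fun u v => \sum_(i <- r) b
    i u v).
Proof.
move=> Sb; split.
- by move=> u v w *; rewrite -big_split/=; apply: eq_bigr => i _;
  rewrite (formDl (Sb i)).
- by move=> a u w *; rewrite mulr_sumr; apply: eq_bigr => i _;
  rewrite (formZl (Sb i)).
- by move=> u v *; apply: eq_bigr => i _; rewrite (formC (Sb i)).
- by move=> u *; apply: sumr_ge0 => i _; rewrite (form_ge0 (Sb i)).
Qed.

End forms.

Section L2_form.
Context dsp (T : measurableType dsp) (R : realType).
Variable mu : {measure set T -> \bar R}.
Local Notation E := ((T -> R^o)%type : lmodType R).
Implicit Types f g k : T -> R.

Definition L2_form (f g : T -> R) := (\int[mu]_x (f x * g x))%R.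

Lemma subspace_sq_integrable : subspace (sq_integrable mu : set E).
Proof.
split; last 2 first.
- by move=> u v; exact: sq_integrableD.
- by move=> a u; exact: sq_integrableZ.
split; first exact: measurable_cst.
by rewrite integral0_eq// => x _; rewrite expr0n.
Qed.

Lemma nonneg_form_L2 : nonneg_form (sq_integrable mu : set E) L2_form.
Proof.
split.
- move=> u v w su sv sw; rewrite /L2_form -RintegralD//; last 2 first.
  + exact: sq_integrableM.
  + exact: sq_integrableM.
  by apply: eq_Rintegral => x _; rewrite mulrDl.
- move=> a u w su sw; rewrite /L2_form -RintegralZl//;
  last exact: sq_integrableM.
  by apply: eq_Rintegral => x _; rewrite mulrA.
- by move=> u v _ _; apply: eq_Rintegral => x _; rewrite mulrC.
- by move=> u _; apply: Rintegral_ge0 => x _; rewrite -expr2 sqr_ge0.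
Qed.

Lemma L2_formE f : sq_integrable mu f ->
  (\int[mu]_x (f x ^+ 2)%:E = (L2_form f f)%:E)%E.
Proof.
move=> sf; rewrite /L2_form /Rintegral fineK;
  last exact/(integrable_fin_num measurableT)/sq_integrableM.
by apply: eq_integral => x _; rewrite expr2.
Qed.

Lemma L2_form_ae f g k : sq_integrable mu f -> sq_integrable mu g ->
  sq_integrable mu k -> {ae mu, forall x, f x = g x} -> L2_form f k = L2_form g
    k.
Proof.
move=> sf sg sk fg; rewrite /L2_form /Rintegral; congr fine.
apply: ae_eq_integral => //.
- by have /measurable_int := sq_integrableM sf sk.
- by have /measurable_int := sq_integrableM sg sk.
- by apply: filterS fg => x ->.
Qed.

Lemma L2_form_eq0 f : sq_integrable mu f -> L2_form f f = 0 ->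
  {ae mu, forall x, f x = 0}.
Proof.
move=> sf f0; have [mf _] := sf.
have : (\int[mu]_x `|(f x ^+ 2)%:E| = 0)%E.
  rewrite -[RHS]/(0%:E) -f0 -L2_formE//; apply: eq_integral => x _.
  by rewrite gee0_abs// sqr_EFin_ge0.
move=> /ae_eq_integral_abs => /(_ measurableT (measurable_sqr mf)).
by apply: filterS => x /(_ I) [] /eqP; rewrite sqrf_eq0 => /eqP.
Qed.

Lemma ae_eq0_L2_form f : sq_integrable mu f -> {ae mu, forall x, f x = 0} ->
  L2_form f f = 0.
Proof.
move=> sf f0; have s0 : sq_integrable mu (0 : E) := subspace0
  subspace_sq_integrable.
by rewrite (L2_form_ae sf s0 sf)// (form0l subspace_sq_integrable
  nonneg_form_L2).
Qed.

End L2_form.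

Lemma test_function_sq_integrable (R : realType) d (phi : 'rV[R]_d -> R) :
  test_function phi -> sq_integrable (lebesgue_rV R d) phi.
Proof.
move=> [sphi cphi]; have [cont _] := sphi [::].
have [M phiM] : exists M, forall x i, phi x != 0 -> `|x ord0 i| < M.
  have /compact_bounded[M [_ MP]] := cphi.
  (* Compactness gives a non-strict bound by M + 1, and the open box below asks for a strict one. *)
  exists (M + 2) => x i phix; apply: le_lt_trans (_ : M + 1 < M + 2);
    last by rewrite ltrD2l ltr1n.
  apply: le_trans (MP (M + 1) _ x _); last 2 first.
  - by rewrite ltrDl.
  - exact: subset_closure.
  rewrite [leRHS]mx_normrE;
    exact: (le_bigmax _ (fun ij => `|x ij.1 ij.2|) (ord0, i)).
have [K phiK] : exists K, forall x, `|phi x| <= K.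
  have /compact_bounded[K [_ KP]] : compact (phi @` closure [set x | phi x !=
    0]).
    apply: continuous_compact => //; apply: continuous_subspaceT; exact: cont.
  have K0 : 0 <= `|K| + 1 by rewrite addr_ge0.
  exists (`|K| + 1) => x; have [->|px] := eqVneq (phi x) 0;
    first by rewrite normr0.
  apply: (KP (`|K| + 1)); first by rewrite (le_lt_trans (ler_norm _))// ltrDl.
  by exists x => //; exact: subset_closure.
apply: (@sq_integrable_bounded_support _ _ _ (const_mx (- M)) (const_mx M) K)
  => //.
  exact: continuous_measurable_rV.
move=> x; apply: contra_notP => /eqP px i; rewrite !mxE -ltr_norml.
exact: phiM.
Qed.

Lemma test_function_partial (R : realType) d (phi : 'rV[R]_d -> R) i :
  test_function phi -> test_function (partial i phi).
Proof.
move=> [sphi cphi]; split.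
  by move=> s; have := sphi (rcons s i); rewrite foldr_rcons.
apply: (subclosed_compact _ cphi); first exact: closed_closure.
have cl := (closure_id (closure [set x | phi x != 0])).1 (@closed_closure _ _).
rewrite [X in _ `<=` X]cl; apply: closure_subset => x /= dx;
  apply: contrapT => xphi.
move/eqP: dx; apply.
have opn : open (~` closure [set x | phi x != 0]) by apply: closed_openC;
  exact: closed_closure.
have ev : \near x, phi x = cst 0 x.
  have := open_nbhs_nbhs (conj opn xphi); apply: filterS => y ny.
  by apply/eqP/negPn/negP => py; apply: ny; exact: subset_closure.
by rewrite /partial (near_eq_derive _ ev) derive_cst.
Qed.

(** * Linearity, uniqueness and closedness of weak derivatives *)

Section weak_derivatives.
Variables (R : realType) (d : nat).
Local Notation mes := (lebesgue_rV R d).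
Local Notation L2 := (sq_integrable mes).
Local Notation E := (('rV[R]_d -> R^o)%type : lmodType R).
Local Notation ip := (L2_form mes).
Implicit Types (u g f : 'rV[R]_d -> R) (i : 'I_d).

Let HS : subspace (L2 : set E) := subspace_sq_integrable mes.
Let Hip : nonneg_form (L2 : set E) ip := nonneg_form_L2 mes.

Lemma weak_derivP i u g : weak_deriv i u g <->
  forall phi, test_function phi -> ip u (partial i phi) = - ip g phi.
Proof. by []. Qed.

Lemma weak_derivD i u v g k : L2 u -> L2 v -> L2 g -> L2 k ->
  weak_deriv i u g -> weak_deriv i v k ->
  weak_deriv i (fun x => u x + v x) (fun x => g x + k x).
Proof.
move=> su sv sg sk ug vk; apply/weak_derivP => phi tphi.
have sphi := test_function_sq_integrable tphi.
have sdphi := test_function_sq_integrable (test_function_partial i tphi).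
rewrite (formDl Hip (u := u) (v := v))// (formDl Hip (u := g) (v := k))//.
by rewrite opprD; congr (_ + _); [exact: ug|exact: vk].
Qed.

Lemma weak_derivZ i (a : R) u g : L2 u -> L2 g -> weak_deriv i u g ->
  weak_deriv i (fun x => a * u x) (fun x => a * g x).
Proof.
move=> su sg ug; apply/weak_derivP => phi tphi.
have sphi := test_function_sq_integrable tphi.
have sdphi := test_function_sq_integrable (test_function_partial i tphi).
rewrite (formZl Hip a (u := u))// (formZl Hip a (u := g))//.
by rewrite -mulrN; congr (_ * _); exact: ug.
Qed.

Lemma weak_derivB i u v g k : L2 u -> L2 v -> L2 g -> L2 k ->
  weak_deriv i u g -> weak_deriv i v k ->
  weak_deriv i (fun x => u x - v x) (fun x => g x - k x).
Proof.
move=> su sv sg sk ug vk.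
have := weak_derivD su (sq_integrableZ (- 1) sv) sg (sq_integrableZ (- 1) sk) ug
  (weak_derivZ (- 1) sv sk vk).
by under eq_fun do rewrite mulN1r;
  under [X in weak_deriv _ _ X]eq_fun do rewrite mulN1r.
Qed.

(** Tested against box bumps g integrates to 0, so the fundamental lemma applies; by linearity this
    is uniqueness of weak derivatives. *)
Lemma weak_deriv0_ae i u g : L2 g -> {ae mes, forall x, u x = 0} -> L2 u ->
  weak_deriv i u g -> {ae mes, forall x, g x = 0}.
Proof.
move=> sg u0 su ug; apply: fundamental_lemma; first exact: sg.1.
- move=> a b; apply: sq_integrable_integrable => //.
  + exact: measurable_obox.
  + exact: lebesgue_obox_fin.
- move=> a b n; have tb := box_bump_test a b n.
  have := ug _ tb; move/eqP; rewrite eq_sym eqr_oppLR => /eqP ->.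
  rewrite -[LHS]/(- ip u _).
  rewrite (form_null HS Hip su _ (ae_eq0_L2_form su u0)) ?oppr0//.
  exact/test_function_sq_integrable/test_function_partial.
Qed.

Lemma weak_deriv_unique i u v g k : L2 u -> L2 v -> L2 g -> L2 k ->
  {ae mes, forall x, u x = v x} ->
  weak_deriv i u g -> weak_deriv i v k -> {ae mes, forall x, g x = k x}.
Proof.
move=> su sv sg sk uv ug vk.
have : {ae mes, forall x, g x - k x = 0}.
  apply: weak_deriv0_ae (weak_derivB su sv sg sk ug vk);
    try exact: sq_integrableB.
  by apply: filterS uv => x ->; rewrite subrr.
by apply: filterS => x /eqP; rewrite subr_eq0 => /eqP.
Qed.

(** The defect [A] of the limit pair involves only the differences u_n - u' and g_n - g', because
    the pairs (u_n, g_n) have none. Cauchy-Schwarz bounds A^2 by 2 e C for every e > 0. *)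
Lemma weak_deriv_limit i (u g : nat -> E) (u' g' : E) :
  (forall n, L2 (u n)) -> (forall n, L2 (g n)) -> L2 u' -> L2 g' ->
  (forall n, weak_deriv i (u n) (g n)) ->
  form_cvg (fun f => ip f f) u u' -> form_cvg (fun f => ip f f) g g' ->
  weak_deriv i u' g'.
Proof.
move=> su sg su' sg' ug uu' gg'; apply/weak_derivP => phi tphi.
have sphi := test_function_sq_integrable tphi.
have sdphi := test_function_sq_integrable (test_function_partial i tphi).
set psi := partial i phi in sdphi *.
pose A := ip u' psi + ip g' phi; pose C := ip psi psi + ip phi phi.
have C0 : 0 <= C by rewrite addr_ge0 ?(form_ge0 Hip).
have A2 e : 0 < e -> A ^+ 2 <= 2 * e * C.
  move=> e0; have [N1 N1P] := uu' _ e0; have [N2 N2P] := gg' _ e0.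
  pose n := maxn N1 N2.
  have un := N1P n (leq_maxl _ _); have gn := N2P n (leq_maxr _ _).
  have sun : L2 (u n - u') := subspaceB HS (su n) su'.
  have sgn : L2 (g n - g') := subspaceB HS (sg n) sg'.
  have -> : A = - (ip (u n - u') psi + ip (g n - g') phi).
    rewrite (formBl HS Hip)// (formBl HS Hip)// (ug n phi tphi : ip (u n) psi =
      - ip (g n) phi) /A.
    ring.
  have h1 := form_CS HS Hip sun sdphi; have h2 := form_CS HS Hip sgn sphi.
  have {}h1 := le_trans h1 (ler_wpM2r (form_ge0 Hip sdphi) un).
  have {}h2 := le_trans h2 (ler_wpM2r (form_ge0 Hip sphi) gn).
  rewrite sqrrN /C.
  move: h1 h2; move: (ip (u n - u') psi) (ip (g n - g') phi) (ip psi psi) (ip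
    phi phi) => a b p q h1 h2.
  rewrite sqrrD; have := sqr_ge0 (a - b); rewrite sqrrB; lra.
have A0 : A ^+ 2 <= 0.
  rewrite leNgt; apply/negP => Apos.
  have c1 : 0 < 2 * C + 1 by lra.
  have := A2 _ (divr_gt0 Apos c1); apply/negP; rewrite -ltNge.
  rewrite (_ : 2 * _ * C = A ^+ 2 * (2 * C) / (2 * C + 1)); last by ring.
  rewrite ltr_pdivrMr// (mulrDr (A ^+ 2)) mulr1; move: Apos;
    move: (A ^+ 2 * (2 * C)) (A ^+ 2) => a b; lra.
have : A == 0 by rewrite -sqrf_eq0 eq_le A0 sqr_ge0.
by rewrite /A addr_eq0 => /eqP.
Qed.

End weak_derivatives.

Section dirichlet_form.
Variables (R : realType) (d : nat).
Local Notation mes := (lebesgue_rV R d).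
Local Notation L2 := (sq_integrable mes).
Local Notation E := (('rV[R]_d -> R^o)%type : lmodType R).
Local Notation ip := (L2_form mes).
Variable V : 'rV[R]_d -> R.
Hypothesis mV : measurable_fun setT V.
Local Notation W := (potential V).
Implicit Types (u g f : 'rV[R]_d -> R) (i : 'I_d).

Let HS : subspace (L2 : set E) := subspace_sq_integrable mes.
Let Hip : nonneg_form (L2 : set E) ip := nonneg_form_L2 mes.

(** A choice of representative, hence linear in u only almost everywhere; [gradient_formE] allows
    any other representative inside the form. *)
Definition wderiv i u : 'rV[R]_d -> R :=
  xget (fun=> 0) [set g | L2 g /\ weak_deriv i u g].

(** Makes the potential term an L2 product of two functions, so that every fact on [L2_form] applies
    to it. *)
Definition root_potential x := Num.sqrt (W x).

Definition dirichlet_domain : set E := [set u |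
  [/\ L2 u, forall i, exists2 g, L2 g & weak_deriv i u g &
    L2 (fun x => root_potential x * u x)]].

Definition dirichlet_form u v :=
  \sum_i ip (wderiv i u) (wderiv i v) +
  ip (fun x => root_potential x * u x) (fun x => root_potential x * v x).

Lemma wderivP i u : dirichlet_domain u -> L2 (wderiv i u) /\ weak_deriv i u
  (wderiv i u).
Proof.
by move=> [_ /(_ i)[g sg ug] _];
  apply: (@xgetPex _ (fun=> 0) [set g | L2 g /\ weak_deriv i u g]); exists g.
Qed.

Lemma subspace_dirichlet : subspace dirichlet_domain.
Proof.
split.
- split; first exact: subspace0 HS.
    move=> i; exists (0 : E); first exact: subspace0 HS.
    apply/weak_derivP => phi tphi; rewrite !(form0l HS Hip) ?oppr0//.
      exact: test_function_sq_integrable.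
    exact/test_function_sq_integrable/test_function_partial.
  rewrite (_ : (fun x => _) = (0 : E)); first exact: subspace0 HS.
  by apply/funext => x; rewrite mulr0.
- move=> u v [su du wu] [sv dv wv]; split; first exact: sq_integrableD.
    move=> i; have [g sg ug] := du i; have [k sk vk] := dv i.
    exists (fun x => g x + k x); first exact: sq_integrableD.
    exact: weak_derivD.
  rewrite (_ : (fun x => _) = fun x => root_potential x * u x + root_potential
    x * v x); first exact: sq_integrableD.
  by apply/funext => x; rewrite mulrDr.
- move=> a u [su du wu]; split; first exact: sq_integrableZ.
    move=> i; have [g sg ug] := du i.
    exists (fun x => a * g x); first exact: sq_integrableZ.
    exact: weak_derivZ.
  rewrite (_ : (fun x => _) = fun x => a * (root_potential x * u x));
    first exact: sq_integrableZ.
  by apply/funext => x; rewrite mulrCA.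
Qed.

Let DS := subspace_dirichlet.

Lemma nonneg_form_gradient i : nonneg_form dirichlet_domain
  (fun u v => ip (wderiv i u) (wderiv i v)).
Proof.
split.
- move=> u v w Du Dv Dw.
  have [su ug] := wderivP i Du; have [sv vg] := wderivP i Dv;
    have [sw _] := wderivP i Dw.
  have [suv uvg] := wderivP i (subspaceD DS Du Dv).
  rewrite -(formDl Hip)//; apply: L2_form_ae => //; first exact: sq_integrableD.
  apply: (weak_deriv_unique _ _ _ _ _ uvg (weak_derivD _ _ _ _ ug vg)) => //.
  + by have [] := subspaceD DS Du Dv.
  + by have [] := subspaceD DS Du Dv.
  + exact: sq_integrableD.
  + exact: aeW.
  + by have [] := Du.
  + by have [] := Dv.
- move=> a u w Du Dw.
  have [su ug] := wderivP i Du; have [sw _] := wderivP i Dw.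
  have [sau aug] := wderivP i (subspaceZ DS a Du).
  rewrite -(formZl Hip)//; apply: L2_form_ae => //; first exact: sq_integrableZ.
  apply: (weak_deriv_unique _ _ _ _ _ aug (weak_derivZ _ _ _ ug)) => //.
  + by have [] := subspaceZ DS a Du.
  + by have [] := subspaceZ DS a Du.
  + exact: sq_integrableZ.
  + exact: aeW.
  + by have [] := Du.
- by move=> u v Du Dv; apply: (formC Hip);
  [exact: (wderivP i Du).1|exact: (wderivP i Dv).1].
- by move=> u Du; apply: (form_ge0 Hip); exact: (wderivP i Du).1.
Qed.

Lemma nonneg_form_potential : nonneg_form dirichlet_domain
  (fun u v => ip (fun x => root_potential x * u x) (fun x => root_potential x *
    v x)).
Proof.
split.
- move=> u v w [_ _ wu] [_ _ wv] [_ _ ww]; rewrite -(formDl Hip)//;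
  congr (L2_form _ _ _).
  by apply/funext => x /=; rewrite -mulrDr.
- move=> a u w [_ _ wu] [_ _ ww]; rewrite -(formZl Hip)//;
  congr (L2_form _ _ _).
  by apply/funext => x /=; rewrite -[RHS]/(a * _) mulrCA.
- by move=> u v [_ _ wu] [_ _ wv]; apply: (formC Hip).
- by move=> u [_ _ wu]; apply: (form_ge0 Hip).
Qed.

Lemma nonneg_dirichlet_form : nonneg_form dirichlet_domain dirichlet_form.
Proof.
apply: nonneg_formD; last exact: nonneg_form_potential.
by apply: nonneg_form_sum => i; exact: nonneg_form_gradient.
Qed.


Lemma measurable_root_potential : measurable_fun setT root_potential.
Proof.
have msqrt : measurable_fun setT (Num.sqrt : R -> R).
  by apply: continuous_measurable_fun; exact: sqrt_continuous.
exact: measurableT_comp msqrt (measurable_potential mV).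
Qed.

Lemma sqr_root_potential x (a : R) : (root_potential x * a) ^+ 2 = W x * a ^+ 2.
Proof. by rewrite exprMn sqr_sqrtr// potential_ge0. Qed.

Lemma gradient_formE i u g v k : dirichlet_domain u -> dirichlet_domain v ->
  L2 g -> L2 k -> weak_deriv i u g -> weak_deriv i v k ->
  ip (wderiv i u) (wderiv i v) = ip g k.
Proof.
move=> Du Dv sg sk ug vk.
have [su u'] := wderivP i Du; have [sv v'] := wderivP i Dv.
have [su0 _ _] := Du; have [sv0 _ _] := Dv.
have ae1 : {ae mes, forall x, wderiv i u x = g x}.
  by apply: (weak_deriv_unique su0 su0 su sg _ u' ug); exact: aeW.
have ae2 : {ae mes, forall x, wderiv i v x = k x}.
  by apply: (weak_deriv_unique sv0 sv0 sv sk _ v' vk); exact: aeW.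
rewrite (L2_form_ae su sg sv ae1) (formC Hip sg sv) (L2_form_ae sv sk sg ae2).
exact: (formC Hip).
Qed.

(** A single weighted space carries both the norm and the potential term, so there is one limit
    function and no two limits to be identified. *)
Let weight x := 1 + W x.

Let measurable_weight : measurable_fun setT weight.
Proof. by apply: measurable_funD => //; exact: measurable_potential. Qed.

Let weight_ge1 x : 1 <= weight x.
Proof. by rewrite /weight lerDl potential_ge0. Qed.

Let integral_weight f : L2 f -> L2 (fun x => root_potential x * f x) ->
  (\int[mes]_x (weight x * f x ^+ 2)%:E =
    (ip (fun x => root_potential x * f x)%R (fun x => root_potential x * f x)%R
      +
     ip f f)%:E)%E.
Proof.
move=> sf wf; rewrite EFinD -!L2_formE// -ge0_integralD//; last 4 first.
- by move=> x _; exact: sqr_EFin_ge0.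
- by apply: measurable_sqr; exact: wf.1.
- by move=> x _; exact: sqr_EFin_ge0.
- by apply: measurable_sqr; exact: sf.1.
apply: eq_integral => x _; rewrite -EFinD sqr_root_potential /weight;
  congr EFin; ring.
Qed.

Let weight_L2 f : measurable_fun setT f ->
  (\int[mes]_x (weight x * f x ^+ 2)%:E < +oo)%E ->
  L2 f /\ L2 (fun x => root_potential x * f x).
Proof.
move=> mf ff.
have mwf : measurable_fun setT (fun x => (weight x * f x ^+ 2)%:E).
  by apply/measurable_EFinP; apply: measurable_funM => //;
    exact: measurable_funX.
have mrf : measurable_fun setT (fun x => root_potential x * f x).
  by apply: measurable_funM => //; exact: measurable_root_potential.
split; split => //; apply: le_lt_trans ff; apply: ge0_le_integral => //.
- by move=> x _; exact: sqr_EFin_ge0.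
- exact: measurable_sqr.
- by move=> x _; rewrite lee_fin ler_peMl ?sqr_ge0.
- by move=> x _; exact: sqr_EFin_ge0.
- exact: measurable_sqr.
- by move=> x _; rewrite sqr_root_potential lee_fin ler_wpM2r ?sqr_ge0//
  /weight lerDr.
Qed.

Lemma L2_complete : form_complete (L2 : set E) (fun u => ip u u).
Proof.
move=> u su uC.
have [|g mg gP] := weighted_sqr_complete (mu := mes) (w := cst 1)
    (measurable_cst _) (fun=> lexx _) (fun n => (su n).1).
  move=> e e0; have [N NP] := uC e e0; exists N => m n mN nN.
  rewrite (eq_integral (fun x => ((u m - u n) x ^+ 2)%:E)); last first.
    by move=> x _; rewrite mul1r.
  by rewrite L2_formE ?lee_fin; [exact: NP|exact: (subspaceB HS)].
have gP1 n : (\int[mes]_x (cst 1 x * (u n x - g x) ^+ 2)%:E)%E =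
    (\int[mes]_x ((u n x - g x) ^+ 2)%:E)%E.
  by apply: eq_integral => x _; rewrite mul1r.
have sd n e : (\int[mes]_x (cst 1 x * (u n x - g x) ^+ 2)%:E <= e%:E)%E ->
    L2 (fun x => u n x - g x).
  move=> h; split; first by apply: measurable_funB => //; exact: (su n).1.
  by rewrite -gP1 (le_lt_trans h)// ltry.
have sg : L2 g.
  have [N /(_ N (leqnn _))/sd sN] := gP 1 ltr01.
  rewrite (_ : g = fun x => u N x - (u N x - g x)); first exact: sq_integrableB.
  by apply/funext => x; ring.
exists g => // e e0; have [N NP] := gP e e0; exists N => n /NP h.
rewrite -lee_fin -L2_formE; first by rewrite gP1 in h.
exact: (subspaceB HS).
Qed.

(** The gradients converge in L2 and the functions in the space of weight 1 + W; [weak_deriv_limit]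
    recognises the limits of the gradients as the weak derivatives of the limit. *)
Lemma dirichlet_form_complete :
  form_complete dirichlet_domain (fun u => dirichlet_form u u + ip u u).
Proof.
move=> u Du uC.
have su n : L2 (u n) by have [] := Du n.
have wu n : L2 (fun x => root_potential x * u n x) by have [] := Du n.
have DB m n : dirichlet_domain (u m - u n) by exact: (subspaceB DS).
have gradB (v v' : E) (g g' : E) i : dirichlet_domain (v - v') -> L2 v -> L2 v'
  -> L2 g -> L2 g' ->
    weak_deriv i v g -> weak_deriv i v' g' ->
    ip (wderiv i (v - v')) (wderiv i (v - v')) = ip (g - g') (g - g').
  move=> D sv sv' sg sg' vg vg'; apply: gradient_formE => //.
  - exact: (subspaceB HS).
  - exact: (subspaceB HS).
  - exact: weak_derivB.
  - exact: weak_derivB.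
have grad i : exists g : E, L2 g /\
    form_cvg (fun f => ip f f) (fun n => wderiv i (u n) : E) g.
  have [|e e0|g sg gP] := @L2_complete (fun n => wderiv i (u n));
    last by exists g.
    by move=> n; exact: (wderivP i (Du n)).1.
  have [N NP] := uC e e0; exists N => m n mN nN.
  apply: le_trans (NP m n mN nN).
  have [sm um] := wderivP i (Du m); have [sn un] := wderivP i (Du n).
  rewrite -(gradB (u m) (u n) (wderiv i (u m)) (wderiv i (u n)) i)//.
  rewrite /dirichlet_form (bigD1 i)//= -!addrA lerDl.
  rewrite addr_ge0//; first by apply: sumr_ge0 => j _;
    exact: (form_ge0 (nonneg_form_gradient j)).
  by rewrite addr_ge0//;
    [exact: (form_ge0 nonneg_form_potential)|apply: (form_ge0 Hip);
    have [] := DB m n].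
have [g gP] := choice grad.
have [|v mv vP] := weighted_sqr_complete (mu := mes) measurable_weight
  weight_ge1 (fun n => (su n).1).
  move=> e e0; have [N NP] := uC e e0; exists N => m n mN nN.
  have [s1 _ s2] := DB m n; rewrite (integral_weight s1 s2) lee_fin.
  apply: le_trans (NP m n mN nN).
  rewrite /dirichlet_form -addrA lerDr; apply: sumr_ge0 => j _.
  exact: (form_ge0 (nonneg_form_gradient j)).
have svd n e : (\int[mes]_x (weight x * (u n x - v x) ^+ 2)%:E <= e%:E)%E ->
    L2 (u n - v : E) /\ L2 (fun x => root_potential x * (u n - v : E) x).
  move=> h; apply: weight_L2; last by rewrite (le_lt_trans h)// ltry.
  by apply: measurable_funB => //; exact: (su n).1.
have sv : L2 v.
  have [N /(_ N (leqnn _))/svd[sN _]] := vP 1 ltr01.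
  rewrite (_ : v = fun x => u N x - (u N x - v x)); first exact: sq_integrableB.
  by apply/funext => x; ring.
have swv : L2 (fun x => root_potential x * v x).
  have [N /(_ N (leqnn _))/svd[_ sN]] := vP 1 ltr01.
  rewrite (_ : (fun x => _) = fun x => root_potential x * u N x -
    root_potential x * (u N x - v x)).
    exact: sq_integrableB.
  by apply/funext => x; ring.
have vg i : weak_deriv i v (g i).
  have [sg cg] := gP i.
  apply: (weak_deriv_limit (u := u) su _ sv sg _ _ cg).
  - by move=> n; exact: (wderivP i (Du n)).1.
  - by move=> n; exact: (wderivP i (Du n)).2.
  - move=> e e0; have [N NP] := vP e e0; exists N => n /NP h.
    have [s1 s2] := svd _ _ h; move: h; rewrite (integral_weight s1 s2) lee_fin.
    by apply: le_trans; rewrite lerDr; apply: (form_ge0 Hip).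
have Dv : dirichlet_domain v.
  by split => // i; exists (g i); [exact: (gP i).1|exact: vg].
exists v => // e e0.
(* There are d gradient terms and one weighted term, the latter comprising the potential and the
   norm. *)
pose e' := e / d.+1%:R.
have e'0 : 0 < e' by rewrite divr_gt0.
have [N NP] := choice (fun i => (gP i).2 e' e'0).
have [M MP] := vP e' e'0.
exists (maxn M (\max_i N i)) => n; rewrite geq_max => /andP[Mn Nn].
have [s1 s2] := svd _ _ (MP n Mn).
have := MP n Mn; rewrite (integral_weight s1 s2) lee_fin => h.
rewrite /dirichlet_form -addrA (_ : e = \sum_(i < d) e' + e'); last first.
  by rewrite sumr_const card_ord -mulrSr -[RHS]mulr_natr /e' divfK// pnatr_eq0.
apply: lerD => //; apply: ler_sum => i _.
have [sn un] := wderivP i (Du n); have [sg _] := gP i.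
rewrite (gradB (u n) v (wderiv i (u n)) (g i) i)//; last exact: (subspaceB DS).
by apply: NP; apply: leq_trans Nn; exact: (leq_bigmax i).
Qed.

Lemma real_energyE u : dirichlet_domain u ->
  real_energy V u (fun i => wderiv i u) setT = (dirichlet_form u u)%:E.
Proof.
move=> Du; have [su _ wu] := Du; rewrite /real_energy EFinD -sumEFin;
  congr (_ + _)%E.
  by apply: eq_bigr => i _; rewrite L2_formE//; exact: (wderivP i Du).1.
by rewrite -L2_formE//; apply: eq_integral => x _; rewrite sqr_root_potential.
Qed.

End dirichlet_form.

Lemma dirichlet_compact (R : realType) (d : nat) (V : 'rV[R]_d -> R)
    (G : set 'rV[R]_d) (r0 : R) (gamma : R -> R) :
  (0 < d)%N -> measurable_fun setT V -> admissible_domain G -> 0 < r0 ->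
  (forall r, 0 < r < r0 -> 0 < gamma r < 1) ->
  limf_esup (fun r : R =>
     (r `^ (- (2 * (d%:R - 2) / d%:R)) * gamma r)%:E) 0^'+ = +oo%E ->
  (forall r : R, 0 < r < r0 ->
     J_functional V G ((1 - gamma r) * fine (lebesgue_rV R d (scaled_domain G r
       0))) y r
       @[y --> enorm_infty R d] --> +oo%E) ->
  forall e : R, 0 < e -> exists N (g : 'I_N -> ('rV[R]_d -> R^o)) M,
    [/\ 0 <= M, forall j, sq_integrable (lebesgue_rV R d) (g j) &
      finite_rank_bound (dirichlet_domain V) (L2_form (lebesgue_rV R d))
        (dirichlet_form V) e g M].
Proof.
move=> d0 mV aG r00 hgamma hlimsup hJ e e0.
have [r [n0 [M [r_gt0 M0 tb]]]] := tail_bound d0 mV aG r00 hgamma hlimsup hJ e0.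
exists n0.+1, (fun j => \1_(tile_nat r j)), M; split => //.
  move=> j; have mj : measurable (tile_nat r j : set 'rV[R]_d) by exact:
    measurable_tile_nat.
  split.
    exact: measurable_indic.
  rewrite (eq_integral (EFin \o \1_(tile_nat r j))); last first.
    by move=> x _; rewrite /= indicE; case: (_ \in _); rewrite ?expr1n// expr0n.
  rewrite integral_indic// setIT.
  have [->|[k _ ->]] := tile_natP d r_gt0 j; first by rewrite measure0.
  have tfin : (lebesgue_rV R d (tile r (tile_center r k)) < +oo)%E.
    by rewrite lebesgue_tile// ltry.
  exact: tfin.
move=> u Du; have [su _ _] := Du.
have := tb u (fun i => wderiv i u) su (fun i => (wderivP i Du).1) (fun i =>
  (wderivP i Du).2).
rewrite real_energyE// => /(_ (ltry _)).
rewrite L2_formE// -EFinM -EFinD lee_fin.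
rewrite (eq_bigr (fun n : 'I_n0.+1 => L2_form (lebesgue_rV R d) u \1_(tile_nat
  r n) ^+ 2))//.
move=> n _; congr (_ ^+ 2); rewrite /tile_functional /L2_form.
rewrite Rintegral_mkcond; apply: eq_Rintegral => x _.
by rewrite patchE indicE; case: (x \in _); rewrite ?mulr1 ?mulr0.
Qed.

(** * The complex form as a pair of real ones *)

Section real_pairs.
Local Open Scope complex_scope.
Context dsp (T : measurableType dsp) (R : realType).
Variable mu : {measure set T -> \bar R}.
Local Notation E := ((T -> R^o)%type : lmodType R).
Local Notation EE := ((E * E)%type : lmodType R).
Local Notation sq2 := (double_set (sq_integrable mu : set E)).
Local Notation ip2 := (double_form (L2_form mu)).
Implicit Types (u v f : T -> R[i]) (p q : EE) (z : R[i]).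

Definition real_pair u : EE := (fun x => complex.Re (u x), fun x => complex.Im
  (u x)).

Definition complex_fun p : T -> R[i] := fun x => p.1 x +i* p.2 x.

Lemma complex_funK p : real_pair (complex_fun p) = p.
Proof. by case: p. Qed.

Lemma real_pairK u : complex_fun (real_pair u) = u.
Proof. by apply/funext => x; rewrite /complex_fun/=; case: (u x). Qed.

Lemma normc_sqr z : Normc.normc z ^+ 2 = complex.Re z ^+ 2 + complex.Im z ^+ 2.
Proof. by case: z => a b;
  rewrite /Normc.normc sqr_sqrtr// addr_ge0 ?sqr_ge0. Qed.

Lemma Re_mul z w : complex.Re (z * w) = complex.Re z * complex.Re w -
  complex.Im z * complex.Im w.
Proof. by case: z; case: w. Qed.

Lemma Im_mul z w : complex.Im (z * w) = complex.Re z * complex.Im w +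
  complex.Im z * complex.Re w.
Proof. by case: z; case: w. Qed.

Lemma Re_mul_conj z w : complex.Re (z * w^*) = complex.Re z * complex.Re w +
  complex.Im z * complex.Im w.
Proof. by case: z => a b; case: w => c e /=; rewrite mulrN opprK. Qed.

Lemma Im_mul_conj z w : complex.Im (z * w^*) = complex.Im z * complex.Re w -
  complex.Re z * complex.Im w.
Proof. by case: z => a b; case: w => c e /=; rewrite mulrN addrC. Qed.

Lemma complex_eq z w : complex.Re z = complex.Re w -> complex.Im z = complex.Im
  w -> z = w.
Proof. by case: z => a b; case: w => c e /= -> ->. Qed.

Lemma integral_normc u : cmeasurable u ->
  (\int[mu]_x (Normc.normc (u x) ^+ 2)%:E =
   \int[mu]_x (complex.Re (u x) ^+ 2)%:E + \int[mu]_x (complex.Im (u x) ^+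
     2)%:E)%E.
Proof.
move=> [mr mi]; rewrite -ge0_integralD//; last 4 first.
- by move=> x _; exact: sqr_EFin_ge0.
- exact: measurable_sqr.
- by move=> x _; exact: sqr_EFin_ge0.
- exact: measurable_sqr.
by apply: eq_integral => x _; rewrite normc_sqr EFinD.
Qed.

Lemma L2P u : L2 mu u <-> sq2 (real_pair u).
Proof.
split=> [[mu_ fin]|[[m1 f1] [m2 f2]]].
  rewrite integral_normc// in fin; have [m1 m2] := mu_.
  by split; split => //; apply: le_lt_trans fin; rewrite ?leeDl ?leeDr//;
    apply: integral_ge0 => x _; exact: sqr_EFin_ge0.
have mu_ : cmeasurable u by split.
by split=> //; rewrite integral_normc//; exact: lte_add_pinfty.
Qed.

Lemma L2_complex_fun p : sq2 p -> L2 mu (complex_fun p).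
Proof. by move=> sp; apply/L2P; rewrite complex_funK. Qed.

Lemma sq2_integrable u v : L2 mu u -> L2 mu v ->
  mu.-integrable setT (EFin \o fun x => complex.Re (u x * (v x)^*)) /\
  mu.-integrable setT (EFin \o fun x => complex.Im (u x * (v x)^*)).
Proof.
move=> /L2P[/= u1 u2] /L2P[/= v1 v2]; split.
  rewrite (_ : _ \o _ = (fun x => (complex.Re (u x) * complex.Re (v x))%:E +
    (complex.Im (u x) * complex.Im (v x))%:E)%E).
    by apply: integrableD => //; exact: sq_integrableM.
  by apply/funext => x; rewrite /= Re_mul_conj.
rewrite (_ : _ \o _ = (fun x => (complex.Im (u x) * complex.Re (v x))%:E -
  (complex.Re (u x) * complex.Im (v x))%:E)%E).
  by apply: integrableB => //; exact: sq_integrableM.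
by apply/funext => x; rewrite /= Im_mul_conj.
Qed.

Lemma L2innerE u v : L2 mu u -> L2 mu v ->
  L2inner mu u v = ip2 (real_pair u) (real_pair v) +i*
    (L2_form mu (real_pair u).2 (real_pair v).1 - L2_form mu (real_pair u).1
      (real_pair v).2).
Proof.
move=> /L2P[/= u1 u2] /L2P[/= v1 v2]; rewrite /L2inner /cintegral;
  congr (_ +i* _).
  rewrite /double_form /L2_form/= -RintegralD//; last 2 first.
  - exact: sq_integrableM.
  - exact: sq_integrableM.
  by apply: eq_Rintegral => x _; rewrite Re_mul_conj.
rewrite /L2_form/= -RintegralB//; last 2 first.
- exact: sq_integrableM.
- exact: sq_integrableM.
by apply: eq_Rintegral => x _; rewrite Im_mul_conj.
Qed.

Lemma L2normE u : L2 mu u -> L2norm mu u = Num.sqrt (ip2 (real_pair u)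
  (real_pair u)).
Proof.
move=> Lu; have /L2P[/= u1 u2] := Lu; have [cu _] := Lu.
rewrite /L2norm /Rintegral integral_normc// !L2_formE//.
Qed.

Lemma ae_zeroP u : L2 mu u -> ae_zero mu u <-> ip2 (real_pair u) (real_pair u)
  = 0.
Proof.
move=> /L2P[/= u1 u2]; split=> [u0|].
  by rewrite /double_form !ae_eq0_L2_form ?addr0//;
    apply: filterS u0 => x /= ->.
move=> /eqP; rewrite paddr_eq0 ?(form_ge0 (nonneg_form_L2 mu))//.
move=> /andP[/eqP/(L2_form_eq0 u1) h1 /eqP/(L2_form_eq0 u2) h2].
by apply: filterS2 h1 h2 => x /= h1 h2; apply: complex_eq.
Qed.

(** Multiplication by z in real coordinates; it plays the role of [Z] in the Fredholm alternative,
    with [K] the modulus of z. *)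
Definition pair_mul z p : EE :=
  (complex.Re z *: p.1 - complex.Im z *: p.2, complex.Re z *: p.2 + complex.Im
    z *: p.1).

Lemma real_pair_mul z u : real_pair (fun x => z * u x) = pair_mul z (real_pair
  u).
Proof.
by congr pair; apply/funext => x /=; rewrite ?Re_mul ?Im_mul.
Qed.

Lemma real_pairD u v : real_pair (fun x => u x + v x) = real_pair u + real_pair
  v.
Proof.
transitivity (((real_pair u).1 + (real_pair v).1, (real_pair u).2 + (real_pair
  v).2) : EE) => //.
by congr pair; apply/funext => x /=; rewrite -[RHS]/(_ + _); case: (u x);
  case: (v x).
Qed.

Lemma pair_mulD z p q : pair_mul z (p + q) = pair_mul z p + pair_mul z q.
Proof.
rewrite /pair_mul/= !scalerDr opprD; congr pair; first by rewrite addrACA.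
by rewrite addrACA.
Qed.

Lemma pair_mulZ z (a : R) p : pair_mul z (a *: p) = a *: pair_mul z p.
Proof.
congr pair => /=; rewrite ?scalerBr ?scalerDr !scalerA !(mulrC a)//.
Qed.

Lemma subspace_pair_mul (S : set E) z p : subspace S -> double_set S p ->
  double_set S (pair_mul z p).
Proof.
move=> SS [p1 p2]; split => /=.
- by apply: (subspaceB SS); exact: (subspaceZ SS).
- by apply: (subspaceD SS); exact: (subspaceZ SS).
Qed.

Lemma double_form_pair_mul (S : set E) (b : E -> E -> R) z p :
  subspace S -> nonneg_form S b -> double_set S p ->
  double_form b (pair_mul z p) (pair_mul z p) = Normc.normc z ^+ 2 *
    double_form b p p.
Proof.
move=> SS Sb [p1 p2]; have Z (a : R) (v : E) : S v -> S (a *: v) by exact: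
  (subspaceZ SS).
rewrite /double_form/= (formBl SS Sb) ?(formDl Sb) ?(formBr SS Sb) ?(formDr SS
  Sb)//;
  try (by apply: (subspaceB SS); exact: Z); try (by apply: (subspaceD SS);
    exact: Z); try exact: Z.
rewrite !(formZl Sb) ?(formZr SS Sb)//; try exact: Z.
rewrite (formC Sb p2 p1) normc_sqr; ring.
Qed.

End real_pairs.

Section complex_schrodinger.
Local Open Scope complex_scope.
Variables (R : realType) (d : nat).
Local Notation mes := (lebesgue_rV R d).
Local Notation E := (('rV[R]_d -> R^o)%type : lmodType R).
Local Notation EE := ((E * E)%type : lmodType R).
Variable V : 'rV[R]_d -> R.
Hypotheses (mV : measurable_fun setT V) (V0 : \forall x \ae mes, 0 <= V x).
Local Notation D2 := (double_set (dirichlet_domain V)).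
Local Notation h := (dirichlet_form V).
Local Notation ip2 := (double_form (L2_form mes)).
Implicit Types (u v g f : 'rV[R]_d -> R[i]) (p q : EE) (z : R[i]).

Lemma ae_potential : {ae mes, forall x, V x = potential V x}.
Proof. by apply: filterS V0 => x Vx; rewrite /potential max_l. Qed.

Lemma weak_partialP i u g : weak_partial i u g <->
  weak_deriv i (real_pair u).1 (real_pair g).1 /\
  weak_deriv i (real_pair u).2 (real_pair g).2.
Proof.
have cintE (w : 'rV[R]_d -> R[i]) (phi : 'rV[R]_d -> R) :
    cintegral mes (fun x => w x * (phi x)%:C) =
    (\int[mes]_x (complex.Re (w x) * phi x))%R +i* (\int[mes]_x (complex.Im (w
      x) * phi x))%R.
  rewrite /cintegral; congr (_ +i* _); apply: eq_Rintegral => x _.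
    by rewrite Re_mul/= mulr0 subr0.
  by rewrite Im_mul/= mulr0 add0r.
split=> [ug|[h1 h2] phi tphi].
  by split => phi /ug; rewrite !cintE => -[].
by rewrite !cintE (h1 phi tphi) (h2 phi tphi).
Qed.

Lemma integral_potential_normc u : cmeasurable u ->
  (\int[mes]_x (V x * Normc.normc (u x) ^+ 2)%:E =
   \int[mes]_x ((root_potential V x * complex.Re (u x)) ^+ 2)%:E +
   \int[mes]_x ((root_potential V x * complex.Im (u x)) ^+ 2)%:E)%E.
Proof.
move=> [m1 m2].
have mq := measurable_root_potential mV.
rewrite -ge0_integralD//; last 4 first.
- by move=> x _; exact: sqr_EFin_ge0.
- by apply: measurable_sqr; exact: measurable_funM.
- by move=> x _; exact: sqr_EFin_ge0.
- by apply: measurable_sqr; exact: measurable_funM.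
apply: ae_eq_integral => //.
- apply/measurable_EFinP; apply: measurable_funM => //.
  rewrite (_ : (fun x => _) = (fun x => complex.Re (u x) ^+ 2 + complex.Im (u
    x) ^+ 2)).
    by apply: measurable_funD; exact: measurable_funX.
  by apply/funext => x; rewrite normc_sqr.
- by apply: emeasurable_funD; apply: measurable_sqr; exact: measurable_funM.
- apply: filterS ae_potential => x Vx _.
  by rewrite !sqr_root_potential -EFinD -mulrDr -normc_sqr Vx.
Qed.

Lemma form_domainP u : form_domain V u <-> D2 (real_pair u).
Proof.
have mq := measurable_root_potential mV.
split=> [[[Lu du] fin]|[D1 D2]].
  have [[m1 m2] _] := Lu; have /L2P[s1 s2] := Lu.
  have rD i : exists2 g, L2 mes g & weak_deriv i (real_pair u).1 (real_pair
    g).1 /\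
      weak_deriv i (real_pair u).2 (real_pair g).2.
    by have [g Lg /weak_partialP] := du i; exists g.
  rewrite integral_potential_normc// in fin.
  split; split => //=.
  - by move=> i; have [g /L2P[sg _] [ug _]] := rD i; exists (real_pair g).1.
  - split; first exact: measurable_funM.
    apply: le_lt_trans fin; rewrite leeDl//; apply: integral_ge0 => x _;
      exact: sqr_EFin_ge0.
  - by move=> i; have [g /L2P[_ sg] [_ ug]] := rD i; exists (real_pair g).2.
  - split; first exact: measurable_funM.
    apply: le_lt_trans fin; rewrite leeDr//; apply: integral_ge0 => x _;
      exact: sqr_EFin_ge0.
have [s1 d1 w1] := D1; have [s2 d2 w2] := D2.
have Lu : L2 mes u by apply/L2P.
have [cu _] := Lu.
split; last first.
  by rewrite integral_potential_normc//; apply: lte_add_pinfty;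
    [exact: w1.2|exact: w2.2].
split => // i; have [g1 sg1 ug1] := d1 i; have [g2 sg2 ug2] := d2 i.
exists (complex_fun (g1, g2)); first exact: L2_complex_fun.
by apply/weak_partialP; rewrite complex_funK.
Qed.

Lemma wpartialP i u : form_domain V u ->
  L2 mes (wpartial i u) /\ weak_partial i u (wpartial i u).
Proof.
by move=> [[_ /(_ i)[g Lg ug]] _];
  apply: (@xgetPex _ (fun=> 0) [set g | L2 mes g /\ weak_partial i u g]);
  exists g.
Qed.

Definition cintegrable u := mes.-integrable setT (EFin \o fun x => complex.Re
  (u x)) /\
  mes.-integrable setT (EFin \o fun x => complex.Im (u x)).

Lemma cintegrableD u v : cintegrable u -> cintegrable v -> cintegrable (fun x
  => u x + v x).
Proof.
move=> [u1 u2] [v1 v2]; split.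
  rewrite (_ : _ \o _ = (fun x => (complex.Re (u x))%:E + (complex.Re (v
    x))%:E)%E); first exact: integrableD.
  by apply/funext => x /=; case: (u x); case: (v x).
rewrite (_ : _ \o _ = (fun x => (complex.Im (u x))%:E + (complex.Im (v
  x))%:E)%E); first exact: integrableD.
by apply/funext => x /=; case: (u x); case: (v x).
Qed.

Lemma cintegralD u v : cintegrable u -> cintegrable v ->
  cintegral mes (fun x => u x + v x) = cintegral mes u + cintegral mes v.
Proof.
move=> [u1 u2] [v1 v2]; rewrite /cintegral [RHS]/GRing.add/=; congr (_ +i* _).
  by rewrite -RintegralD//; apply: eq_Rintegral => x _; case: (u x);
    case: (v x).
by rewrite -RintegralD//; apply: eq_Rintegral => x _; case: (u x); case: (v x).
Qed.

Lemma cintegral_sum n (w : 'I_n -> 'rV[R]_d -> R[i]) : (forall i, cintegrable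
  (w i)) ->
  cintegrable (fun x => \sum_i w i x) /\
  cintegral mes (fun x => \sum_i w i x) = \sum_i cintegral mes (w i).
Proof.
elim: n w => [|n IHn] w iw.
  have i0 : mes.-integrable setT (EFin \o fun x : 'rV[R]_d => (0 : R)) by
    exact: integrable0.
  under eq_fun do rewrite big_ord0; rewrite big_ord0; split; first by split.
  by rewrite /cintegral/= /Rintegral !integral0.
have [IH1 IH2] := IHn _ (fun i => iw (lift ord0 i)).
under eq_fun do rewrite big_ord_recl; rewrite big_ord_recl -IH2; split.
  exact: cintegrableD.
exact: cintegralD.
Qed.

Lemma cintegral_ae u v : cmeasurable u -> cmeasurable v ->
  {ae mes, forall x, u x = v x} -> cintegral mes u = cintegral mes v.
Proof.
move=> [u1 u2] [v1 v2] uv; rewrite /cintegral /Rintegral;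
  congr (fine _ +i* fine _).
  apply: ae_eq_integral => //; try exact/measurable_EFinP.
  by apply: filterS uv => x ->.
apply: ae_eq_integral => //; try exact/measurable_EFinP.
by apply: filterS uv => x ->.
Qed.

Lemma complex_sum n (a b : 'I_n -> R) :
  \sum_i (a i +i* b i) = (\sum_i a i) +i* (\sum_i b i).
Proof. by elim/big_rec3 : _ => // i x y _ _ ->. Qed.

Lemma cmeasurable_real (a : 'rV[R]_d -> R) u : measurable_fun setT a ->
  cmeasurable u ->
  cmeasurable (fun x => (a x)%:C * u x).
Proof.
move=> ma [u1 u2]; split.
  rewrite (_ : _ \o _ = (fun x => a x * complex.Re (u x)));
    first exact: measurable_funM.
  by apply/funext => x /=; rewrite Re_mul/= mul0r subr0.
rewrite (_ : _ \o _ = (fun x => a x * complex.Im (u x)));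
  first exact: measurable_funM.
by apply/funext => x /=; rewrite Im_mul/= mul0r addr0.
Qed.

Lemma cmeasurableD u v : cmeasurable u -> cmeasurable v -> cmeasurable (fun x
  => u x + v x).
Proof.
move=> [u1 u2] [v1 v2]; split.
  rewrite (_ : _ \o _ = (fun x => complex.Re (u x) + complex.Re (v x)));
    first exact: measurable_funD.
  by apply/funext => x /=; case: (u x); case: (v x).
rewrite (_ : _ \o _ = (fun x => complex.Im (u x) + complex.Im (v x)));
  first exact: measurable_funD.
by apply/funext => x /=; case: (u x); case: (v x).
Qed.

Lemma cintegrable_cmeasurable u : cintegrable u -> cmeasurable u.
Proof. by move=> [/measurable_int m1 /measurable_int m2]; split;
  apply/measurable_EFinP. Qed.

(** The parts of a complex weak derivative are weak derivatives of the parts, so [gradient_formE]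
    lets them replace the representatives chosen by [wderiv]. In the potential term V is exchanged
    almost everywhere for its truncation. *)
Lemma schrodinger_formE u v : form_domain V u -> form_domain V v ->
  schrodinger_form V u v = double_form h (real_pair u) (real_pair v) +i*
    (h (real_pair u).2 (real_pair v).1 - h (real_pair u).1 (real_pair v).2).
Proof.
move=> Du Dv; have /form_domainP[u1 u2] := Du; have /form_domainP[v1 v2] := Dv.
pose qq (w : 'rV[R]_d -> R[i]) := fun x => (root_potential V x)%:C * w x.
have pairq w : real_pair (qq w) = (fun x => root_potential V x * (real_pair
  w).1 x,
    fun x => root_potential V x * (real_pair w).2 x).
  congr pair; apply/funext => x /=; first by rewrite Re_mul/= mul0r subr0.
  by rewrite Im_mul/= mul0r addr0.
have Lq w : D2 (real_pair w) -> L2 mes (qq w).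
  by move=> [[_ _ w1] [_ _ w2]]; apply/L2P; rewrite pairq.
have Lqu := Lq _ (conj u1 u2); have Lqv := Lq _ (conj v1 v2).
have Lpu i := (wpartialP i Du).1; have Lpv i := (wpartialP i Dv).1.
have -> : schrodinger_form V u v =
    \sum_i L2inner mes (wpartial i u) (wpartial i v) + L2inner mes (qq u) (qq
      v).
  have [S1 S2] := cintegral_sum (fun i => sq2_integrable (Lpu i) (Lpv i)).
  have S3 := sq2_integrable Lqu Lqv.
  rewrite -S2 -[L2inner _ (qq u) _]/(cintegral _ _) -cintegralD//.
  apply: cintegral_ae.
  - apply: cmeasurableD; first exact: cintegrable_cmeasurable.
    apply: cmeasurable_real => //; apply: cintegrable_cmeasurable.
    by apply: sq2_integrable; [exact: Du.1.1|exact: Dv.1.1].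
  - exact/cintegrable_cmeasurable/cintegrableD.
  - apply: filterS ae_potential => x Vx; congr (_ + _).
    have W0 : potential V x = root_potential V x * root_potential V x.
      by rewrite -expr2 sqr_sqrtr// potential_ge0.
    rewrite Vx W0 /qq; apply: complex_eq; case: (u x) => a b;
      case: (v x) => c e /=; ring.
rewrite L2innerE// !pairq; under eq_bigr do rewrite L2innerE//.
rewrite complex_sum [LHS]/GRing.add/=.
have Gu i := (weak_partialP i u (wpartial i u)).1 (wpartialP i Du).2.
have Gv i := (weak_partialP i v (wpartial i v)).1 (wpartialP i Dv).2.
have /all_and2[su1 su2] i := (L2P mes (wpartial i u)).1 (Lpu i).
have /all_and2[sv1 sv2] i := (L2P mes (wpartial i v)).1 (Lpv i).
rewrite /double_form /dirichlet_form/=; congr (_ +i* _).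
  rewrite big_split/= addrACA; congr (_ + _ + (_ + _)).
  - by apply: eq_bigr => i _;
    rewrite -(gradient_formE u1 v1 (su1 i) (sv1 i) (Gu i).1 (Gv i).1).
  - by apply: eq_bigr => i _;
    rewrite -(gradient_formE u2 v2 (su2 i) (sv2 i) (Gu i).2 (Gv i).2).
rewrite sumrB opprD [RHS]addrACA; congr (_ - _ + _).
- by apply: eq_bigr => i _;
  rewrite -(gradient_formE u2 v1 (su2 i) (sv1 i) (Gu i).2 (Gv i).1).
- by apply: eq_bigr => i _;
  rewrite -(gradient_formE u1 v2 (su1 i) (sv2 i) (Gu i).1 (Gv i).2).
Qed.

(* The imaginary part of the equation for [v] is its real part for [i v]. *)
Lemma schrodingerP u f : schrodinger V (u, f) <->
  [/\ D2 (real_pair u), double_set (sq_integrable mes : set E) (real_pair f) &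
    forall q, D2 q -> double_form h (real_pair u) q = ip2 (real_pair f) q].
Proof.
split=> [[/= Du Lf uf]|[Du Lf uf]].
  split; [exact/form_domainP|exact/L2P|] => q Dq.
  have Dcq : form_domain V (complex_fun q) by apply/form_domainP;
    rewrite complex_funK.
  have := uf _ Dcq; rewrite schrodinger_formE// L2innerE// ?complex_funK;
    first by case.
  by case: Dcq => -[].
have Du' : form_domain V u by apply/form_domainP.
have Lf' : L2 mes f by apply/L2P.
split => // v Dv; rewrite schrodinger_formE// L2innerE//;
  last by case: Dv => -[].
have /form_domainP Dv2 := Dv; congr (_ +i* _); first exact: uf.
have [v1 v2] := Dv2.
have DS := subspace_dirichlet V.
have := uf (- (real_pair v).2, (real_pair v).1).
have nv2 : dirichlet_domain V (- (real_pair v).2) by exact: (subspaceN DS).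
move=> /(_ (conj nv2 v1)); rewrite /double_form/=.
have Nr (b : E -> E -> R) (S : set E) w k : subspace S -> nonneg_form S b -> S
  w -> S k ->
    b w (- k) = - b w k.
  by move=> SS Sb Sw Sk; rewrite -scaleN1r (formZr SS Sb)// mulN1r.
have [[_ _ _] [_ _ _]] := Du; case: Du => Du1 Du2; case: Lf => Lf1 Lf2.
rewrite (Nr _ _ _ _ DS (nonneg_dirichlet_form V))//.
rewrite (Nr _ _ _ _ (subspace_sq_integrable mes) (nonneg_form_L2 mes))//;
  last by case: v2.
by rewrite addrC => ->; rewrite addrC.
Qed.

End complex_schrodinger.

(** * Discreteness of the spectrum *)

Section discreteness.
Local Open Scope complex_scope.
Variables (R : realType) (d : nat).
Local Notation mes := (lebesgue_rV R d).
Local Notation E := (('rV[R]_d -> R^o)%type : lmodType R).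
Local Notation EE := ((E * E)%type : lmodType R).
Variable V : 'rV[R]_d -> R.
Hypotheses (mV : measurable_fun setT V) (V0 : \forall x \ae mes, 0 <= V x).
Local Notation sqi := (sq_integrable mes : set E).
Local Notation D := (dirichlet_domain V).
Local Notation H2 := (double_set sqi).
Local Notation D2 := (double_set D).
Local Notation ip2 := (double_form (L2_form mes)).
Local Notation h2 := (double_form (dirichlet_form V)).
Implicit Types (u v g f : 'rV[R]_d -> R[i]) (p q : EE) (z : R[i]).
Hypothesis compact1 : forall e : R, 0 < e -> exists N (g : 'I_N -> E) M,
    [/\ 0 <= M, forall j, sqi (g j) &
      finite_rank_bound D (L2_form mes) (dirichlet_form V) e g M].

Let HS : subspace H2 := subspace_double (subspace_sq_integrable mes).
Let Hip : nonneg_form H2 ip2 := nonneg_form_double (nonneg_form_L2 mes).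
Let DS : subspace D2 := subspace_double (subspace_dirichlet V).
Let Dh : nonneg_form D2 h2 := nonneg_form_double (nonneg_dirichlet_form V).
Let DH : D2 `<=` H2.
Proof. by move=> p [[s1 _ _] [s2 _ _]]. Qed.

Let Dcomplete : form_complete D2 (fun p => h2 p p + ip2 p p).
Proof.
rewrite (_ : (fun p => _) = fun p =>
    double_form (fun u v : E => dirichlet_form V u v + L2_form mes u v) p p).
  apply: (form_complete_double (subspace_dirichlet V)).
    apply: nonneg_formD; first exact: nonneg_dirichlet_form.
    have := nonneg_form_L2 mes => -[Dl Zl C ge0]; split.
    - by move=> u v w [su _ _] [sv _ _] [sw _ _]; exact: Dl.
    - by move=> a u w [su _ _] [sw _ _]; exact: Zl.
    - by move=> u v [su _ _] [sv _ _]; exact: C.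
    - by move=> u [su _ _]; exact: ge0.
  exact: dirichlet_form_complete.
by apply/funext => p; rewrite /double_form addrACA.
Qed.

Let compact2 : forall e : R, 0 < e -> exists N (g : 'I_N -> EE) M,
    [/\ 0 <= M, forall j, H2 (g j) & finite_rank_bound D2 ip2 h2 e g M].
Proof.
move=> e /compact1[N [g [M [M0 Hg gP]]]].
have DH1 : D `<=` sqi by move=> u [].
have [g' Hg' g'P] := finite_rank_bound_double (subspace_sq_integrable mes)
  (nonneg_form_L2 mes) DH1 Hg gP.
by exists (N + N)%N, g', M.
Qed.

Let ip2_ge0 p : H2 p -> 0 <= ip2 p p.
Proof. exact: (form_ge0 Hip). Qed.

Lemma eigenspaceP z u : Defs.eigenspace (schrodinger V) z u <->
  D2 (real_pair u) /\ forall q, D2 q -> h2 (real_pair u) q = ip2 (pair_mul z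
    (real_pair u)) q.
Proof.
rewrite /Defs.eigenspace/= schrodingerP// real_pair_mul;
  split=> [[? ?]|[Du uf]] //.
by split => //; apply: (subspace_pair_mul z (subspace_sq_integrable mes));
  exact: DH.
Qed.

(** The first branch of the Fredholm alternative is a nonzero eigenfunction; in the second,
    solvability and the bound give surjectivity and bounded inverse, and the bound with f = 0 gives
    injectivity. *)
Lemma eigenvalue_or_resolvent z : is_eigenvalue mes (schrodinger V) z \/
  resolvent_set mes (schrodinger V) z.
Proof.
pose K := Normc.normc z.
have K0 : 0 <= K by rewrite {}/K; case: z => a b; exact: sqrtr_ge0.
(* The largest eps with eps * (K + 1) <= 1/2. *)
have e0 : 0 < (2 * (K + 1))^-1 by rewrite invr_gt0 mulr_gt0// ltr_wpDl.
have [N [g [M [M0 Hg gP]]]] := compact2 e0.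
have eK : (2 * (K + 1))^-1 * (K + 1) <= 2^-1.
  by rewrite invfM divfK// gt_eqF// ltr_wpDl.
have ZH p : D2 p -> H2 (pair_mul z p).
  by move=> Dp; apply: (subspace_pair_mul z (subspace_sq_integrable mes));
    exact: DH.
have ZB p : D2 p -> ip2 (pair_mul z p) (pair_mul z p) <= K ^+ 2 * ip2 p p.
  move=> Dp; rewrite (double_form_pair_mul z (subspace_sq_integrable mes)
    (nonneg_form_L2 mes))//.
  exact: DH.
have := fredholm_alternative HS Hip DS Dh DH Dcomplete e0 M0 Hg gP K0 eK ZH
  (fun p q _ _ => pair_mulD z p q) (fun a p _ => pair_mulZ z a p) ZB.
move=> [[p [Dp p0 hp]]|[sol [C CP]]].
  left; exists (complex_fun p).
    by apply/eigenspaceP; rewrite complex_funK.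
  move=> /(ae_zeroP _).1; rewrite complex_funK => p0'.
  by move/eqP: p0; apply; apply: p0'; exact/L2_complex_fun/DH.
have rp f u : real_pair (fun x => f x + z * u x) = real_pair f + pair_mul z
  (real_pair u).
  by rewrite real_pairD real_pair_mul.
right; split.
- move=> f /L2P Hf; have [p Dp hp] := sol _ Hf.
  exists (complex_fun p); apply/schrodingerP => //; rewrite rp complex_funK;
    split => //.
  by apply: (subspaceD HS) => //; exact: ZH.
- move=> u /eigenspaceP[Du hu].
  have /L2P Lu : L2 mes u by apply/L2P; exact: DH.
  have H0 := subspace0 HS.
  apply/ae_zeroP; first exact/L2P.
  apply/eqP; rewrite eq_le ip2_ge0// andbT.
  have := CP 0 (real_pair u) H0 Du; rewrite (form0l HS Hip)// mulr0; apply.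
  by move=> q Dq; rewrite add0r; exact: hu.
(* [C] bounds squared norms and its sign is not known, hence the root of its absolute value. *)
- exists (Num.sqrt `|C|) => u f /schrodingerP => /(_ mV V0)[Du _ hu] Lf.
  have /L2P Hf := Lf; have Hu := DH Du.
  have Lu : L2 mes u by apply/L2P.
  rewrite !L2normE// -sqrtrM//; apply: ler_wsqrtr.
  apply: (@le_trans _ _ (C * ip2 (real_pair f) (real_pair f))).
    by apply: CP => // q Dq; rewrite -rp; exact: hu.
  by apply: ler_wpM2r; [exact: ip2_ge0|exact: ler_norm].
Qed.

(* Test the equation for [u] against [i u]. *)
Lemma eigenvalue_real z u : Defs.eigenspace (schrodinger V) z u -> ~ ae_zero
  mes u ->
  complex.Im z = 0.
Proof.
move=> /eigenspaceP[Du hu] u0; have [Du1 Du2] := Du.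
have [s1 s2] := DH Du.
pose q : EE := (- (real_pair u).2, (real_pair u).1).
have Dq : D2 q by split => //=; exact: (subspaceN (subspace_dirichlet V)).
have := hu q Dq.
have Lu : L2 mes u by apply/L2P; exact: DH.
have ip0 : ip2 (real_pair u) (real_pair u) != 0.
  by apply/eqP => ip0; apply: u0; exact/ae_zeroP.
have NE (S : set E) (b : E -> E -> R) w k : subspace S -> nonneg_form S b -> S
  w -> S k ->
    b w (- k) = - b w k.
  by move=> SS Sb Sw Sk; rewrite -scaleN1r (formZr SS Sb)// mulN1r.
have SS := subspace_sq_integrable mes; have Sb := nonneg_form_L2 mes.
have Z1 (a : R) : sqi (a *: (real_pair u).1) by exact: (subspaceZ SS).
have Z2 (a : R) : sqi (a *: (real_pair u).2) by exact: (subspaceZ SS).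
move: ip0; rewrite /double_form/= (NE D)//; last 2 first.
- exact: subspace_dirichlet.
- exact: nonneg_dirichlet_form.
rewrite (formC (nonneg_dirichlet_form V) Du1 Du2) addNr.
rewrite (NE sqi)//; last exact: (subspaceB SS).
rewrite (formBl SS Sb)// (formDl Sb)// !(formZl Sb)//.
rewrite (formC Sb s2 s1) => ip0 h0.
have : complex.Im z * (L2_form mes (real_pair u).1 (real_pair u).1 +
    L2_form mes (real_pair u).2 (real_pair u).2) = 0 by rewrite [RHS]h0; ring.
by move=> /eqP; rewrite mulf_eq0 (negbTE ip0) orbF => /eqP.
Qed.

Lemma pair_mul_real (l : R) p : pair_mul l%:C p = l *: p.
Proof.
by rewrite /pair_mul/= !scale0r subr0 addr0; case: p.
Qed.

Lemma eigenspace_eigenpair (l : R) u : Defs.eigenspace (schrodinger V) l%:C u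
  <->
  eigenpair D2 ip2 h2 l (real_pair u).
Proof.
split=> [/eigenspaceP|] [Du hu].
  by split => // q Dq; rewrite hu// pair_mul_real (formZl Hip)//; exact: DH.
apply/eigenspaceP; split => // q Dq.
by rewrite hu// pair_mul_real (formZl Hip)//; exact: DH.
Qed.

Lemma complex_fun_sum n (P : pred 'I_n) (c : 'I_n -> R) (e : 'I_n -> EE) x :
  complex_fun (\sum_(k | P k) c k *: e k) x = \sum_(k | P k) (c k)%:C *
    complex_fun (e k) x.
Proof.
elim/big_rec2 : _ => // k a p _ <-.
by apply: complex_eq; rewrite /= ?mul0r ?subr0 ?addr0.
Qed.

Lemma complex_funB p q x : complex_fun (p - q) x = complex_fun p x -
  complex_fun q x.
Proof. by apply: complex_eq. Qed.

Lemma spectrum_eigenpair z : spectrum mes (schrodinger V) z ->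
  exists l u, [/\ z = l%:C, Defs.eigenspace (schrodinger V) z u, ~ ae_zero mes
    u,
    eigenpair D2 ip2 h2 l (real_pair u) & ip2 (real_pair u) (real_pair u) != 0].
Proof.
move=> zS; have [[u uz u0]|//] := eigenvalue_or_resolvent z.
have zr := eigenvalue_real uz u0.
have zE : z = (complex.Re z)%:C by case: z zr {uz zS} => a b /= ->.
exists (complex.Re z), u; split => //; first by apply/eigenspace_eigenpair;
  rewrite -zE.
apply/eqP => ip0; apply: u0; apply/ae_zeroP => //; apply/L2P; apply: DH.
by have /eigenspaceP[] := uz.
Qed.

(** Every spectral point is a real eigenvalue, and the finite complete family for eigenvalues of
    modulus at most |l| + 1 contains all those at distance less than 1 from l. This bounds the
    multiplicity and isolates l at once. *)
Lemma schrodinger_discrete : discrete_spectrum mes (schrodinger V).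
Proof.
move=> z zS; have [l [u [zE uz u0 lu ip0]]] := spectrum_eigenpair zS.
have L0 : 0 < `|l| + 1 by rewrite ltr_wpDl.
have [n [lam [e [[eig _ _] eP]]]] := eigenfamily_complete HS Hip DS Dh DH
  compact2 L0.
split; last 2 first.
- by exists u.
(* The members of the family with another eigenvalue are replaced by 0, which lies in every
   eigenspace, to keep the same index set. *)
- exists n, (fun k => if lam k == l then complex_fun (e k) else cst 0); split.
    move=> k; rewrite zE; apply/eigenspace_eigenpair.
    case: ifPn => [/eqP kl|_]; first by rewrite complex_funK -kl.
    rewrite (_ : real_pair _ = 0)//; split; first exact: (subspace0 DS).
    by move=> q Dq; rewrite (form0l DS Dh)// (form0l HS Hip) ?mulr0//;
      exact: DH.
  move=> v; rewrite zE => /eigenspace_eigenpair lv.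
  have [Dv _] := lv.
  exists (fun k => if lam k == l then (ip2 (real_pair v) (e k))%:C else 0).
  have l1 : `|l| <= `|l| + 1 by rewrite lerDl.
  have := eP l _ lv l1 => /=.
  set w := _ - _ => w0.
  have Hw : H2 w.
    apply: DH; apply: (subspaceB DS) => //; apply: (subspace_sum DS) => k _.
    by have [] := eig k.
  have : ae_zero mes (complex_fun w).
    by apply/ae_zeroP; [exact: L2_complex_fun|rewrite complex_funK].
  apply: filterS => x; rewrite complex_funB real_pairK => /eqP;
    rewrite subr_eq0 => /eqP ->.
  rewrite complex_fun_sum big_mkcond; apply: eq_bigr => k _.
  by case: ifPn => //; rewrite mul0r.
(* The 1 in the minimum keeps a spectral point m with |m - l| < eps within |m| <= |l| + 1, the range
   of the family. *)
pose eps := \big[Num.min/(1 : R)]_(k | lam k != l) `|lam k - l|.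
exists eps.
  rewrite /eps; elim/big_ind : _ => //.
  - by move=> a b a0 b0; rewrite lt_min a0.
  - by move=> k kl; rewrite normr_gt0 subr_eq0.
move=> w wS; have [m [v [-> _ _ mv ipv]]] := spectrum_eigenpair wS.
rewrite zE => wz.
have norm_ml : Normc.normc (m%:C - l%:C) = `|m - l|.
  by rewrite /Normc.normc/= subrr expr0n addr0 sqrtr_sqr.
rewrite norm_ml in wz.
have m1 : `|m| <= `|l| + 1.
  rewrite -(subrK l m) addrC; apply: le_trans (ler_normD _ _) _; rewrite lerD2l.
  by apply: ltW; apply: lt_le_trans wz _; exact: bigmin_le_id.
have := eP m _ mv m1 => /= w0.
(* Otherwise the sum over the members with eigenvalue m would be empty and the eigenvector v itself
   null. *)
have [k /eqP km] : exists k, lam k == m.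
  apply: contrapT => nk; move/eqP: ipv; apply;
    rewrite -w0 big1 ?subr0// => k km.
  by exfalso; apply: nk; exists k.
have [<-|kl] := eqVneq (lam k) l; first by rewrite km.
have := @bigmin_le_cond _ R _ 1 k (fun k => lam k != l) (fun k => `|lam k - l|)
  kl.
rewrite -/eps.
by rewrite km leNgt wz.
Qed.

End discreteness.

Theorem theorem3p6 (R : realType) (d : nat) (hd : (3 <= d)%N)
    (V : 'rV[R]_d -> R) (hV : locally_integrable_rV V)
    (hV0 : \forall x \ae lebesgue_rV R d, 0 <= V x)
    (G : set 'rV[R]_d) (hG : admissible_domain G)
    (r0 : R) (hr0 : 0 < r0) (gamma : R -> R)
    (hgamma : forall r : R, 0 < r < r0 -> 0 < gamma r < 1)
    (hlimsup : limf_esup (fun r : R =>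
        (r `^ (- (2 * (d%:R - 2) / d%:R)) * gamma r)%:E) 0^'+ = +oo%E)
    (hJ : forall r : R, 0 < r < r0 ->
      let sigma := (1 - gamma r) *
        fine (lebesgue_rV R d (scaled_domain G r 0)) in
      J_functional V G sigma y r @[y --> enorm_infty R d] --> +oo%E) :
  discrete_spectrum (lebesgue_rV R d) (schrodinger V).
Proof.
have [mV _] := hV.
apply: schrodinger_discrete => // e e0.
exact: (dirichlet_compact (ltn_trans (ltn0Sn 1) hd) mV hG hr0 hgamma hlimsup hJ e0).
Qed.
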